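(* Let $n\geq 5$, let $H$ be a hereditary $k$-algebra of Dynkin type $D_n$, and let $T$ and $T'$ be basic tilting objects in the cluster category $\mathscr{C}_H$. Then the cluster-tilted algebras $\Gamma=\mathrm{End}_{\mathscr{C}_H}(T)^{\rm op}$ and $\Gamma'=\mathrm{End}_{\mathscr{C}_H}(T')^{\rm op}$ are isomorphic if and only if $T\cong\tau^i T'$ or $T\cong\sigma\tau^j T'$ for some integers $i$ and $j$.
   Context: $k$ is a fixed field. A hereditary $k$-algebra of type $D_n$ is the path algebra of a quiver whose underlying graph is the Dynkin diagram $D_n$. The cluster category of $H$ is the orbit category $\mathscr{C}_H=\mathscr{D}^b(\mathrm{mod}\,H)/\tau^{-1}[1]$, which is a triangulated category; $\tau$ denotes its Auslander-Reiten translation. A basic tilting object in $\mathscr{C}_H$ is an object $T$ which is a direct sum of $n$ pairwise non-isomorphic indecomposable objects and satisfies $\mathrm{Ext}^1_{\mathscr{C}_H}(T,T)=0$. The automorphism $\sigma$ of $\mathscr{C}_H$ is defined through the following geometric model. Let $\mathbf{P}_n$ be the polygon with $n$ vertices on its boundary and one puncture in its center. For boundary vertices $a\ne b$, let $\delta_{a,b}$ be the path along the boundary from $a$ to $b$ in counterclockwise direction not running through the same point twice, and let $|\delta_{a,b}|$ be the number of vertices on it (including $a$ and $b$). The set $E'$ of tagged edges consists of the symbols $M_{a,b}$ for $a\neq b$ with $|\delta_{a,b}|\ge 3$ (the homotopy class of paths from $a$ to $b$ in the interior of $\mathbf{P}_n$, homotopic to $\delta_{a,b}$), and $M_{a,a}^{\epsilon}$,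 $\epsilon=\pm1$, for every boundary vertex $a$ (drawn as a line from $a$ to the puncture, with a tag if $\epsilon=-1$). The translation on $E'$ is $\tau M_{a,b}=M_{a',b'}$ for $a\neq b$ and $\tau M_{a,a}^{\epsilon}=M_{a',a'}^{-\epsilon}$, where $x'$ is the clockwise neighbor of $x$. The category of tagged edges $\mathcal{C}$ is the $k$-linear additive category whose objects are direct sums of tagged edges; morphisms between tagged edges are spanned by sequences of elementary moves modulo the mesh relations (for each $M\in E'$, the sum of all compositions $\tau M\to X\to M$ of two elementary moves is zero). The elementary moves are as follows, where $c,d$ are the counterclockwise neighbors of $a,b$ respectively: $M_{a,b}\to M_{a,d}$ if $3\le|\delta_{a,b}|\le n-1$; $M_{a,b}\to M_{c,b}$ if $4\le|\delta_{a,b}|\le n$; $M_{a,b}\to M_{a,a}^{1}$ and $M_{a,b}\to M_{a,a}^{-1}$ if $|\delta_{a,b}|=n$; $M_{a,a}^{\epsilon}\to M_{c,a}$. There is (Schiffler) an equivalence of categories $\varphi:\mathcal{C}\to\mathscr{C}_H$, compatible with the translations $\tau$. The automorphism $\sigma$ of $\mathcal{C}$ is given by $\sigma(M_{a,b})=M_{a,b}$ if $a\ne b$ and $\sigma(M_{a,a}^{\epsilon})=M_{a,a}^{-\epsilon}$; it satisfies $\sigma^2=1$ and $\sigma\tau=\tau\sigma$. The automorphism of $\mathscr{C}_H$ induced by it via $\varphi$ is again denoted $\sigma$. *)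

(* Defs.v *)
From HB Require Import structures.
From mathcomp Require Import all_boot all_order all_algebra.
From mathcomp Require Import zify boolp.

Set Implicit Arguments.
Unset Strict Implicit.
Unset Printing Implicit Defensive.

Import GRing.Theory.
Local Open Scope ring_scope.
Local Open Scope quotient_scope.

Record kcat (k : fieldType) := KCat {
  ob :> Type;
  hom : ob -> ob -> lmodType k;
  idc : forall X, hom X X;
  comp : forall X Y Z, hom Y Z -> hom X Y -> hom X Z;
  compA : forall X Y Z W (h : hom Z W) (g : hom Y Z) (f : hom X Y),
    comp h (comp g f) = comp (comp h g) f;
  comp1c : forall X Y (f : hom X Y), comp (idc Y) f = f;
  compc1 : forall X Y (f : hom X Y), comp f (idc X) = f;
  comp_linl : forall X Y Z a (g g' : hom Y Z) (f : hom X Y),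
    comp (a *: g + g') f = a *: comp g f + comp g' f;
  comp_linr : forall X Y Z a (g : hom Y Z) (f f' : hom X Y),
    comp g (a *: f + f') = a *: comp g f + comp g f' }.

Arguments hom {k C} : rename.
Arguments idc {k C} X : rename.
Arguments comp {k C X Y Z} g f : rename.

Declare Scope kcat_scope.
Delimit Scope kcat_scope with KC.
Local Open Scope kcat_scope.
Notation "g \oc f" := (comp g f) (at level 40, left associativity) : kcat_scope.

Section CompTheory.
Variables (k : fieldType) (C : kcat k).
Implicit Types X Y Z : C.

Lemma comp0c X Y Z (f : hom X Y) : (0 : hom Y Z) \oc f = 0.
Proof.
have := comp_linl (-1) (0 : hom Y Z) 0 f.
by rewrite scaler0 addr0 scaleN1r addNr.
Qed.

Lemma compc0 X Y Z (g : hom Y Z) : g \oc (0 : hom X Y) = 0.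
Proof.
have := comp_linr (-1) g (0 : hom X Y) 0.
by rewrite scaler0 addr0 scaleN1r addNr.
Qed.

Lemma compDl X Y Z (g g' : hom Y Z) (f : hom X Y) :
  (g + g') \oc f = g \oc f + g' \oc f.
Proof. by have := comp_linl 1 g g' f; rewrite !scale1r. Qed.

Lemma compDr X Y Z (g : hom Y Z) (f f' : hom X Y) :
  g \oc (f + f') = g \oc f + g \oc f'.
Proof. by have := comp_linr 1 g f f'; rewrite !scale1r. Qed.

Lemma compZl X Y Z a (g : hom Y Z) (f : hom X Y) :
  (a *: g) \oc f = a *: (g \oc f).
Proof. by have := comp_linl a g 0 f; rewrite comp0c !addr0. Qed.

Lemma compZr X Y Z a (g : hom Y Z) (f : hom X Y) :
  g \oc (a *: f) = a *: (g \oc f).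
Proof. by have := comp_linr a g f 0; rewrite compc0 !addr0. Qed.

Lemma comp_suml X Y Z (I : finType) (g : I -> hom Y Z) (f : hom X Y) :
  (\sum_i g i) \oc f = \sum_i (g i \oc f).
Proof.
by elim/big_rec2: _ => [|i y x _ <-]; rewrite ?comp0c ?compDl.
Qed.

Lemma comp_sumr X Y Z (I : finType) (g : hom Y Z) (f : I -> hom X Y) :
  g \oc (\sum_i f i) = \sum_i (g \oc f i).
Proof.
by elim/big_rec2: _ => [|i y x _ <-]; rewrite ?compc0 ?compDr.
Qed.

End CompTheory.

Section InCategory.
Variables (k : fieldType) (C : kcat k).

Definition isom (X Y : C) : Prop :=
  exists (f : hom X Y) (g : hom Y X), g \oc f = idc X /\ f \oc g = idc Y.

Definition zero_object (X : C) : Prop := idc X = 0.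

Definition is_direct_sum (I : finType) (X : I -> C) (S : C) : Prop :=
  exists (inj : forall i, hom (X i) S) (prj : forall i, hom S (X i)),
    [/\ forall i, prj i \oc inj i = idc (X i),
        forall i j, i != j -> prj j \oc inj i = 0
      & \sum_i (inj i \oc prj i) = idc S].

Definition indecomposable (X : C) : Prop :=
  ~ zero_object X /\
  forall A B : C, is_direct_sum (fun b : bool => if b then A else B) X ->
    zero_object A \/ zero_object B.

(** The algebra End(T)^op: the product is the opposite of composition. *)
Definition endop (T : C) : Type := hom T T.

End InCategory.

HB.instance Definition _ (k : fieldType) (C : kcat k) (T : C) :=
  GRing.Lmodule.copy (endop T) (hom T T).
HB.instance Definition _ (k : fieldType) (C : kcat k) (T : C) :=
  GRing.Zmodule_isPzRing.Build (endop T)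
    (fun x y z : endop T => esym (compA z y x))
    (fun x : endop T => compc1 x) (fun x : endop T => comp1c x)
    (fun x y z : endop T => compDr z x y)
    (fun x y z : endop T => compDl y z x).

Definition endop_isomorphic (k : fieldType) (C : kcat k) (T T' : C) : Prop :=
  exists f : {linear endop T -> endop T'}, bijective f /\ monoid_morphism f.

Record kfunctor (k : fieldType) (A B : kcat k) := KFunctor {
  fob :> A -> B;
  fmap : forall X Y, hom X Y -> hom (fob X) (fob Y);
  fmap_id : forall X, fmap (idc X) = idc (fob X);
  fmap_comp : forall X Y Z (g : hom Y Z) (f : hom X Y),
    fmap (g \oc f) = fmap g \oc fmap f;
  fmap_lin : forall X Y a (f g : hom X Y),
    fmap (a *: f + g) = a *: fmap f + fmap g }.

Arguments fmap {k A B} F {X Y} f : rename.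

Definition fun_id (k : fieldType) (A : kcat k) : kfunctor A A.
Proof. by exists (fun X : A => X) (fun _ _ f => f). Defined.

Definition fun_comp (k : fieldType) (A B C : kcat k)
  (G : kfunctor B C) (F : kfunctor A B) : kfunctor A C.
Proof.
exists (fun X => G (F X)) (fun _ _ f => fmap G (fmap F f)) => *.
- by rewrite !fmap_id.
- by rewrite !fmap_comp.
- by rewrite !fmap_lin.
Defined.

Record natiso (k : fieldType) (A B : kcat k) (F G : kfunctor A B) := NatIso {
  nfwd : forall X : A, hom (F X) (G X);
  nbwd : forall X : A, hom (G X) (F X);
  nfwdK : forall X, nbwd X \oc nfwd X = idc (F X);
  nbwdK : forall X, nfwd X \oc nbwd X = idc (G X);
  nfwd_nat : forall X Y (f : hom X Y),
    nfwd Y \oc fmap F f = fmap G f \oc nfwd X }.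

Arguments nfwd {k A B F G} e X : rename.
Arguments nbwd {k A B F G} e X : rename.

Record kequiv (k : fieldType) (A B : kcat k) := KEquiv {
  efun :> kfunctor A B;
  einv : kfunctor B A;
  eunit : natiso (fun_id A) (fun_comp einv efun);
  ecounit : natiso (fun_comp efun einv) (fun_id B) }.

(** Generators and relations: the objects are those of [O]; the morphisms are
    the k-linear combinations of formal composites of the generators [G],
    modulo the two-sided ideal generated by the relations [R]. They are encoded
    as terms modulo the least congruence containing [R] and the axioms of
    k-linear categories. *)

Section Presented.
Variables (k : fieldType) (O : Type) (G : O -> O -> Type).

Inductive term : O -> O -> Type :=
| TGen X Y of G X Y : term X Y
| TId X : term X X
| TComp X Y Z of term Y Z & term X Y : term X Z
| TZero X Y : term X Y
| TAdd X Y of term X Y & term X Y : term X Y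
| TScale X Y of k & term X Y : term X Y.

Definition TSum (I : Type) (s : seq I) X Y (f : I -> term X Y) : term X Y :=
  foldr (fun i t => TAdd (f i) t) (TZero X Y) s.

Variable R : forall X Y, term X Y -> term X Y -> Prop.

Inductive teq : forall X Y, term X Y -> term X Y -> Prop :=
| teq_rel X Y (s t : term X Y) : R s t -> teq s t
| teq_refl X Y (t : term X Y) : teq t t
| teq_sym X Y (s t : term X Y) : teq s t -> teq t s
| teq_trans X Y (t s u : term X Y) : teq s t -> teq t u -> teq s u
| teq_comp X Y Z (s s' : term Y Z) (t t' : term X Y) :
    teq s s' -> teq t t' -> teq (TComp s t) (TComp s' t')
| teq_add X Y (s s' t t' : term X Y) :
    teq s s' -> teq t t' -> teq (TAdd s t) (TAdd s' t')
| teq_scale X Y a (t t' : term X Y) :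
    teq t t' -> teq (TScale a t) (TScale a t')
| teq_addA X Y (s t u : term X Y) : teq (TAdd s (TAdd t u)) (TAdd (TAdd s t) u)
| teq_addC X Y (s t : term X Y) : teq (TAdd s t) (TAdd t s)
| teq_add0 X Y (t : term X Y) : teq (TAdd (TZero X Y) t) t
| teq_addN X Y (t : term X Y) : teq (TAdd (TScale (-1) t) t) (TZero X Y)
| teq_scaleA X Y a b (t : term X Y) :
    teq (TScale a (TScale b t)) (TScale (a * b) t)
| teq_scale1 X Y (t : term X Y) : teq (TScale 1 t) t
| teq_scaleDr X Y a (s t : term X Y) :
    teq (TScale a (TAdd s t)) (TAdd (TScale a s) (TScale a t))
| teq_scaleDl X Y a b (t : term X Y) :
    teq (TScale (a + b) t) (TAdd (TScale a t) (TScale b t))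
| teq_compA X Y Z W (s : term Z W) (t : term Y Z) (u : term X Y) :
    teq (TComp s (TComp t u)) (TComp (TComp s t) u)
| teq_id_comp X Y (t : term X Y) : teq (TComp (TId Y) t) t
| teq_comp_id X Y (t : term X Y) : teq (TComp t (TId X)) t
| teq_compDl X Y Z (s s' : term Y Z) (t : term X Y) :
    teq (TComp (TAdd s s') t) (TAdd (TComp s t) (TComp s' t))
| teq_compZl X Y Z a (s : term Y Z) (t : term X Y) :
    teq (TComp (TScale a s) t) (TScale a (TComp s t))
| teq_compDr X Y Z (s : term Y Z) (t t' : term X Y) :
    teq (TComp s (TAdd t t')) (TAdd (TComp s t) (TComp s t'))
| teq_compZr X Y Z a (s : term Y Z) (t : term X Y) :
    teq (TComp s (TScale a t)) (TScale a (TComp s t)).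

HB.instance Definition _ X Y := gen_eqMixin (term X Y).
HB.instance Definition _ X Y := gen_choiceMixin (term X Y).

Section Quotient.
Variables X Y : O.

Definition teqb : rel (term X Y) := fun s t => `[< teq s t >].

Lemma teqb_refl : reflexive teqb.
Proof. by move=> t; apply/asboolP/teq_refl. Qed.

Lemma teqb_sym : symmetric teqb.
Proof. by move=> s t; apply/asboolP/asboolP; apply: teq_sym. Qed.

Lemma teqb_trans : transitive teqb.
Proof.
by move=> t s u /asboolP st /asboolP tu; apply/asboolP/(teq_trans st tu).
Qed.

Canonical teqb_equiv := EquivRel teqb teqb_refl teqb_sym teqb_trans.

Definition phom : Type := {eq_quot teqb_equiv}.
HB.instance Definition _ := Choice.on phom.
HB.instance Definition _ := Quotient.on phom.

End Quotient.

Definition pcls X Y (t : term X Y) : phom X Y := \pi_(phom X Y) t.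

Lemma pclsP X Y (s t : term X Y) : pcls s = pcls t <-> teq s t.
Proof.
split=> [e|e]; first by apply/asboolP/(@eqmodP _ (teqb_equiv X Y)).
by apply/(@eqmodP _ (teqb_equiv X Y))/asboolP.
Qed.

Lemma phom_ind X Y (P : phom X Y -> Prop) :
  (forall t, P (pcls t)) -> forall x, P x.
Proof. by move=> Pt x; rewrite -[x]reprK; apply: Pt. Qed.

Lemma repr_pcls X Y (t : term X Y) : teq (repr (pcls t)) t.
Proof. by apply/pclsP; rewrite /pcls reprK. Qed.

Definition padd X Y (x y : phom X Y) := pcls (TAdd (repr x) (repr y)).
Definition pscale X Y a (x : phom X Y) := pcls (TScale a (repr x)).
Definition pcomp X Y Z (x : phom Y Z) (y : phom X Y) :=
  pcls (TComp (repr x) (repr y)).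

Lemma paddE X Y (s t : term X Y) : padd (pcls s) (pcls t) = pcls (TAdd s t).
Proof. by apply/pclsP/teq_add; apply: repr_pcls. Qed.
Lemma pscaleE X Y a (t : term X Y) : pscale a (pcls t) = pcls (TScale a t).
Proof. by apply/pclsP/teq_scale; apply: repr_pcls. Qed.
Lemma pcompE X Y Z (s : term Y Z) (t : term X Y) :
  pcomp (pcls s) (pcls t) = pcls (TComp s t).
Proof. by apply/pclsP/teq_comp; apply: repr_pcls. Qed.

Section Module.
Variables X Y : O.

Lemma paddA : associative (@padd X Y).
Proof.
elim/phom_ind=> s; elim/phom_ind=> t; elim/phom_ind=> u.
by rewrite !paddE; apply/pclsP/teq_addA.
Qed.
Lemma paddC : commutative (@padd X Y).
Proof.
elim/phom_ind=> s; elim/phom_ind=> t.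
by rewrite !paddE; apply/pclsP/teq_addC.
Qed.
Lemma padd0 : left_id (pcls (TZero X Y)) (@padd X Y).
Proof. by elim/phom_ind=> t; rewrite !paddE; apply/pclsP/teq_add0. Qed.
Lemma paddN : left_inverse (pcls (TZero X Y)) (pscale (-1)) (@padd X Y).
Proof.
by elim/phom_ind=> t; rewrite pscaleE paddE; apply/pclsP/teq_addN.
Qed.

HB.instance Definition _ :=
  GRing.isZmodule.Build (phom X Y) paddA paddC padd0 paddN.

Lemma pscaleA a b (x : phom X Y) : pscale a (pscale b x) = pscale (a * b) x.
Proof.
by elim/phom_ind: x => t; rewrite !pscaleE; apply/pclsP/teq_scaleA.
Qed.
Lemma pscale1 : left_id 1 (@pscale X Y).
Proof. by elim/phom_ind=> t; rewrite pscaleE; apply/pclsP/teq_scale1. Qed.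
Lemma pscaleDr : right_distributive (@pscale X Y) +%R.
Proof.
move=> a; elim/phom_ind=> s; elim/phom_ind=> t.
by rewrite /GRing.add /= !(pscaleE, paddE); apply/pclsP/teq_scaleDr.
Qed.
Lemma pscaleDl (x : phom X Y) : {morph (@pscale X Y)^~ x : a b / a + b}.
Proof.
move=> a b; elim/phom_ind: x => t.
by rewrite !pscaleE [RHS]paddE; apply/pclsP/teq_scaleDl.
Qed.

HB.instance Definition _ := GRing.Zmodule_isLmodule.Build k (phom X Y)
  pscaleA pscale1 pscaleDr pscaleDl.

End Module.

Lemma pclsD X Y (s t : term X Y) : pcls (TAdd s t) = pcls s + pcls t.
Proof. by rewrite -paddE. Qed.
Lemma pclsZ X Y a (t : term X Y) : pcls (TScale a t) = a *: pcls t.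
Proof. by rewrite -pscaleE. Qed.
Lemma pcls0 X Y : pcls (TZero X Y) = 0. Proof. by []. Qed.

Lemma pcompA X Y Z W (x : phom Z W) (y : phom Y Z) (z : phom X Y) :
  pcomp x (pcomp y z) = pcomp (pcomp x y) z.
Proof.
elim/phom_ind: x => s; elim/phom_ind: y => t; elim/phom_ind: z => u.
by rewrite !pcompE; apply/pclsP/teq_compA.
Qed.
Lemma pcomp1c X Y (x : phom X Y) : pcomp (pcls (TId Y)) x = x.
Proof. by elim/phom_ind: x => t; rewrite pcompE; apply/pclsP/teq_id_comp. Qed.
Lemma pcompc1 X Y (x : phom X Y) : pcomp x (pcls (TId X)) = x.
Proof. by elim/phom_ind: x => t; rewrite pcompE; apply/pclsP/teq_comp_id. Qed.
Lemma pcomp_linl X Y Z a (x x' : phom Y Z) (y : phom X Y) :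
  pcomp (a *: x + x') y = a *: pcomp x y + pcomp x' y.
Proof.
elim/phom_ind: x => s; elim/phom_ind: x' => s'; elim/phom_ind: y => t.
rewrite -pclsZ -pclsD !pcompE -pclsZ -pclsD; apply/pclsP.
apply: teq_trans (teq_compDl _ _ _) _.
by apply: teq_add (teq_refl _); apply: teq_compZl.
Qed.
Lemma pcomp_linr X Y Z a (x : phom Y Z) (y y' : phom X Y) :
  pcomp x (a *: y + y') = a *: pcomp x y + pcomp x y'.
Proof.
elim/phom_ind: x => s; elim/phom_ind: y => t; elim/phom_ind: y' => t'.
rewrite -pclsZ -pclsD !pcompE -pclsZ -pclsD; apply/pclsP.
apply: teq_trans (teq_compDr _ _ _) _.
by apply: teq_add (teq_refl _); apply: teq_compZr.
Qed.

Definition presented : kcat k :=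
  @KCat k O (fun X Y => phom X Y) (fun X => pcls (TId X)) pcomp
    pcompA pcomp1c pcompc1 pcomp_linl pcomp_linr.

Section Lift.
Variables (B : kcat k) (fo : O -> B).
Variable fg : forall X Y, G X Y -> hom (fo X) (fo Y).

Fixpoint teval X Y (t : term X Y) : hom (fo X) (fo Y) :=
  match t in term X Y return hom (fo X) (fo Y) with
  | TGen _ _ g => fg g
  | TId X => idc (fo X)
  | TComp _ _ _ s t => teval s \oc teval t
  | TZero _ _ => 0
  | TAdd _ _ s t => teval s + teval t
  | TScale _ _ a t => a *: teval t
  end.

Hypothesis fgR : forall X Y (s t : term X Y), R s t -> teval s = teval t.

Lemma teval_teq X Y (s t : term X Y) : teq s t -> teval s = teval t.
Proof.
elim=> {X Y s t} /=.
- exact: fgR.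
- by [].
- by move=> X Y s t _ ->.
- by move=> X Y t s u _ -> _ ->.
- by move=> X Y Z s s' t t' _ -> _ ->.
- by move=> X Y s s' t t' _ -> _ ->.
- by move=> X Y a t t' _ ->.
- by move=> *; rewrite addrA.
- by move=> *; rewrite addrC.
- by move=> *; rewrite add0r.
- by move=> *; rewrite scaleN1r addNr.
- by move=> *; rewrite scalerA.
- by move=> *; rewrite scale1r.
- by move=> *; rewrite scalerDr.
- by move=> *; rewrite scalerDl.
- by move=> *; rewrite compA.
- by move=> *; rewrite comp1c.
- by move=> *; rewrite compc1.
- by move=> *; rewrite compDl.
- by move=> *; rewrite compZl.
- by move=> *; rewrite compDr.
- by move=> *; rewrite compZr.
Qed.

Lemma teval_repr X Y (t : term X Y) : teval (repr (pcls t)) = teval t.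
Proof. exact/teval_teq/repr_pcls. Qed.

Definition lift_map X Y (x : phom X Y) : hom (fo X) (fo Y) := teval (repr x).

Lemma lift_map_id X : lift_map (pcls (TId X)) = idc (fo X).
Proof. exact: teval_repr. Qed.
Lemma lift_map_comp X Y Z (x : phom Y Z) (y : phom X Y) :
  lift_map (pcomp x y) = lift_map x \oc lift_map y.
Proof.
elim/phom_ind: x => s; elim/phom_ind: y => t.
by rewrite /lift_map pcompE !teval_repr.
Qed.
Lemma lift_map_lin X Y a (x y : phom X Y) :
  lift_map (a *: x + y) = a *: lift_map x + lift_map y.
Proof.
elim/phom_ind: x => s; elim/phom_ind: y => t.
by rewrite -pclsZ -pclsD /lift_map !teval_repr.
Qed.

Definition lift_functor : kfunctor presented B :=
  @KFunctor k presented B fo lift_map lift_map_id lift_map_comp lift_map_lin.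

End Lift.
End Presented.

(** The additive hull: objects are finite sequences of objects (read as their
    direct sum), morphisms are matrices of morphisms. *)

Section AdditiveHull.
Variables (k : fieldType) (C : kcat k).

Definition summand (s : seq C) (i : 'I_(size s)) : C := tnth (in_tuple s) i.

Definition hhom (s t : seq C) : Type :=
  forall (i : 'I_(size s)) (j : 'I_(size t)), hom (summand i) (summand j).

HB.instance Definition _ s t := gen_eqMixin (hhom s t).
HB.instance Definition _ s t := gen_choiceMixin (hhom s t).

Lemma hhomP s t (f g : hhom s t) : (forall i j, f i j = g i j) -> f = g.
Proof.
move=> fg; apply: functional_extensionality_dep => i.
exact/functional_extensionality_dep/fg.
Qed.

Definition hadd s t (f g : hhom s t) : hhom s t := fun i j => f i j + g i j.
Definition hopp s t (f : hhom s t) : hhom s t := fun i j => - f i j.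
Definition hzero s t : hhom s t := fun i j => 0.
Definition hscale s t a (f : hhom s t) : hhom s t := fun i j => a *: f i j.

Section Module.
Variables s t : seq C.

Lemma haddA : associative (@hadd s t).
Proof. by move=> f g h; apply: hhomP => i j; apply: addrA. Qed.
Lemma haddC : commutative (@hadd s t).
Proof. by move=> f g; apply: hhomP => i j; apply: addrC. Qed.
Lemma hadd0 : left_id (@hzero s t) (@hadd s t).
Proof. by move=> f; apply: hhomP => i j; apply: add0r. Qed.
Lemma haddN : left_inverse (@hzero s t) (@hopp s t) (@hadd s t).
Proof. by move=> f; apply: hhomP => i j; apply: addNr. Qed.

HB.instance Definition _ :=
  GRing.isZmodule.Build (hhom s t) haddA haddC hadd0 haddN.

Lemma hscaleA a b (f : hhom s t) : hscale a (hscale b f) = hscale (a * b) f.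
Proof. by apply: hhomP => i j; apply: scalerA. Qed.
Lemma hscale1 : left_id 1 (@hscale s t).
Proof. by move=> f; apply: hhomP => i j; apply: scale1r. Qed.
Lemma hscaleDr : right_distributive (@hscale s t) +%R.
Proof. by move=> a f g; apply: hhomP => i j; apply: scalerDr. Qed.
Lemma hscaleDl (f : hhom s t) : {morph (@hscale s t)^~ f : a b / a + b}.
Proof. by move=> a b; apply: hhomP => i j; apply: scalerDl. Qed.

HB.instance Definition _ := GRing.Zmodule_isLmodule.Build k (hhom s t)
  hscaleA hscale1 hscaleDr hscaleDl.

End Module.

Definition hid (s : seq C) : hhom s s := fun i j =>
  if i =P j is ReflectT e
  then ecast j (hom (summand i) (summand j)) e (idc (summand i)) else 0.

Definition hcomp (s t u : seq C) (g : hhom t u) (f : hhom s t) : hhom s u :=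
  fun i l => \sum_j (g j l \oc f i j).

Lemma hidE s (i : 'I_(size s)) : @hid s i i = idc (summand i).
Proof. by rewrite /hid; case: eqP => // e; rewrite eq_axiomK. Qed.

Lemma hidN s (i j : 'I_(size s)) : i != j -> @hid s i j = 0.
Proof. by rewrite /hid; case: eqP. Qed.

Definition additive_hull : kcat k.
Proof.
refine (@KCat k (seq C) (fun s t => hhom s t) hid hcomp _ _ _ _ _).
- move=> s t u v h g f; apply: hhomP => i l; rewrite /hcomp.
  under eq_bigr do rewrite comp_sumr.
  rewrite exchange_big; apply: eq_bigr => j _ /=.
  by rewrite comp_suml; apply: eq_bigr => m _; rewrite compA.
- move=> s t f; apply: hhomP => i j; rewrite /hcomp (bigD1 j) //= hidE comp1c.
  by rewrite big1 ?addr0 // => l lj; rewrite hidN // comp0c.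
- move=> s t f; apply: hhomP => i j; rewrite /hcomp (bigD1 i) //= hidE compc1.
  by rewrite big1 ?addr0 // => l li; rewrite hidN 1?eq_sym // compc0.
- move=> s t u a g g' f; apply: hhomP => i l.
  rewrite [RHS](_ : _ = a *: (\sum_j (g j l \oc f i j))
    + \sum_j (g' j l \oc f i j)) // scaler_sumr -big_split.
  by apply: eq_bigr => j _; apply: comp_linl.
- move=> s t u a g f f'; apply: hhomP => i l.
  rewrite [RHS](_ : _ = a *: (\sum_j (g j l \oc f i j))
    + \sum_j (g j l \oc f' i j)) // scaler_sumr -big_split.
  by apply: eq_bigr => j _; apply: comp_linr.
Defined.

End AdditiveHull.

(** The diagram D_n, n >= 4, on the vertices 0, ..., n-1: the chain
    0 - 1 - ... - (n-2), together with the edge (n-3) - (n-1). *)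
Definition D_edge (n : nat) (i j : 'I_n) : bool :=
  let half (i j : nat) :=
    ((i.+1 == j) && (j <= n - 2)%N) || ((i == n - 3)%N && (j == n - 1)%N) in
  half i j || half j i.

(** A quiver (without multiple arrows) with underlying graph D_n;
    [Q i j] means that there is an arrow i -> j. *)
Definition D_quiver (n : nat) (Q : rel 'I_n) : Prop :=
  (forall i j, Q i j -> D_edge i j) /\
  (forall i j, D_edge i j -> Q i j (+) Q j i).

(** The path v_0 -> v_1 -> ... -> v_m is encoded as the pair
    (v_0, [:: v_1; ...; v_m]). *)
Definition is_qpath (n : nat) (Q : rel 'I_n) (p : 'I_n * seq 'I_n) : bool :=
  path Q p.1 p.2.

(** H has a k-basis indexed by the paths of Q, multiplied by concatenation. *)
Definition is_path_algebra (k : fieldType) (n : nat) (Q : rel 'I_n)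
    (H : algType k) : Prop :=
  exists b : 'I_n * seq 'I_n -> H,
    [/\ forall h : H, exists (s : seq ('I_n * seq 'I_n))
          (c : 'I_n * seq 'I_n -> k),
          all (is_qpath Q) s /\ h = \sum_(p <- s) c p *: b p,
        forall (s : seq ('I_n * seq 'I_n)) (c : 'I_n * seq 'I_n -> k),
          uniq s -> all (is_qpath Q) s -> \sum_(p <- s) c p *: b p = 0 ->
          {in s, forall p, c p = 0},
        1 = \sum_(v : 'I_n) b (v, [::])
      & forall p q, is_qpath Q p -> is_qpath Q q ->
          b p * b q = if last p.1 p.2 == q.1 then b (p.1, p.2 ++ q.2) else 0].

Definition hereditary_of_type_D (k : fieldType) (n : nat) (H : algType k) :
    Prop :=
  exists2 Q : rel 'I_n, D_quiver Q & is_path_algebra Q H.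

Section Derived.
Variables (k : fieldType) (H : algType k).

(** A finite-dimensional left module, with underlying space the column vectors
    'cV[k]_mdim. *)
Record fdmod := FdMod {
  mdim : nat;
  mact : H -> 'M[k]_mdim;
  mact_lin : forall a x y, mact (a *: x + y) = a *: mact x + mact y;
  mact1 : mact 1 = 1%:M;
  mactM : forall x y, mact (x * y) = mact x *m mact y }.

Definition is_modhom (M N : fdmod) (f : 'M[k]_(mdim N, mdim M)) : Prop :=
  forall h : H, f *m mact M h = mact N h *m f.

Record complex := Complex {
  cob :> int -> fdmod;
  cdiff : forall i : int, 'M[k]_(mdim (cob (i + 1)), mdim (cob i));
  cdiff_hom : forall i, @is_modhom (cob i) (cob (i + 1)) (cdiff i);
  cdiff2 : forall i, cdiff (i + 1) *m cdiff i = 0;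
  cbounded : exists N : nat, forall i : int, (N%:Z < `|i|)%R -> mdim (cob i) = 0%N }.

Record chain_map (X Y : complex) := ChainMap {
  cmap :> forall i : int, 'M[k]_(mdim (Y i), mdim (X i));
  cmap_hom : forall i, @is_modhom (X i) (Y i) (cmap i);
  cmap_diff : forall i, cmap (i + 1) *m cdiff X i = cdiff Y i *m cmap i }.

Definition chain_id (X : complex) : chain_map X X.
Proof.
exists (fun i => 1%:M) => i; first by move=> h; rewrite mul1mx mulmx1.
by rewrite mul1mx mulmx1.
Defined.

Definition chain_comp (X Y Z : complex) (g : chain_map Y Z) (f : chain_map X Y) :
  chain_map X Z.
Proof.
exists (fun i => g i *m f i) => i.
  by move=> h; rewrite -mulmxA (cmap_hom f) mulmxA (cmap_hom g) mulmxA.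
by rewrite -[LHS]mulmxA (cmap_diff f) [LHS]mulmxA (cmap_diff g) [RHS]mulmxA.
Defined.

Definition chain_lin (X Y : complex) (a : k) (f g : chain_map X Y) :
  chain_map X Y.
Proof.
exists (fun i => a *: f i + g i) => i.
  move=> h; rewrite mulmxDl mulmxDr -scalemxAl -scalemxAr.
  by rewrite (cmap_hom f) (cmap_hom g).
rewrite mulmxDl mulmxDr -scalemxAl -scalemxAr.
by rewrite (cmap_diff f) (cmap_diff g).
Defined.

(** f induces a bijection on cohomology in each degree i + 1. *)
Definition quasi_iso (X Y : complex) (f : chain_map X Y) : Prop :=
  forall i : int,
    (forall z : 'cV[k]_(mdim (X (i + 1))), cdiff X (i + 1) *m z = 0 ->
       (exists y, f (i + 1) *m z = cdiff Y i *m y) ->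
       exists x, z = cdiff X i *m x) /\
    (forall w : 'cV[k]_(mdim (Y (i + 1))), cdiff Y (i + 1) *m w = 0 ->
       exists z y, cdiff X (i + 1) *m z = 0 /\
         w = f (i + 1) *m z + cdiff Y i *m y).

(** D^b(mod H) is the localization of the category of bounded complexes at the
    quasi-isomorphisms: the chain maps are generators, and each
    quasi-isomorphism [s : X -> Y] gets a formal inverse [DInv s : Y -> X]. *)
Inductive derived_gen : complex -> complex -> Type :=
| DMap X Y of chain_map X Y : derived_gen X Y
| DInv X Y (s : chain_map X Y) of quasi_iso s : derived_gen Y X.

Local Notation dterm := (term k derived_gen).
Local Notation dmap f := (TGen k (DMap f)).
Local Notation dinv qs := (TGen k (DInv qs)).

Inductive derived_rel : forall X Y, dterm X Y -> dterm X Y -> Prop :=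
| DRId X : derived_rel (dmap (chain_id X)) (TId k derived_gen X)
| DRComp X Y Z (g : chain_map Y Z) (f : chain_map X Y) :
    derived_rel (dmap (chain_comp g f)) (TComp (dmap g) (dmap f))
| DRLin X Y a (f g : chain_map X Y) :
    derived_rel (dmap (chain_lin a f g)) (TAdd (TScale a (dmap f)) (dmap g))
| DRInvl X Y (s : chain_map X Y) (qs : quasi_iso s) :
    derived_rel (TComp (dinv qs) (dmap s)) (TId k derived_gen X)
| DRInvr X Y (s : chain_map X Y) (qs : quasi_iso s) :
    derived_rel (TComp (dmap s) (dinv qs)) (TId k derived_gen Y).

Definition Db : kcat k := presented derived_rel.

Lemma shift_bounded (X : complex) :
  exists N : nat, forall i : int, (N%:Z < `|i|)%R -> mdim (X (i + 1)) = 0%N.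
Proof. by have [N XN] := cbounded X; exists N.+1 => i Ni; apply: XN; lia. Qed.

Definition complex_shift (X : complex) : complex.
Proof.
refine (@Complex (fun i => X (i + 1)) (fun i => - cdiff X (i + 1)) _ _
  (shift_bounded X)).
- by move=> i h; rewrite mulNmx mulmxN (cdiff_hom X).
- by move=> i; rewrite mulNmx mulmxN opprK cdiff2.
Defined.

Definition chain_shift (X Y : complex) (f : chain_map X Y) :
  chain_map (complex_shift X) (complex_shift Y).
Proof.
exists (fun i => f (i + 1)) => i; first exact: (cmap_hom f).
by rewrite mulmxN mulNmx (cmap_diff f).
Defined.

Lemma quasi_iso_shift (X Y : complex) (f : chain_map X Y) :
  quasi_iso f -> quasi_iso (chain_shift f).
Proof.
move=> qf i; have [fi fs] := qf (i + 1); split=> [z /= dz [y fz]|w /= dw].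
  have [||x ->] := fi z.
  - by apply: oppr_inj; rewrite -mulNmx dz oppr0.
  - by exists (- y); rewrite fz mulmxN mulNmx.
  by exists (- x); rewrite mulNmx mulmxN opprK.
have [|z [y [dz wE]]] := fs w.
  by apply: oppr_inj; rewrite -mulNmx dw oppr0.
exists z, (- y); split; first by rewrite mulNmx dz oppr0.
by rewrite wE mulNmx mulmxN opprK.
Qed.

Definition shift_gen (X Y : complex) (g : derived_gen X Y) :
    @hom k Db (complex_shift X) (complex_shift Y) :=
  match g in derived_gen X Y
    return @hom k Db (complex_shift X) (complex_shift Y) with
  | DMap _ _ f => pcls derived_rel (dmap (chain_shift f))
  | DInv _ _ _ qs => pcls derived_rel (dinv (quasi_iso_shift qs))
  end.

Lemma chain_mapP (X Y : complex) (f g : chain_map X Y) :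
  (forall i, f i = g i) -> f = g.
Proof.
case: f g => [f fh fd] [g gh gd] /= fg.
have e : f = g by exact: functional_extensionality_dep.
by rewrite -{g}e in gh gd fg *; congr ChainMap; apply: Prop_irrelevance.
Qed.

Lemma shift_rel (X Y : complex) (s t : dterm X Y) : derived_rel s t ->
  @teval k _ _ Db complex_shift shift_gen _ _ s =
  @teval k _ _ Db complex_shift shift_gen _ _ t.
Proof.
case=> {X Y s t} /=.
- move=> X; rewrite (_ : chain_shift _ = chain_id _); last exact: chain_mapP.
  exact/pclsP/teq_rel/DRId.
- move=> X Y Z g f.
  rewrite (_ : chain_shift _ = chain_comp (chain_shift g) (chain_shift f));
    last exact: chain_mapP.
  by rewrite pcompE; apply/pclsP/teq_rel/DRComp.
- move=> X Y a f g.
  rewrite (_ : chain_shift _ = chain_lin a (chain_shift f) (chain_shift g));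
    last exact: chain_mapP.
  rewrite -[a *: _]pclsZ -[_ + _]pclsD; exact/pclsP/teq_rel/DRLin.
- by move=> X Y s qs; rewrite pcompE; apply/pclsP/teq_rel/DRInvl.
- by move=> X Y s qs; rewrite pcompE; apply/pclsP/teq_rel/DRInvr.
Qed.

Definition Db_shift : kfunctor Db Db := lift_functor shift_rel.

End Derived.

(** The Auslander-Reiten translation of a triangulated category with shift
    functor [Sh]: an autoequivalence tau together with an isomorphism
      Hom(Y, (tau X)[1]) ~ Hom_k(Hom(X, Y), k),
    natural in X and Y; that is, tau = S[-1] for a Serre functor S. *)
Record ar_translation (k : fieldType) (D : kcat k) (Sh : kfunctor D D) :=
  ARTranslation {
  ar_tau : kequiv D D;
  ar_dual : forall X Y : D, hom Y (Sh (ar_tau X)) -> hom X Y -> k;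
  ar_dual_linl : forall (X Y : D) a (g g' : hom Y (Sh (ar_tau X)))
    (f : hom X Y),
    ar_dual (a *: g + g') f = a * ar_dual g f + ar_dual g' f;
  ar_dual_linr : forall (X Y : D) a (g : hom Y (Sh (ar_tau X)))
    (f f' : hom X Y),
    ar_dual g (a *: f + f') = a * ar_dual g f + ar_dual g f';
  ar_dual_perfect : forall (X Y : D) (l : {scalar hom X Y}),
    exists! g : hom Y (Sh (ar_tau X)), forall f, ar_dual g f = l f;
  ar_dual_natY : forall (X Y Y' : D) (u : hom Y Y') (f : hom X Y)
    (g : hom Y' (Sh (ar_tau X))),
    ar_dual (g \oc u) f = ar_dual g (u \oc f);
  ar_dual_natX : forall (X X' Y : D) (v : hom X X') (f : hom X' Y)
    (g : hom Y (Sh (ar_tau X))),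
    ar_dual (fmap Sh (fmap ar_tau v) \oc g) f = ar_dual g (f \oc v) }.

(** The orbit category D/F of an autoequivalence F: a category with a functor
    pi from D, essentially surjective on objects, and an isomorphism
    eta : pi F ~ pi, such that Hom(pi X, pi Y) is the direct sum over i in Z of
    the Hom_D(X, F^i Y). The components of degree m >= 0 are the
    f_m : X -> F^m Y; those of degree -(m+1) are given, F being an
    autoequivalence, by g_m : F^(m+1) X -> Y. *)
Section Orbit.
Variables (k : fieldType) (D : kcat k) (F : kfunctor D D).

Section Powers.
Variables (O : kcat k) (pi : kfunctor D O) (eta : natiso (fun_comp pi F) pi).

Fixpoint eta_pow (m : nat) (Y : D) : hom (pi (iter m F Y)) (pi Y) :=
  if m is m'.+1 then eta_pow m' Y \oc nfwd eta (iter m' F Y) else idc (pi Y).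

Fixpoint eta_pow_inv (m : nat) (Y : D) : hom (pi Y) (pi (iter m F Y)) :=
  if m is m'.+1 then nbwd eta (iter m' F Y) \oc eta_pow_inv m' Y
  else idc (pi Y).

Definition orbit_sum (X Y : D) (N : nat) (f : forall m, hom X (iter m F Y))
    (g : forall m, hom (iter m.+1 F X) Y) : hom (pi X) (pi Y) :=
  \sum_(m < N) (eta_pow m Y \oc fmap pi (f m)) +
  \sum_(m < N) (fmap pi (g m) \oc eta_pow_inv m.+1 X).

End Powers.

Record orbit_category := OrbitCategory {
  orb_cat :> kcat k;
  orb_pi : kfunctor D orb_cat;
  orb_eta : natiso (fun_comp orb_pi F) orb_pi;
  orb_surj : forall Z : orb_cat, exists X : D, isom Z (orb_pi X);
  orb_span : forall (X Y : D) (h : hom (orb_pi X) (orb_pi Y)),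
    exists N f g, h = orbit_sum orb_eta N f g;
  orb_free : forall (X Y : D) N (f : forall m, hom X (iter m F Y))
    (g : forall m, hom (iter m.+1 F X) Y),
    orbit_sum orb_eta N f g = 0 ->
    forall m, (m < N)%N -> f m = 0 /\ g m = 0 }.

End Orbit.

(** The orbit category D^b(mod H)/tau^-1[1]. Its shift functor and its
    Auslander-Reiten translation are induced from D^b(mod H); commutation with
    the projection determines them on objects, up to isomorphism. *)
Record cluster_category (k : fieldType) (H : algType k) := ClusterCategory {
  cl_ar : ar_translation (Db_shift H);
  cl_cat :> orbit_category (fun_comp (einv (ar_tau cl_ar)) (Db_shift H));
  cl_shift : kfunctor cl_cat cl_cat;
  cl_shift_induced : natiso (fun_comp cl_shift (orb_pi cl_cat))
                            (fun_comp (orb_pi cl_cat) (Db_shift H));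
  cl_tau : kequiv cl_cat cl_cat;
  cl_tau_induced : natiso (fun_comp cl_tau (orb_pi cl_cat))
                          (fun_comp (orb_pi cl_cat) (ar_tau cl_ar)) }.

Section Tilting.
Variables (k : fieldType) (H : algType k) (CH : cluster_category H).

Definition Ext1_vanishes (X Y : CH) : Prop :=
  forall f : hom X (cl_shift CH Y), f = 0.

Definition basic_tilting (n : nat) (T : CH) : Prop :=
  (exists Ts : 'I_n -> CH,
     [/\ forall i, indecomposable (Ts i),
         forall i j, i != j -> ~ isom (Ts i) (Ts j)
       & is_direct_sum Ts T]) /\
  Ext1_vanishes T T.

Definition tau_pow (i : int) (T : CH) : CH :=
  match i with
  | Posz m => iter m (cl_tau CH) T
  | Negz m => iter m.+1 (einv (cl_tau CH)) T
  end.

End Tilting.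

Section TaggedEdges.
Variable n : nat.

(** The boundary vertices are 'I_n, numbered counterclockwise, so that [ordS]
    is the counterclockwise and [ord_pred] the clockwise neighbor. *)

(** The number of vertices on the boundary path from a counterclockwise to b,
    including a and b. *)
Definition bsize (a b : 'I_n) : nat := ((b + (n - a)) %% n).+1.

(** [inl (a, b)] is M_{a,b}, where [3 <= bsize a b] forces a <> b;
    [inr (a, true)] is M_{a,a}^{1} and [inr (a, false)] is M_{a,a}^{-1}. *)
Definition tedge : finType :=
  ({p : 'I_n * 'I_n | (3 <= bsize p.1 p.2)%N} + 'I_n * bool)%type.

Lemma bsize_pred (a b : 'I_n) : bsize (ord_pred a) (ord_pred b) = bsize a b.
Proof.
have predE (i : 'I_n) : val (ord_pred i) = if val i == 0%N then n.-1 else i.-1.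
  have := ltn_ord i; rewrite /=; case: (i : nat) => [|j] jn /=.
    by rewrite add0n modn_small //; lia.
  by rewrite modnDr modn_small //; lia.
have modE (x y : nat) : x = y \/ x = (y + n)%N \/ y = (x + n)%N ->
    (x %% n = y %% n)%N.
  by case=> [->|[] ->]; rewrite ?modnDr.
rewrite /bsize -![nat_of_ord (ord_pred _)]/(val (ord_pred _)) !predE.
congr S; apply: modE; have := ltn_ord a; have := ltn_ord b.
by case: eqP; case: eqP => /=; lia.
Qed.

Definition etau_sub (p : {p : 'I_n * 'I_n | (3 <= bsize p.1 p.2)%N}) :
  {p : 'I_n * 'I_n | (3 <= bsize p.1 p.2)%N}.
Proof.
exists (ord_pred (val p).1, ord_pred (val p).2).
by rewrite bsize_pred; apply: (valP p).
Defined.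

Definition etau (M : tedge) : tedge :=
  match M with
  | inl p => inl (etau_sub p)
  | inr (a, e) => inr (ord_pred a, ~~ e)
  end.

Definition esigma (M : tedge) : tedge :=
  match M with
  | inl p => inl p
  | inr (a, e) => inr (a, ~~ e)
  end.

(** [move M N]: there is an elementary move M -> N (it is then unique). *)
Definition move (M N : tedge) : bool :=
  match M, N with
  | inl p, inl q =>
      let: (a, b) := val p in
      (val q == (a, ordS b)) && (3 <= bsize a b <= n - 1)%N ||
      (val q == (ordS a, b)) && (4 <= bsize a b <= n)%N
  | inl p, inr (c, e) => let: (a, b) := val p in (c == a) && (bsize a b == n)
  | inr (a, e), inl q => val q == (ordS a, a)
  | inr _, inr _ => false
  end.

Variable k : fieldType.

Local Notation mterm := (term k (fun M N : tedge => is_true (move M N))).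

(** The elementary move M -> N if there is one, and 0 otherwise. *)
Definition arrow (M N : tedge) : mterm M N :=
  if @idP (move M N) is ReflectT mv then TGen k mv else TZero k _ M N.

Inductive mesh_rel : forall M N : tedge, mterm M N -> mterm M N -> Prop :=
| MeshRel (M : tedge) :
    mesh_rel (TSum (enum tedge) (fun X => TComp (arrow X M) (arrow (etau M) X)))
             (TZero k _ (etau M) M).

Definition tagged_cat : kcat k := additive_hull (presented mesh_rel).

Definition tagged_tau (M : tagged_cat) : tagged_cat := map etau M.
Definition tagged_sigma (M : tagged_cat) : tagged_cat := map esigma M.

End TaggedEdges.

(** The equivalence varphi from tagged edges to the cluster category. *)
Record tagged_equiv (k : fieldType) (n : nat) (H : algType k)
    (CH : cluster_category H) := TaggedEquiv {
  te_equiv :> kequiv (tagged_cat n k) CH;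
  te_tau : forall M : tagged_cat n k,
    isom (te_equiv (tagged_tau M)) (cl_tau CH (te_equiv M)) }.

Definition sigma (k : fieldType) (n : nat) (H : algType k)
    (CH : cluster_category H) (phi : tagged_equiv n CH) (T : CH) : CH :=
  phi (tagged_sigma (einv phi T)).

(* Main.v *)
(** A basic tilting object T corresponds to n pairwise compatible tagged edges,
    and Hom in the mesh category is easily computed on such a family: each
    endomorphism space is k, and Hom(M, N) is nonzero exactly under an explicit
    numerical condition on the positions and levels of M and N. Since the
    summands have only scalar endomorphisms, an isomorphism of endomorphism
    algebras matches the summands of T and T' so that the relation "Hom is
    nonzero" is preserved. This relation on the set of edges determines the
    triangulation of the punctured polygon up to rotation and simultaneous change
    of tags: it first tells which edges end in the puncture, and then, for each
    arc, which arcs below it share an endpoint with it, so that all levels and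
    relative positions can be read off triangle by triangle. Rotations are the
    powers of tau, up to tags, and the change of all tags is sigma. *)

From HB Require Import structures.
From mathcomp Require Import all_boot all_order all_algebra.
From mathcomp Require Import zify boolp.
Require Import Defs.

Set Implicit Arguments.
Unset Strict Implicit.
Unset Printing Implicit Defensive.

(** * Compatible tagged edges *)

(** The relation read off from the algebra records all nonzero Hom spaces, not the arrows of its
    quiver, and it carries no tags. So edges to the puncture (radii) and triangles must be
    characterized through composite maps, and two radii at one vertex with opposite tags cannot be
    told apart. The bound [n >= 5] excludes the triality of D_4: for [n = 4], the two radii at the
    start of an arc of level 3 and the arc of level 2 at its end are interchangeable. Maximality of
    the family enters through counting: [n] pairwise non-crossing edges leave no interval
    untriangulated. On the categorical side, vanishing of Hom comes from a spanning set of paths and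
    nonvanishing from explicit thin representations. The two criteria agree on non-crossing pairs,
    which is what a tilting object provides. Ext^1 becomes Hom into [tau] because the shift and
    [tau] are isomorphic on objects of the orbit category. *)

Definition dist (n a c : nat) : nat := if (a <= c)%N then c - a else c + n - a.

Definition shiftn (n a k : nat) : nat := if (a + k < n)%N then a + k else a + k - n.

Lemma dist_lt n a c : a < n -> c < n -> dist n a c < n.
Proof. by rewrite /dist; case: (leqP a c); lia. Qed.

Lemma dist_sym n a c : a < n -> c < n ->
  (dist n a c = 0 /\ dist n c a = 0) \/
  (0 < dist n a c /\ dist n c a = n - dist n a c).
Proof. by rewrite /dist; case: (leqP a c); case: (leqP c a); lia. Qed.

(** Arithmetic modulo [n] is put in this case form for [lia]; with [dist_sym] it decides the
    relative position of any three vertices. *)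
Lemma dist_tri n a c d : a < n -> c < n -> d < n ->
  (dist n a c <= dist n a d /\ dist n c d = dist n a d - dist n a c) \/
  (dist n a d < dist n a c /\ dist n c d = dist n a d + n - dist n a c).
Proof.
by rewrite /dist; case: (leqP a c); case: (leqP c d); case: (leqP a d); lia.
Qed.

Lemma dist_eq0 n a c : a < n -> c < n -> (dist n a c == 0) = (a == c).
Proof. by rewrite /dist; case: (leqP a c); lia. Qed.

Lemma dist_shift n a k : a < n -> k < n -> dist n a (shiftn n a k) = k.
Proof.
rewrite /dist /shiftn; case: (ltnP (a + k) n).
  by case: (leqP a (a + k)); lia.
by case: (leqP a (a + k - n)); lia.
Qed.

Lemma shift_lt n a k : a < n -> k <= n -> shiftn n a k < n.
Proof. by rewrite /shiftn; case: (ltnP (a + k) n); lia. Qed.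

Lemma shift_dist n a c : a < n -> c < n -> shiftn n a (dist n a c) = c.
Proof.
rewrite /dist; case: (leqP a c) => h ha hc; rewrite /shiftn.
  by rewrite subnKC // hc.
by rewrite subnKC ?ltnNge ?leq_addl /= ?addnK //; lia.
Qed.

Lemma dist_inj n a c d : a < n -> c < n -> d < n -> dist n a c = dist n a d -> c = d.
Proof. by move=> ha hc hd e; rewrite -(shift_dist ha hc) e shift_dist. Qed.

(* A tagged edge is recorded by its initial vertex, its level (the number of
   boundary sides cut off by [M_{a,b}], and [n] for an edge to the puncture) and
   its tag, which is relevant at level [n] only. For an edge of level [m] and one
   of level [l] starting [x] vertices further on, [hits] means that there is a
   nonzero morphism from the first to the second in the mesh category, and
   [cross] that [Ext^1] is nonzero. The second alternative of [hits] is the part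
   of the support of Hom that is reflected at the puncture. *)
Definition trap (n m : nat) (t : bool) (x l : nat) (u : bool) : bool :=
  (x + 2 <= m <= x + l) && ((m == n) ==> (l == n) ==> (t == u)).

Definition hits (n m : nat) t x l u : bool :=
  trap n m t x l u ||
  [&& l < n, m < n, n <= x + l, x + l + 2 <= n + m & x + 2 <= n].

Definition cross (n m : nat) (t : bool) x l u : bool :=
  (0 < x < m) && (m < x + l) && ((m == n) ==> (l == n) ==> (t != u)).

Section Cards.
Variable n : nat.
Implicit Types A B : {set 'I_n}.

Definition cd A : nat := #|A|.

Lemma cd_sub A B : A \subset B -> cd A <= cd B.
Proof. exact: subset_leq_card. Qed.
Lemma cdU A B : cd (A :|: B) <= cd A + cd B.
Proof. exact: leq_card_setU. Qed.
Lemma cd_cover (C A B : {set 'I_n}) i j :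
  (forall h, h \in C -> [\/ h = i, h = j, h \in A | h \in B]) ->
  cd C <= 2 + cd A + cd B.
Proof.
move=> cov; have sub : C \subset [set i; j] :|: (A :|: B).
  apply/subsetP => h /cov; rewrite !inE => -[->|->|->|->]; rewrite ?eqxx ?orbT //.
apply: leq_trans (cd_sub sub) (leq_trans (cdU _ _) _).
rewrite -addnA; apply: leq_add (cdU _ _).
by rewrite /cd cards2; case: eqP.
Qed.

Lemma cd_cover1 (C A B : {set 'I_n}) i :
  (forall h, h \in C -> [\/ h = i, h \in A | h \in B]) ->
  cd C <= 1 + cd A + cd B.
Proof.
move=> cov; have sub : C \subset [set i] :|: (A :|: B).
  by apply/subsetP => h /cov; rewrite !inE => -[->|->|->]; rewrite ?eqxx ?orbT.
apply: leq_trans (cd_sub sub) (leq_trans (cdU _ _) _).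
by rewrite -addnA leq_add ?cdU // /cd cards1.
Qed.

Lemma cdT : cd [set: 'I_n] = n. Proof. by rewrite /cd cardsT card_ord. Qed.
Lemma cd0 : cd (@set0 'I_n) = 0. Proof. by rewrite /cd cards0. Qed.

End Cards.

(* The [n] summands of a tilting object, indexed arbitrarily. *)
Record tri (n : nat) := Tri {
  tri_n5 : 5 <= n;
  ps : 'I_n -> nat;
  lv : 'I_n -> nat;
  tg : 'I_n -> bool;
  ps_lt : forall i, ps i < n;
  lv_bounds : forall i, 2 <= lv i <= n;
  tri_inj : forall i j, ps i = ps j -> lv i = lv j ->
    (lv i = n -> tg i = tg j) -> i = j;
  tri_cross : forall i j,
    ~~ cross n (lv i) (tg i) (dist n (ps i) (ps j)) (lv j) (tg j) }.

(** * Arcs inside an interval of the boundary *)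

Section Counting.
Variables (n : nat) (t : tri n).
Let n5 : 5 <= n := tri_n5 t.
Implicit Types i j : 'I_n.

Definition ds i j := dist n (ps t i) (ps t j).
Definition rd i : bool := lv t i == n.
(* Hom from [i] to [j] is nonzero: all that the endomorphism algebra tells. *)
Definition rl i j : bool :=
  (i != j) && hits n (lv t i) (tg t i) (ds i j) (lv t j) (tg t j).

Local Notation s := (ps t).
Local Notation l := (lv t).

Lemma ds_lt i j : ds i j < n.
Proof. exact: dist_lt (ps_lt _ _) (ps_lt _ _). Qed.
Lemma ds_sym i j : (ds i j = 0 /\ ds j i = 0) \/ (0 < ds i j /\ ds j i = n - ds i j).
Proof. exact: dist_sym (ps_lt _ _) (ps_lt _ _). Qed.
Lemma ds_tri (h : 'I_n) i j :
  (ds h i <= ds h j /\ ds i j = ds h j - ds h i) \/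
  (ds h j < ds h i /\ ds i j = ds h j + n - ds h i).
Proof. exact: dist_tri (ps_lt _ _) (ps_lt _ _) (ps_lt _ _). Qed.
Lemma dsii i : ds i i = 0.
Proof. by rewrite /ds /dist leqnn subnn. Qed.
Lemma ds_eq0 i j : ds i j = 0 -> s i = s j.
Proof. by move/eqP; rewrite dist_eq0 ?ps_lt // => /eqP. Qed.

Lemma arcP i : ~~ rd i -> 2 <= l i < n.
Proof. by rewrite /rd => h; have := lv_bounds t i; lia. Qed.
Lemma radP i : rd i -> l i = n.
Proof. by move/eqP. Qed.

Lemma arc_inj i j : ~~ rd i -> ds i j = 0 -> l i = l j -> i = j.
Proof.
move=> hi /ds_eq0 e el; apply: (tri_inj (t := t)) => // e'.
by move: hi; rewrite /rd e' eqxx.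
Qed.

Lemma crossN i j : ~ [/\ 0 < ds i j < l i, l i < ds i j + l j &
   ~~ rd i \/ ~~ rd j \/ tg t i <> tg t j].
Proof.
case=> h1 h2 h3; have := tri_cross t i j; rewrite /cross.
rewrite -/(ds i j) h1 h2 /= -/(rd i) -/(rd j).
by case: (rd i) (rd j) h3 => [] [] //= [|[]] // /eqP ->.
Qed.

(** In order: common start, [j] below [i], [j] beside [i], [j] above [i]. Since [cross] depends on
    the order of its arguments, the last case uses the reversed pair. *)
Lemma arc_arc i j : ~~ rd i -> ~~ rd j ->
  [\/ ds i j = 0, 0 < ds i j /\ ds i j + l j <= l i,
      l i <= ds i j /\ ds i j + l j <= n |
      l i <= ds i j /\ n + l i <= ds i j + l j].
Proof.
move=> hi hj; have := arcP hi; have := arcP hj; have := ds_lt i j => lt bj bi.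
have h1 := @crossN i j; have h2 := @crossN j i.
have [e|p] := posnP (ds i j); first exact: Or41.
have e : ds j i = n - ds i j by case: (ds_sym i j) => -[]; lia.
rewrite e in h2.
have [?|?] := leqP (l i) (ds i j); last first.
  apply: Or42; split=> //; rewrite leqNgt; apply/negP => ?.
  by apply: h1; split; [lia|lia|left].
have [?|?] := leqP (ds i j + l j) n; first exact: Or43.
apply: Or44; split=> //; rewrite leqNgt; apply/negP => ?.
by apply: h2; split; [lia|lia|left].
Qed.

Lemma rad_arc i j : rd i -> ~~ rd j -> ds i j = 0 \/ (0 < ds i j /\ ds i j + l j <= n).
Proof.
move=> hi hj; have := arcP hj; have := ds_lt i j; have := radP hi => li lt bj.
have [e|p] := posnP (ds i j); [by left|right; split=> //].
rewrite leqNgt; apply/negP => ?; apply: (@crossN i j).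
by split; [lia|lia|right; left].
Qed.

Lemma arc_rad i j : rd i -> ~~ rd j -> ds j i = 0 \/ l j <= ds j i.
Proof.
move=> hi hj; have := ds_sym i j; have := rad_arc hi hj; have := arcP hj; have := ds_lt i j. lia.
Qed.

Lemma rad_rad i j : rd i -> rd j -> ds i j = 0 \/ (0 < ds i j /\ tg t i = tg t j).
Proof.
move=> hi hj; have [e|p] := posnP (ds i j); [by left|right; split=> //].
apply/eqP; apply/negP => /negP h; apply: (@crossN i j); split.
- by rewrite p /= (radP hi) ds_lt.
- by rewrite (radP hi) (radP hj); lia.
- by right; right; apply/eqP.
Qed.

(** Without crossings only the boundary of the region [hits] is attained: two sides of [trap], and
    the ray [x + l = n] of the reflected part. In each case the arcs share an endpoint. *)
Lemma rl_arc i j : ~~ rd i -> ~~ rd j -> rl i j <->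
  [\/ ds i j = 0 /\ l i < l j, 0 < ds i j /\ ds i j + l j = l i |
      0 < ds i j /\ ds i j + l j = n].
Proof.
move=> hi hj; rewrite /rl /hits /trap.
have [<-|ne] /= := eqVneq i j.
  by rewrite dsii ltnn; split => // -[] []; lia.
have := arcP hi; have := arcP hj; have := ds_lt i j => lt bj bi.
have v := arc_arc hi hj.
have ne' : ds i j = 0 -> l i <> l j by move=> e1 e2; case/eqP: ne; apply: arc_inj.
rewrite (_ : l i == n = false) /=; last by apply/eqP; lia.
rewrite andbT; split.
  by case: v => v h; try (apply: Or31; lia); try (apply: Or32; lia); (apply: Or33; lia).
by move=> h; case: v => v; case: h => h; lia.
Qed.

Lemma rl_rad_arc i j : rd i -> ~~ rd j -> rl i j <-> 0 < ds i j /\ ds i j + l j = n.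
Proof.
move=> hi hj; rewrite /rl /hits /trap.
have ne : i != j by apply: contraNneq hj => <-.
have := arcP hj; have := ds_lt i j => lt bj; have := rad_arc hi hj; have := radP hi => -> v.
rewrite ne ltnn /= eqxx /= andbF orbF (_ : l j == n = false) /=; last by apply/eqP; lia.
by rewrite andbT; lia.
Qed.

Lemma rl_arc_rad i j : ~~ rd i -> rd j -> rl i j <-> ds i j = 0.
Proof.
move=> hi hj; rewrite /rl /hits /trap.
have ne : i != j by apply: contraNneq hi => ->.
have := arcP hi; have := ds_lt i j => lt bj; have := arc_rad hj hi; have := radP hj => -> v.
rewrite ne ltnn /= orbF (_ : l i == n = false) /=; last by apply/eqP; lia.
by rewrite andbT; lia.
Qed.

Lemma rl_rad_rad i j : rd i -> rd j -> rl i j <-> 0 < ds i j /\ ds i j + 2 <= n.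
Proof.
move=> hi hj; rewrite /rl /hits /trap.
have := ds_lt i j => lt; have := rad_rad hi hj; have := radP hj => e; have := radP hi => e'.
rewrite e e' eqxx /= ltnn /= orbF => v; split.
  case/andP => ne /andP[h1 /eqP h2]; split; last by lia.
  case: v => [e0|[]] //; case/eqP: ne; apply: (tri_inj (t := t)); rewrite ?e ?e' //.
  exact: ds_eq0.
move=> [h1 h2]; case: v => [|[_ ->]]; first by lia.
rewrite eqxx andbT; apply/andP; split; last by lia.
by apply/eqP => e0; move: h1; rewrite e0 dsii.
Qed.

(** Consider the polygon with vertices [p, ..., p + k] closed by a chord: [prp] consists of its
    diagonals, [inn] admits the chord as well. For [k = n] the chord is a loop at [p] around the
    puncture. *)
Definition inn p k := [set i | ~~ rd i & dist n p (s i) + l i <= k].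
Definition prp p k := [set i | (l i < k) && (dist n p (s i) + l i <= k)].

Lemma inn_bound p k : p < n -> k < n ->
  cd (inn p k) = cd (prp p k) \/
  exists i, [/\ ~~ rd i, s i = p, l i = k & cd (inn p k) = (cd (prp p k)).+1].
Proof.
move=> hp hk.
have sub : prp p k \subset inn p k.
  by apply/subsetP => i; rewrite !inE /rd => /andP[h1 h2]; rewrite h2 andbT; lia.
have [i hi|no] := pickP [pred i | (s i == p) && (l i == k)].
  right; exists i; case/andP: hi => /eqP si /eqP li.
  have ri : ~~ rd i by rewrite /rd li; lia.
  split=> //; rewrite /cd (cardsD1 i) (_ : i \in _) /= ?add1n; last first.
    by rewrite inE ri si li /dist leqnn subnn add0n leqnn.
  congr S; apply: eq_card => j; rewrite !inE.
  have hs := ps_lt t j.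
  case: (leqP (dist n p (s j) + l j) k) => hj; rewrite ?andbF ?andbT //.
  have -> : rd j = false by rewrite /rd; apply/eqP; lia.
  rewrite andbT; case: eqP => [->|ne]; first by rewrite li ltnn.
  rewrite /=; have [lt|ge] := ltnP; first by [].
  case: ne; apply/esym/arc_inj => //.
    by rewrite /ds si; lia.
  by lia.
left; apply: eq_card => j; rewrite !inE.
case: (leqP (dist n p (s j) + l j) k) => hj; rewrite ?andbF ?andbT //.
have -> : rd j = false by rewrite /rd; apply/eqP; lia.
by move: (no j) (dist_eq0 hp (ps_lt t j)) => /=; lia.
Qed.

(* Cut the interval at the end of the longest arc of length [< k] starting at [p]:
   no other arc of [prp p k] crosses the cut. *)
Lemma prp_split p k : p < n -> 2 <= k <= n ->
  exists h, [/\ 0 < h < k & prp p k \subset inn p h :|: inn (shiftn n p h) (k - h)].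
Proof.
move=> hp hk.
pose Q h := (h < k) && ((h == 1) || [exists i, (s i == p) && (l i == h)]).
have Q1 : exists h, Q h by exists 1; rewrite /Q eqxx; lia.
have Qb h : Q h -> h <= k by case/andP => /ltnW.
case: (ex_maxnP Q1 Qb) => h /andP[hk1 hQ] hmax.
have h0 : 0 < h.
  case/orP: hQ => [/eqP -> //|/existsP[i /andP[_ /eqP <-]]].
  by have := lv_bounds t i; lia.
exists h; split; first by rewrite h0.
apply/subsetP => j; rewrite !inE => /andP[lk dk].
have rj : ~~ rd j by rewrite /rd; lia.
have bj := lv_bounds t j; have sj := ps_lt t j.
rewrite rj /=.
have [e0|d0] := posnP (dist n p (s j)).
  have lh : l j <= h.
    apply: hmax; rewrite /Q lk /=; apply/orP; right; apply/existsP; exists j.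
    by rewrite eqxx andbT eq_sym -(dist_eq0 hp sj) e0.
  by rewrite e0 add0n lh.
have [//|lt] := leqP (dist n p (s j) + l j) h; rewrite /=.
have hd : h <= dist n p (s j).
  case/orP: hQ => [/eqP -> //|/existsP[i /andP[/eqP si /eqP li]]].
  have ri : ~~ rd i by rewrite /rd; lia.
  have := arc_arc ri rj; rewrite /ds si li => v.
  by case: v; lia.
have hn : h < n by lia.
have := dist_tri hp (shift_lt hp (ltnW hn)) sj; rewrite (dist_shift hp hn).
by lia.
Qed.

(** This is the number of diagonals triangulating a polygon with [k + 1] vertices: the two intervals
    of [prp_split] contribute at most [h - 1] and [k - h - 1] arcs. *)
Lemma prp_bound p k : p < n -> 0 < k <= n -> cd (prp p k) <= k - 2.
Proof.
elim/ltn_ind: k p => k IH p hp hk.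
have [k2|k1] := leqP 2 k; last first.
  suff -> : prp p k = set0 by rewrite /cd cards0.
  apply/setP => i; rewrite !inE.
  by have := lv_bounds t i; lia.
have [h [hh sub]] := prp_split hp (k := k) ltac:(lia).
have hn : h <= n by lia.
have le := leq_trans (cd_sub sub) (cdU _ _).
have b q g : q < n -> 0 < g < k -> cd (inn q g) <= g - 1.
  move=> hq hg; have := IH g _ q hq _; have := @inn_bound q g hq _.
  move=> /(_ ltac:(lia)) v /(_ ltac:(lia) ltac:(lia)) ?.
  by case: v => [|[i [_ _ li]]]; [lia | have := lv_bounds t i; lia].
have b1 := b p h hp hh; have b2 := b (shiftn n p h) (k - h) (shift_lt hp hn) ltac:(lia).
by lia.
Qed.

Lemma inn_le p k : p < n -> 0 < k < n -> cd (inn p k) <= k - 1.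
Proof.
move=> hp hk; have := prp_bound hp (k := k) ltac:(lia).
case: (inn_bound hp (k := k) ltac:(lia)) => [|[i [_ _ li]]]; first by lia.
by have := lv_bounds t i; lia.
Qed.

(** Equality in [prp_bound]: the arcs of the family triangulate the interval. *)
Definition tight p k := cd (prp p k) = k - 2.

Lemma inn_max p k : p < n -> 0 < k < n -> cd (inn p k) = k - 1 ->
  tight p k /\ (k = 1 \/ exists i, [/\ ~~ rd i, s i = p & l i = k]).
Proof.
move=> hp hk e; have b := prp_bound hp (k := k) ltac:(lia); rewrite /tight.
case: (inn_bound hp (k := k) ltac:(lia)) => [e1|[i [ri si li e1]]].
  by split; [lia | left; lia].
by have := lv_bounds t i; split; [lia | right; exists i].
Qed.

(** The triangle on the chord. Equality in [prp_bound] forces equality on both intervals of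
    [prp_split], so each remaining side is a boundary side or an arc of the family. *)
Lemma tight_split p k : p < n -> 2 <= k <= n -> tight p k ->
  exists h, [/\ 0 < h < k, prp p k \subset inn p h :|: inn (shiftn n p h) (k - h),
    tight p h /\ (h = 1 \/ exists i, [/\ ~~ rd i, s i = p & l i = h]) &
    tight (shiftn n p h) (k - h) /\
    (k - h = 1 \/ exists i, [/\ ~~ rd i, s i = shiftn n p h & l i = k - h])].
Proof.
move=> hp hk tk; have [h [hh sub]] := prp_split hp hk; exists h.
have hn : h <= n by lia.
have le := leq_trans (cd_sub sub) (cdU _ _).
have b1 := @inn_le p h hp ltac:(lia).
have b2 := @inn_le (shiftn n p h) (k - h) (shift_lt hp hn) ltac:(lia).
rewrite tk in le.
by split=> //; apply: inn_max; rewrite ?shift_lt //; lia.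
Qed.

Lemma inn_cases p k i : p < n -> 0 < k < n -> i \in inn p k ->
  (s i = p /\ l i = k) \/ i \in prp p k.
Proof.
move=> hp hk; rewrite !inE => /andP[ri le].
have := lv_bounds t i; have := dist_eq0 hp (ps_lt t i).
have [lt|ge] := ltnP (l i) k; first by right.
by left; lia.
Qed.

Lemma tight_desc p k i : p < n -> 2 <= k <= n -> tight p k -> i \in prp p k ->
  tight (s i) (l i).
Proof.
elim/ltn_ind: k p => k IH p hp hk tk hi.
have [h [hh sub [t1 _] [t2 _]]] := tight_split hp hk tk.
have hn : h <= n by lia.
have bi := lv_bounds t i.
have := subsetP sub _ hi; rewrite inE => /orP[] /[dup] hii.
- move/(inn_cases hp (k := h) ltac:(lia)) => [[-> ->] //|].
  move=> h'; apply: IH h' => //; first by lia.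
  by move: hii; rewrite inE; lia.
- move/(inn_cases (shift_lt hp hn) (k := k - h) ltac:(lia)) => [[-> ->] //|].
  move=> h'; apply: IH h' => //; [by lia|exact: shift_lt|].
  by move: hii; rewrite inE; lia.
Qed.

End Counting.

(* Hypotheses on [rl] and [rd] would send [lia] into needless boolean case
   splits. *)
Ltac alia := intros; repeat match goal with H : ?T |- _ =>
  match T with context [@rl] => clear H | context [@rd] => clear H end end; lia.

(** * Gaps between consecutive edges to the puncture *)

Section Gaps.
Variables (n : nat) (t : tri n).
Let n5 : 5 <= n := tri_n5 t.
Implicit Types i j : 'I_n.
Local Notation s := (ps t).
Local Notation l := (lv t).
Local Notation ds := (ds t).
Local Notation rd := (rd t).
Local Notation tight := (tight t).
Local Notation inn := (inn t).
Local Notation prp := (prp t).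

(** Without radii, every arc other than a longest one would lie in the interval of length [n] at its
    start, giving at most [1 + (n - 2)] edges. *)
Lemma rad_ex : exists i, rd i.
Proof.
have [i //|no] := pickP rd; first by exists i.
have n0 : 0 < n by lia.
pose i0 : 'I_n := Ordinal n0.
have [i imax] : exists i, forall j, l j <= l i.
  by case: (@arg_maxnP _ i0 predT l isT) => i _ imax; exists i => j; apply: imax.
have : cd [set: 'I_n] <= 1 + cd (prp (s i) n) + cd (@set0 'I_n).
  apply: (@cd_cover1 _ _ _ _ i) => j _; apply: Or32; rewrite inE.
  have := imax j; have := no i; have := no j => /= /negbT hj /negbT hi le.
  have := arcP hi; have := arcP hj; have := ds_lt t i j.
  by case: (arc_arc hi hj); rewrite /ds; lia.
by rewrite cdT cd0; have := prp_bound t (ps_lt t i) (k := n) ltac:(lia); lia.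
Qed.

Lemma rad_in_prp i j : rd i -> ~~ rd j -> j \in prp (s i) n.
Proof.
move=> ri rj; rewrite inE; have := arcP rj; have := rad_arc ri rj.
by rewrite /ds; lia.
Qed.

Lemma rad_inj i j : rd i -> rd j -> ds i j = 0 -> tg t i = tg t j -> i = j.
Proof.
move=> ri rj /ds_eq0 e et; apply: (tri_inj (t := t)) => //.
by rewrite (radP ri) (radP rj).
Qed.

(** By [tri_inj] the tags of such a pair differ, so a radius at any other vertex would cross one of
    the two; hence [twins_only]. *)
Definition twins i j := [/\ rd i, rd j, i <> j & ds i j = 0].

Lemma twins_only i j h : twins i j -> rd h -> h = i \/ h = j.
Proof.
case=> ri rj ne e rh.
have te : tg t i <> tg t j by move=> te; apply: ne; apply: rad_inj.
have hi := rad_rad ri rh; have hj := rad_rad rj rh.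
have e' : ds j h = ds i h by rewrite /ds (ds_eq0 e).
have [d0|d] := posnP (ds i h).
  case: (eqVneq (tg t i) (tg t h)) => [e1|e1]; first by left; rewrite (rad_inj ri rh).
  right; rewrite (@rad_inj j h) ?e' //.
  by move: te e1; case: (tg t i) (tg t j) (tg t h) => [] [] [].
by case: te; case: hi hj; [lia|case=> _ ->]; case; [lia|case=> _ ->].
Qed.

Lemma twins_tight i j : twins i j -> tight (s i) n.
Proof.
move=> tw; case: (tw) => ri rj ne e; have b := prp_bound t (ps_lt t i) (k := n) ltac:(lia).
have : cd [set: 'I_n] <= 2 + cd (prp (s i) n) + cd (@set0 'I_n).
  apply: (@cd_cover _ _ _ _ i j) => h _.
  case rh: (rd h); first by case: (twins_only tw rh) => ->; [apply: Or41|apply: Or42].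
  by apply: Or43; apply: (rad_in_prp ri); rewrite rh.
by rewrite /tight cdT cd0; lia.
Qed.

Definition notwin := forall i j, rd i -> rd j -> ds i j = 0 -> i = j.

Lemma twinsVnot : (exists i j, twins i j) \/ notwin.
Proof.
have [/existsP[i /existsP[j /and4P[ri rj /eqP ne /eqP e]]]|no] :=
  boolP [exists i, exists j, [&& rd i, rd j, i != j & ds i j == 0]].
  by left; exists i, j.
right=> i j ri rj e; apply/eqP; apply: contraNT no => ne.
by apply/existsP; exists i; apply/existsP; exists j; rewrite ri rj ne e.
Qed.

(** Radii at the two ends are left out, so that an inner radius splits the set into itself and two
    smaller gaps. *)
Definition gap p k := [set i | if rd i then 0 < dist n p (s i) < k
                              else dist n p (s i) + l i <= k].

Lemma gap_split p k i j : p < n -> k <= n -> rd i -> notwin -> dist n p (s i) < n ->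
  0 < dist n p (s i) < k ->
  j \in gap p k -> [\/ j = i, j \in gap p (dist n p (s i)) |
    j \in gap (s i) (k - dist n p (s i))].
Proof.
move=> hp hk ri nt lx hx; rewrite !inE.
have := dist_tri hp (ps_lt t i) (ps_lt t j); rewrite -/(ds i j) => tri.
case rj: (rd j) => hj.
  have [e|d] := posnP (ds i j); first by apply: Or31; rewrite (nt i j).
  by case: tri => -[h1 h2]; [apply: Or33 | apply: Or32]; lia.
move/negbT: rj => rj; have := arcP rj; have := rad_arc ri rj.
by case: tri => -[h1 h2] h3 h4; [apply: Or33|apply: Or32]; lia.
Qed.

(** An inner radius at distance [d] leaves [1 + (d - 1) + (k - d - 1)] edges; without inner radii
    only arcs remain and [inn_le] or [prp_bound] applies. *)
Lemma gap_bound p k : notwin -> p < n -> 0 < k <= n -> cd (gap p k) <= k - 1.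
Proof.
move=> nt; elim/ltn_ind: k p => k IH p hp hk.
have [i /andP[ri hi]|no] := pickP [pred i | rd i && (0 < dist n p (s i) < k)].
  have lx := dist_lt hp (ps_lt t i).
  have sub : cd (gap p k) <= 1 + cd (gap p (dist n p (s i))) + cd (gap (s i) (k - dist n p (s i))).
    by apply: (@cd_cover1 _ _ _ _ i) => j; apply: gap_split => //; lia.
  have b1 := @IH (k - dist n p (s i)) ltac:(lia) _ (ps_lt t i) ltac:(lia).
  have b2 := @IH (dist n p (s i)) ltac:(lia) _ hp ltac:(lia).
  by lia.
have [kn|kn] := ltnP k n.
  have -> : gap p k = inn p k.
    by apply/setP => i; rewrite !inE; move: (no i) => /=; case: (rd i).
  by apply: inn_le; lia.
have -> : gap p k = prp p n.
  apply/setP => i; rewrite !inE; move: (no i) => /=; have [ri|ri] := boolP (rd i).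
    by have := radP ri; lia.
  by have := arcP ri; have := lv_bounds t i; lia.
by have := prp_bound t hp (k := n) ltac:(lia); lia.
Qed.

Definition nxt i j := [/\ rd i, rd j, i <> j & forall h, rd h -> h <> i -> ds i j <= ds i h].

Lemma nxt_ex i : notwin -> rd i -> exists j, nxt i j.
Proof.
move=> nt ri.
have [j0 /andP[rj0 ne0]|no] := pickP [pred j | rd j && (j != i)].
  case: (@arg_minnP _ j0 [pred j | rd j && (j != i)] (ds i)) => /= [|j /andP[rj ne] jmin].
    by rewrite rj0 ne0.
  exists j; split=> // [e|h rh /eqP nh]; first by rewrite e eqxx in ne.
  by apply: jmin; rewrite rh nh.
have : cd [set: 'I_n] <= 1 + cd (prp (s i) n) + cd (@set0 'I_n).
  apply: (@cd_cover1 _ _ _ _ i) => h _; case: (eqVneq h i) => [->|ne]; first exact: Or31.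
  by apply/Or32/(rad_in_prp ri); move: (no h); rewrite /= ne andbT => ->.
by rewrite cdT cd0; have := prp_bound t (ps_lt t i) (k := n) ltac:(lia); lia.
Qed.

Lemma nxt_pos i j : notwin -> nxt i j -> 0 < ds i j.
Proof.
move=> nt [ri rj ne _]; rewrite lt0n; apply/eqP => e; apply: ne; exact: nt.
Qed.

(** The [n] edges are the two radii, at most [ds i j - 1] arcs in the gap, and at most
    [n - ds i j - 1] edges beyond [j]. Both bounds are therefore attained, and [inn_max] supplies
    the closing arc. *)
Lemma nxt_gap i j : notwin -> nxt i j -> tight (s i) (ds i j) /\
  (ds i j = 1 \/ exists h, [/\ ~~ rd h, s h = s i & l h = ds i j]).
Proof.
move=> nt nx; case: (nx) => ri rj ne jmin.
have d0 := nxt_pos nt nx; have dn := ds_lt t i j.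
apply: inn_max; rewrite ?ps_lt //; first by lia.
have b1 := @inn_le _ t (s i) (ds i j) (ps_lt t i) ltac:(lia).
have b2 := @gap_bound (s j) (n - ds i j) nt (ps_lt t j) ltac:(lia).
have : cd [set: 'I_n] <= 2 + cd (inn (s i) (ds i j)) + cd (gap (s j) (n - ds i j)).
  apply: (@cd_cover _ _ _ _ i j) => h _.
  case: (eqVneq h i) => [->|nhi]; first exact: Or41.
  case: (eqVneq h j) => [->|nhj]; first exact: Or42.
  suff : (h \in inn (s i) (ds i j)) || (h \in gap (s j) (n - ds i j)).
    by case/orP => ?; [apply: Or43|apply: Or44].
  have dh := ds_tri t i j h.
  case rh: (rd h).
    apply/orP; right; rewrite inE rh -/(ds j h).
    have := jmin h rh ltac:(exact/eqP).
    have : ds j h <> 0 by move=> e; case/eqP: nhj; rewrite (nt j h).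
    by have := ds_lt t i h; lia.
  move/negbT: rh => rh; rewrite !inE rh (negbTE rh) -/(ds i h) -/(ds j h) /=.
  by have := rad_arc ri rh; have := rad_arc rj rh; have := arcP rh; lia.
by rewrite cdT; lia.
Qed.

Lemma rd_prp_tight i h k : 2 <= k <= n -> tight (s i) k -> ~~ rd h ->
  ds i h + l h <= k -> tight (s h) (l h).
Proof.
move=> hk tk rh le.
have [lt|ge] := ltnP (l h) k.
  by apply: tight_desc hk tk _ => //; [exact: ps_lt|rewrite inE lt].
have e : ds i h = 0 by lia.
by rewrite -(ds_eq0 e) (_ : l h = k) //; lia.
Qed.

(** The last radius before the start of [h] and its successor bound the gap, since a radius under
    [h] would cross it. *)
Lemma nxt_around h : notwin -> ~~ rd h -> exists i j, nxt i j /\ ds i h + l h <= ds i j.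
Proof.
move=> nt rh; have [i0 ri0] := rad_ex.
case: (@arg_minnP _ i0 rd (fun i => ds i h) ri0) => i ri imin.
have [j nx] := nxt_ex nt ri; exists i, j; split=> //.
case: (nx) => _ rj ne _; have := imin j rj; have := ds_tri t i j h.
have := nxt_pos nt nx; have := ds_lt t i j; have := ds_lt t i h; have := ds_lt t j h.
by have := rad_arc rj rh; have := rad_arc ri rh; have := arcP rh; lia.
Qed.

(** Every arc lies in a triangulated interval, either the polygon cut at the vertex of twins or a
    gap between consecutive radii, and tightness is inherited. *)
Lemma arc_tight h : ~~ rd h -> tight (s h) (l h).
Proof.
move=> rh; case: twinsVnot => [[i [j tw]]|nt].
  apply: (@rd_prp_tight i h n) => //; first by lia.
    exact: twins_tight tw.
  by case: tw => ri _ _ _; have := rad_in_prp ri rh; rewrite inE => /andP[].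
have [i [j [nx le]]] := nxt_around nt rh.
have := nxt_gap nt nx => -[tg _]; have := arcP rh; have := ds_lt t i j => *.
by apply: (rd_prp_tight (i := i) _ tg rh le); lia.
Qed.

End Gaps.

(** * Edges to the puncture *)

Section Central.
Variables (n : nat) (r : rel 'I_n).

(** By [mut_rad] and [mut_arc]: two radii at least two steps apart on both sides, or two arcs
    bounding a digon around the puncture. *)
Definition mut i j := r i j && r j i.
Definition adj i j := r i j || r j i.
Definition has_mut := exists i j, mut i j.
Definition branch := exists i j j', [/\ j <> j', mut i j & mut i j'].
(** [i] behaves like a leaf attached to [p]: each of its relations with a third edge passes through
    [p]. The model is a short branch of D_n. *)
Definition hang i p := i <> p /\ forall h, h <> i -> h <> p ->
  (r h i -> r h p /\ r p i) /\ (r i h -> r i p /\ r p h).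
Definition split_mut i :=
  exists j h, [/\ mut i j, h <> i, h <> j & adj h i <> adj h j].

(* Recognizes the edges to the puncture from [rl] alone, see [centralP]. The four
   alternatives correspond to the possible positions of these edges, see
   [classify]. *)
Definition central i : Prop :=
  [\/ ~ has_mut /\ (exists p j, [/\ i <> j, hang i p & hang j p]),
      split_mut i,
      branch /\ (exists j, mut i j) |
      ~ branch /\ (exists j j', [/\ mut j j', r j i, r i j' &
        ~ split_mut j \/ forall h, adj h i -> h = j \/ h = j'])].
End Central.

(** * Relations read as shared endpoints *)

Section Relations.
Variables (n : nat) (t : tri n).
Let n5 : 5 <= n := tri_n5 t.
Implicit Types i j : 'I_n.
Local Notation l := (lv t).
Local Notation ds := (ds t).
Local Notation rd := (rd t).
Local Notation rl := (rl t).
Local Notation mut := (mut rl).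
Local Notation adj := (adj rl).

Lemma dsa i j : ds i j < n /\ ((ds i j = 0 /\ ds j i = 0) \/ (0 < ds i j /\ ds i j + ds j i = n)).
Proof. by have := ds_sym t i j; have := ds_lt t i j; lia. Qed.
Lemma dst b i j : (ds b i <= ds b j /\ ds b j = ds b i + ds i j) \/
  (ds b j < ds b i /\ ds b j + n = ds b i + ds i j).
Proof. by have := ds_tri t b i j; have := ds_lt t b i; lia. Qed.

Ltac geo b x := have := dsa b x.
Ltac geo2 b x y := geo b x; geo b y; geo x y; have := dst b x y.

Lemma arc_cases i j : ~~ rd i -> ~~ rd j -> ds i j = 0 \/ (0 < ds i j /\ ds i j + l j <= l i) \/
      (l i <= ds i j /\ ds i j + l j <= n) \/ (l i <= ds i j /\ n + l i <= ds i j + l j).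
Proof. by move=> hi hj; case: (arc_arc hi hj); tauto. Qed.

Lemma rl_arcs i j : ~~ rd i -> ~~ rd j -> rl i j <->
  (ds i j = 0 /\ l i < l j) \/ (0 < ds i j /\ ds i j + l j = l i) \/
      (0 < ds i j /\ ds i j + l j = n).
Proof.
move=> hi hj; rewrite rl_arc //; split; first by case; tauto.
by case=> [h|[h|h]]; [apply: Or31|apply: Or32|apply: Or33].
Qed.

Lemma mut_rad i j : rd i -> mut i j -> [/\ rd j, 2 <= ds i j & ds i j + 2 <= n].
Proof.
move=> ri /andP[]; have [rj|rj] := boolP (rd j).
  by have := rl_rad_rad ri rj; have := rl_rad_rad rj ri; geo i j => *; split => //; lia.
by have := rl_rad_arc ri rj; have := rl_arc_rad rj ri; geo i j; lia.
Qed.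

Lemma mut_radI i j : rd i -> rd j -> 2 <= ds i j -> ds i j + 2 <= n -> mut i j.
Proof.
move=> ri rj h1 h2; rewrite /mut; have := rl_rad_rad ri rj; have := rl_rad_rad rj ri.
by geo i j; lia.
Qed.

Lemma mut_sym i j : mut i j = mut j i. Proof. by rewrite /mut andbC. Qed.

Lemma mut_arc i j : ~~ rd i -> mut i j -> [/\ ~~ rd j, ds i j = l i & l i + l j = n].
Proof.
move=> ri; rewrite mut_sym => m; have [rj|rj] := boolP (rd j).
  by have [] := mut_rad rj m; rewrite (negbTE ri).
move: m; rewrite /mut => /andP[].
have := rl_arcs ri rj; have := rl_arcs rj ri; have := arc_cases ri rj; have := arcP ri; have := arcP rj.
by geo i j => *; split => //; lia.
Qed.

Lemma mut_arcI i j : ~~ rd i -> ~~ rd j -> ds i j = l i -> l i + l j = n -> mut i j.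
Proof.
move=> ri rj; rewrite /mut.
have := rl_arcs ri rj; have := rl_arcs rj ri; have := arcP ri; have := arcP rj.
by geo i j; lia.
Qed.

Lemma mut_arc_uniq i j j' : ~~ rd i -> mut i j -> mut i j' -> j = j'.
Proof.
move=> ri /(mut_arc ri)[rj d e] /(mut_arc ri)[rj' d' e'].
by apply: (@arc_inj _ t) => //; [geo2 i j j'; lia|lia].
Qed.

Lemma branch_rad i j j' : j <> j' -> mut i j -> mut i j' -> rd i.
Proof.
move=> ne m m'; apply: contraT => ri; case: ne; exact: mut_arc_uniq m m'.
Qed.

(** Related arcs are those with a common endpoint; the five equations list which endpoints agree
    modulo [n]. *)
Lemma adj_aa i h : ~~ rd i -> ~~ rd h -> h <> i -> adj h i <->
  ds i h = 0 \/ ds i h = l i \/ ds i h + l h = n \/ ds i h + l h = l i \/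
  ds i h + l h = l i + n.
Proof.
move=> ri rh ne; have bi := arcP ri; have bh := arcP rh; rewrite /adj.
have ne' : ds i h = 0 -> l i <> l h by move=> e1 e2; apply: ne; rewrite (arc_inj ri e1 e2).
split.
  by case/orP => [/(rl_arcs rh ri)|/(rl_arcs ri rh)]; geo i h; lia.
case: (arc_cases ri rh) => [v|[v|[v|v]]] h2.
- have [lt|ge] := ltnP (l h) (l i).
    by apply/orP; left; apply/(rl_arcs rh ri); left; geo i h; lia.
  by apply/orP; right; apply/(rl_arcs ri rh); left; split => //; have := ne' v; lia.
- by apply/orP; right; apply/(rl_arcs ri rh); right; lia.
- have [e|ne2] := eqVneq (ds i h + l h) n.
    by apply/orP; right; apply/(rl_arcs ri rh); lia.
  by apply/orP; left; apply/(rl_arcs rh ri); right; right; geo i h; lia.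
- by apply/orP; left; apply/(rl_arcs rh ri); right; left; geo i h; lia.
Qed.

Lemma adj_ra i h : rd i -> ~~ rd h -> adj h i <-> ds i h = 0 \/ ds i h + l h = n.
Proof.
move=> ri rh; have bh := arcP rh; rewrite /adj; split.
  by case/orP => [/(rl_arc_rad rh ri)|/(rl_rad_arc ri rh)]; geo i h; lia.
case=> e; apply/orP; [left; apply/(rl_arc_rad rh ri)|right; apply/(rl_rad_arc ri rh)].
  by geo i h; lia.
by geo i h; lia.
Qed.

Lemma adjC i j : adj i j = adj j i. Proof. by rewrite /adj orbC. Qed.

(** The two sides of a digon have the same endpoints, hence the same neighbours. So [split_mut] can
    only hold for radii. *)
Lemma mut_arc_adj i j h : ~~ rd i -> mut i j -> h <> i -> h <> j -> adj h i -> adj h j.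
Proof.
move=> ri m; have [rj d e] := mut_arc ri m => ni nj.
have bi := arcP ri; have bj := arcP rj.
have [rh|rh] := boolP (rd h).
  by rewrite adjC => /(adj_ra rh ri) h1; rewrite adjC; apply/(adj_ra rh rj); geo2 h i j; lia.
have bh := arcP rh; move/(adj_aa ri rh ni) => A; apply/(adj_aa rj rh nj); move: A.
have := arc_cases ri rh; have := arc_cases rj rh; geo2 i j h; lia.
Qed.

Lemma split_mut_rad i : split_mut rl i -> rd i.
Proof.
move=> [j [h [m ni nj ne]]]; apply: contraT => ri; case: ne.
have [rj _ _] := mut_arc ri m.
apply/idP/idP; first exact: mut_arc_adj.
by apply: (mut_arc_adj (i := j)) => //; rewrite mut_sym.
Qed.

Lemma between_arcs j j' i : ~~ rd j -> mut j j' -> rl j i -> rl i j' -> rd i.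
Proof.
move=> rj m;  have [rj' d e] := mut_arc rj m; have bj := arcP rj; have bj' := arcP rj'.
have [//|ri] := boolP (rd i).
move=> /(rl_arcs rj ri) h1 /(rl_arcs ri rj') h2; have := arc_cases rj ri; have := arc_cases rj' ri.
by have := arcP ri; geo2 j j' i; lia.
Qed.

End Relations.

(** * Possible positions of the edges to the puncture *)

Section Configurations.
Variables (n : nat) (t : tri n).
Let n5 : 5 <= n := tri_n5 t.
Implicit Types i j : 'I_n.
Local Notation s := (ps t).
Local Notation l := (lv t).
Local Notation ds := (ds t).
Local Notation rd := (rd t).
Local Notation rl := (rl t).
Local Notation mut := (mut rl).
Ltac geo b x := have := dsa t b x.
Ltac geo2 b x y := geo b x; geo b y; geo x y; have := dst t b x y.

Definition rads2 i j := [/\ rd i, rd j, i <> j & forall h, rd h -> h = i \/ h = j].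

(** [p] and the one boundary side it does not cut off form a digon around the puncture, which
    contains both radii. *)
Definition config1 p i j := [/\ rads2 i j, ~~ rd p, (l p).+1 = n,
  ds p i = 0 \/ (ds p i).+1 = n & ds p j = 0 \/ (ds p j).+1 = n].

(** The digon around the puncture is bounded by two arcs. The radii end at one of its vertices in
    [config2], and one at each vertex in [config3]. *)
Definition config23 a b i j := [/\ rads2 i j, ~~ rd a, ~~ rd b &
  [/\ l a + l b = n, ds i a = 0 & ds i b = l a]].

Definition config2 a b i j := config23 a b i j /\ ds i j = 0.
Definition config3 a b i j := config23 a b i j /\ ds i j = l a.

(** A triangle around the puncture with two boundary sides, meeting at the vertex of [h]: the only
    position of three radii without a [branch]. *)
Definition config4 a i j h := [/\ [/\ rd i, rd j & rd h],
  forall x, rd x -> [\/ x = i, x = j | x = h], ~~ rd a &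
  [/\ (l a).+2 = n, ds i a = 0, (ds i j).+2 = n & (ds i h).+1 = n]].

Lemma ds_rw i j h : s i = s j -> ds i h = ds j h.
Proof. by rewrite /ds => ->. Qed.
Lemma ds_rwr i j h : s i = s j -> ds h i = ds h j.
Proof. by rewrite /ds => ->. Qed.

Lemma classify_twins i j : twins t i j ->
  (exists p, config1 p i j) \/ (exists a b, config2 a b i j).
Proof.
move=> tw; have ti := twins_tight tw; case: (tw) => ri rj ne e.
have r2 : rads2 i j by split=> // h; exact: twins_only tw.
have si := ps_lt t i.
have [h [hh _ [_ A] [_ B]]] := tight_split si (k := n) ltac:(lia) ti.
have dji x : ds j x = ds i x by apply/ds_rw/esym/ds_eq0.
have dij x : ds x j = ds x i by apply/ds_rwr/esym/ds_eq0.
case: A => [h1|[a [ra sa la]]].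
  case: B => [|[b [rb sb lb]]]; first by lia.
  have d : ds i b = 1 by rewrite /ds sb h1 dist_shift //; lia.
  left; exists b; split => //; rewrite ?dij ?lb; geo i b; lia.
have da : ds i a = 0 by rewrite (@ds_rwr a i) // dsii.
case: B => [h1|[b [rb sb lb]]].
  by left; exists a; split => //; rewrite ?dij ?la; geo i a; lia.
right; exists a, b; split=> //; split=> //; split=> //; first by lia.
by rewrite la /ds sb dist_shift //; lia.
Qed.

Lemma classify2 i j : notwin t -> rads2 i j ->
  (exists p, config1 p i j) \/ (exists a b, config3 a b i j).
Proof.
move=> nt r2; case: (r2) => ri rj ne all.
have nxij : nxt t i j.
  by have [x nx] := nxt_ex nt ri; case: (nx) => _ rx nix _; case: (all x rx) nx nix => -> .
have nxji : nxt t j i.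
  by have [x nx] := nxt_ex nt rj; case: (nx) => _ rx nix _; case: (all x rx) nx nix => -> .
have pij := nxt_pos nt nxij; have pji := nxt_pos nt nxji.
case: (nxt_gap nt nxij) => _ [d1|[a [ra sa la]]];
  case: (nxt_gap nt nxji) => _ [d2|[b [rb sb lb]]].
- by geo i j; lia.
- have d := ds_rw i sb; have d' := ds_rw j sb.
  by left; exists b; split; rewrite ?d ?d' ?dsii //; geo i j; lia.
- have d := ds_rw i sa; have d' := ds_rw j sa.
  by left; exists a; split; rewrite ?d ?d' ?dsii //; geo i j; lia.
right; exists a, b; split=> //; split=> //; split=> //.
- by geo i j; lia.
- by rewrite (ds_rwr i sa) dsii.
- by rewrite (ds_rwr i sb).
Qed.

(** The gap and its complement have at least two sides, so [i] and [j] are mutual. A third radius at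
    least two steps from [i] or from [j] on both sides gives a branch; otherwise it sits alone
    between [j] and [i], one step from each. *)
Lemma classify_gap i j : notwin t -> nxt t i j -> 2 <= ds i j ->
  (exists h, [/\ rd h, h <> i & h <> j]) ->
  branch rl \/ exists a h, config4 a i j h.
Proof.
move=> nt nx d2 [h [rh hi hj]]; case: (nx) => ri rj ne jmin.
have far x : rd x -> x <> i -> x <> j -> ds i j < ds i x.
  move=> rx xi xj; have := jmin x rx xi; have xj0 : ds j x <> 0.
    by move=> e; apply: xj; rewrite (nt j x).
  by geo2 i j x; lia.
have fh := far h rh hi hj.
have mij : mut i j by apply: mut_radI => //; geo i h; lia.
have [/existsP[x /and4P[rx /eqP xi /eqP xj le]]|no] :=
  boolP [exists x, [&& rd x, x != i, x != j & ds i x + 2 <= n]].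
  left; exists i, j, x; split=> //; first by move=> e; case: xj.
  by apply: mut_radI => //; have := far x rx xi xj; lia.
have last x : rd x -> x <> i -> x <> j -> (ds i x).+1 = n.
  move=> rx /eqP xi /eqP xj; move: no; rewrite negb_exists => /forallP/(_ x).
  by rewrite rx xi xj /=; geo i x; lia.
have lh := last h rh hi hj.
have [le|gt] := leqP (ds i j + 3) n.
  left; exists j, i, h; split; [by move=> e; case: hi|by rewrite mut_sym|].
  by apply: mut_radI => //; geo2 i j h; lia.
right; case: (nxt_gap nt nx) => _ [|[a [ra sa la]]]; first by lia.
exists a, h; split=> //.
  move=> x rx; have [->|xi] := eqVneq x i; first exact: Or31.
  have [->|xj] := eqVneq x j; first exact: Or32.
  apply: Or33; apply: nt => //.
  have := last x rx ltac:(exact/eqP) ltac:(exact/eqP).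
  by geo2 i x h; lia.
by rewrite (ds_rwr i sa) dsii; split; lia.
Qed.

Lemma classify3 i j h : notwin t -> rd i -> rd j -> rd h -> i <> j -> i <> h -> j <> h ->
  branch rl \/ exists a x y z, config4 a x y z.
Proof.
move=> nt ri rj rh nij nih njh.
have third x y : exists z, [/\ rd z, z <> x & z <> y].
  have [/andP[/eqP ? /eqP ?]|c1] := boolP ((i != x) && (i != y)); first by exists i.
  have [/andP[/eqP ? /eqP ?]|c2] := boolP ((j != x) && (j != y)); first by exists j.
  move: c1 c2; rewrite !negb_and !negbK => /orP[]/eqP e1 /orP[]/eqP e2; exists h;
    by split=> // e3; congruence.
have gap x y : nxt t x y -> 2 <= ds x y -> branch rl \/ exists a x y z, config4 a x y z.
  move=> nx d2; case: (classify_gap nt nx d2 (third x y)) => [|[a [z c]]]; first by left.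
  by right; exists a, x, y, z.
have [x nx] := nxt_ex nt ri; have px := nxt_pos nt nx.
have [|l1] := leqP 2 (ds i x); first exact: gap.
case: (nx) => _ rx _ _.
have [y ny] := nxt_ex nt rx; have py := nxt_pos nt ny.
have [|l2] := leqP 2 (ds x y); first exact: gap.
case: (ny) => _ ry _ _.
have [z nz] := nxt_ex nt ry; have pz := nxt_pos nt nz.
have [|l3] := leqP 2 (ds y z); first exact: gap.
case: (nz) => _ rz nyz _.
(* Three gaps of length 1 in a row: [y] and [z] lie two and three steps after [i], and [n >= 5]
   keeps both at least two steps away on the other side. *)
left; exists i, y, z; split=> //.
  by apply: mut_radI => //; geo2 i x y; lia.
by apply: mut_radI => //; geo2 i x y; geo2 i y z; lia.
Qed.

Lemma classify : [\/ exists p i j, config1 p i j, exists a b i j, config2 a b i j,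
  exists a b i j, config3 a b i j |
  branch rl \/ exists a i j h, config4 a i j h].
Proof.
case: (twinsVnot t) => [[i [j tw]]|nt].
  case: (classify_twins tw) => [[p c]|[a [b c]]]; first by apply: Or41; exists p, i, j.
  by apply: Or42; exists a, b, i, j.
have [i ri] := rad_ex t; have [j nx] := nxt_ex nt ri; case: (nx) => _ rj nij _.
have [h /and3P[rh /eqP hi /eqP hj]|no] := pickP [pred h | [&& rd h, h != i & h != j]].
  by apply/Or44/(@classify3 i j h) => //; apply/nesym.
have r2 : rads2 i j.
  split=> // h rh; move: (no h); rewrite /= rh /=.
  by case: eqP => [|_]; [left|case: eqP => //; right].
case: (classify2 nt r2) => [[p c]|[a [b c]]]; first by apply: Or41; exists p, i, j.
by apply: Or43; exists a, b, i, j.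
Qed.

End Configurations.

(** * Recognizing the edges to the puncture *)

Section Recognition.
Variables (n : nat) (t : tri n).
Let n5 : 5 <= n := tri_n5 t.
Implicit Types i j : 'I_n.
Local Notation s := (ps t).
Local Notation l := (lv t).
Local Notation ds := (ds t).
Local Notation rd := (rd t).
Local Notation rl := (rl t).
Local Notation prp := (prp t).
Local Notation mut := (mut rl).
Local Notation adj := (adj rl).
Local Notation hang := (hang rl).
Ltac geo b x := have := dsa t b x.
Ltac geo2 b x y := geo b x; geo b y; geo x y; have := dst t b x y.

(** The two lower sides of the triangle on [u] have total length at least 3, so one of them is an
    arc. *)
Lemma child u : ~~ rd u -> 3 <= l u -> exists c, [/\ ~~ rd c, l c < l u &
  ds u c = 0 \/ (0 < ds u c /\ ds u c + l c = l u)].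
Proof.
move=> ru l3; have bu := arcP ru; have su := ps_lt t u.
have [h [hh _ [_ A] [_ B]]] := tight_split su (k := l u) ltac:(lia) (arc_tight ru).
case: A => [h1|[c [rc sc lc]]]; last first.
  by exists c; split=> //; [alia|left; rewrite (ds_rwr u sc) dsii].
case: B => [|[c [rc sc lc]]]; first by alia.
exists c; split=> //; first by alia.
have d : ds u c = h by rewrite /ds sc dist_shift //; alia.
by right; alia.
Qed.

Lemma child_adj u c : ~~ rd u -> ~~ rd c -> l c < l u ->
  ds u c = 0 \/ (0 < ds u c /\ ds u c + l c = l u) -> rl c u \/ rl u c.
Proof.
move=> ru rc lt [d|d]; [left; apply/(rl_arcs rc ru)|right; apply/(rl_arcs ru rc)].
  by geo u c; alia.
by alia.
Qed.

(* [q] is the shortest arc above [u]; the third side [w] of the triangle on [q]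
   and [u] is either an arc or a boundary side. *)
Lemma parent p u : ~~ rd p -> ~~ rd u -> u \in prp (s p) (l p) ->
  exists q, ~~ rd q /\
   exists2 k, 0 < k < l q &
    (forall x, ~~ rd x -> l x < l q -> ds q x + l x <= l q ->
       ds q x + l x <= k \/ k <= ds q x) /\
    ([/\ ds q u = 0, l u = k &
      k.+1 = l q \/ exists w, [/\ ~~ rd w, ds q w = k & k + l w = l q]] \/
     [/\ ds q u = k, k + l u = l q &
      k = 1 \/ exists w, [/\ ~~ rd w, ds q w = 0 & l w = k]]).
Proof.
move=> rp ru up.
have [q /andP[rq uq] qmin] :
  {q | ~~ rd q && (u \in prp (s q) (l q)) &
     forall x, ~~ rd x -> u \in prp (s x) (l x) -> l q <= l x}.
  have Pp : ~~ rd p && (u \in prp (s p) (l p)) by rewrite rp up.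
  case: (@arg_minnP _ p [pred q | ~~ rd q && (u \in prp (s q) (l q))] l Pp) => q Pq qm.
  by exists q => // x rx ux; apply: qm; rewrite inE rx ux.
exists q; split=> //.
have bq := arcP rq; have sq := ps_lt t q; have bu := arcP ru.
have [k [hk sub [_ A] [_ B]]] := tight_split sq (k := l q) ltac:(lia) (arc_tight rq).
have sk : shiftn n (s q) k < n by apply: shift_lt; alia.
have dk x : (k <= ds q x /\ ds q x = k + dist n (shiftn n (s q) k) (s x)) \/
   (ds q x < k /\ ds q x + n = k + dist n (shiftn n (s q) k) (s x)).
  have := dist_tri sq sk (ps_lt t x); rewrite dist_shift //; last by alia.
  have := dist_lt sk (ps_lt t x); rewrite -/(ds q x); alia.
exists k => //; split.
  move=> x rx lx dx; have : x \in prp (s q) (l q) by rewrite inE lx.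
  move/(subsetP sub); rewrite !inE (negbTE rx) /= -/(ds q x).
  by have := dk x; have := arcP rx; have := ds_lt t q x; alia.
move/(subsetP sub): uq; rewrite inE => /orP[] u_in.
- left; case: (inn_cases sq (k := k) ltac:(lia) u_in) => [[su lu]|u_prp].
    split=> //; first by rewrite (ds_rwr q su) dsii.
    case: B => [|[w [rw sw lw]]]; [by left; alia|right; exists w].
    by split=> //; [rewrite /ds sw dist_shift //; alia|alia].
  case: A => [k1|[w [rw sw lw]]]; first by move: u_prp; rewrite inE; alia.
  have := qmin w rw; rewrite sw lw u_prp => /(_ isT); alia.
right; case: (inn_cases sk (k := l q - k) ltac:(lia) u_in) => [[su lu]|u_prp].
  split; [by rewrite /ds su dist_shift //; alia|alia|].
  case: A => [|[w [rw sw lw]]]; [by left|right; exists w].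
  by split=> //; rewrite (ds_rwr q sw) dsii.
case: B => [k1|[w [rw sw lw]]]; first by move: u_prp; rewrite inE; alia.
have := qmin w rw; rewrite sw lw u_prp => /(_ isT); alia.
Qed.

Section Config1.
Variables p i j : 'I_n.
Hypothesis c1 : config1 t p i j.

Let rp : ~~ rd p. Proof. by case: c1. Qed.
Let lp : (l p).+1 = n. Proof. by case: c1. Qed.
Let ri : rd i. Proof. by case: c1 => [[]]. Qed.
Let rj : rd j. Proof. by case: c1 => [[]]. Qed.

Lemma c1_arc h : ~~ rd h -> h = p \/ (l h < l p /\ ds p h + l h <= l p).
Proof.
move=> rh; have [->|/eqP ne] := eqVneq h p; [by left|right].
have ne' : ds p h = 0 -> l h <> l p by move=> d /esym e; apply: ne; rewrite (arc_inj rp d e).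
by have := arc_cases rp rh; have := arcP rh; have := ds_lt t p h; alia.
Qed.

Lemma c1_rad h : rd h -> ds p h = 0 \/ (ds p h).+1 = n.
Proof. by case: c1 => -[_ _ _ all] _ _ hi hj /all[->|->]. Qed.

Lemma c1_nomut : ~ has_mut rl.
Proof.
move=> [x [y m]]; have [rx|rx] := boolP (rd x).
  have [ry h1 h2] := mut_rad rx m.
  by have := c1_rad rx; have := c1_rad ry; geo2 p x y; alia.
have [ry h1 h2] := mut_arc rx m; have bx := arcP rx; have b_y := arcP ry.
have le h : ~~ rd h -> ds p h + l h <= l p.
  by case/c1_arc => [->|[]//]; rewrite dsii.
by have := le x rx; have := le y ry; geo2 p x y; alia.
Qed.

Lemma c1_hang h : rd h -> hang h p.
Proof.
move=> rh; split=> [e|x xh xp]; first by move: rp; rewrite -e rh.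
have [rx|rx] := boolP (rd x).
  have := c1_rad rx; have := c1_rad rh => h1 h2.
  split=> /rl_rad_rad-/(_ ltac:(done) ltac:(done)) h3; split;
    first [apply/(rl_rad_arc _ rp) => //|apply/(rl_arc_rad rp) => //];
    geo2 p x h; alia.
case: (c1_arc rx) => // h3; have bx := arcP rx; have h1 := c1_rad rh.
split.
  move/(rl_arc_rad rx rh) => e; split; first by apply/(rl_arcs rx rp); geo2 p x h; alia.
  by apply/(rl_arc_rad rp rh); geo2 p x h; alia.
move/(rl_rad_arc rh rx) => e; split; first by apply/(rl_rad_arc rh rp); geo2 p h x; alia.
by apply/(rl_arcs rp rx); geo2 p h x; alia.
Qed.

(** No edge sits between [p] and a radius ending at one of its endpoints, and at least one of the
    two radii differs from [q]. *)
Lemma c1_hang_p q : ~ hang p q.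
Proof.
have ne : i <> j by case: c1 => -[].
case=> npq hg.
have [w [rw nwq]] : exists w, rd w /\ w <> q.
  by have [e|/eqP] := eqVneq i q; [exists j; split=> // e'; apply: ne; rewrite e|exists i].
have wp : w <> p by move=> e; move: rp; rewrite -e rw.
have [A B] := hg w wp nwq.
case: (c1_rad rw) => d.
  have [|h1 h2] := B; first by apply/(rl_arc_rad rp rw).
  have [rq|rq] := boolP (rd q).
    by move/(rl_arc_rad rp rq): h1; move/(rl_rad_rad rq rw): h2; geo2 p q w; alia.
  case: (c1_arc rq) => h3; first by case: npq.
  by move/(rl_arcs rp rq): h1; move/(rl_arc_rad rq rw): h2; have := arcP rq; geo2 p q w; alia.
have [|h1 h2] := A; first by apply/(rl_rad_arc rw rp); geo p w; alia.
have [rq|rq] := boolP (rd q).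
  move/(rl_rad_rad rw rq): h1; move/(rl_rad_arc rq rp): h2; geo2 p q w; geo2 p w q; alia.
case: (c1_arc rq) => h3; first by case: npq.
by move/(rl_rad_arc rw rq): h1; move/(rl_arcs rq rp): h2; have := arcP rq; geo2 p w q; alia.
Qed.

(** Nothing sits between [u] and the arc [Q] directly above it, so [q = Q]. An arc as sibling or
    child of [u] would, through [hang], give a map opposite to the one between [u] and [Q],
    contradicting [c1_nomut]. *)
Lemma c1_hang_arc u q : hang u q -> ~~ rd u ->
  [/\ ~~ rd q, l u = 2, l q = 3 & ds q u = 0 \/ ds q u = 1].
Proof.
move=> hg ru; have bu := arcP ru.
case: (c1_arc ru) => [e|h3]; first by move: hg; rewrite e => /c1_hang_p.
have up : u \in prp (s p) (l p) by rewrite inE -/(ds p u); alia.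
have [Q [rQ [k hk [cov PC]]]] := parent rp ru up.
have bQ := arcP rQ.
have nomut x y : rl x y -> rl y x -> False.
  by move=> h1 h2; apply: c1_nomut; exists x, y; rewrite /mut h1 h2.
case: hg => nuq hg.
have [uQ|Qu] : rl u Q \/ rl Q u.
    by case: PC => -[h1 h2 _]; [left; apply/(rl_arcs ru rQ)|right; apply/(rl_arcs rQ ru)]; geo Q u; alia.
- have {PC} : [/\ ds Q u = 0, l u = k &
      k.+1 = l Q \/ exists w, [/\ ~~ rd w, ds Q w = k & k + l w = l Q]].
    case: PC => // -[h1 h2 _]; case: (nomut u Q uQ); apply/(rl_arcs rQ ru); alia.
  case=> d lu sib.
  have Qne : Q <> u by move=> e; move: hk; rewrite -lu e; alia.
  have eq : q = Q.
    apply/eqP; apply: contraT => /eqP ne.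
    have [_ /(_ uQ)[h1 h2]] := hg Q Qne (nesym ne).
    have [rq|rq] := boolP (rd q).
      by move/(rl_arc_rad ru rq): h1; move/(rl_rad_arc rq rQ): h2; geo2 Q u q; alia.
    have nm : ~ (0 < ds Q q /\ ds Q q + l q = n).
      by move=> h; apply: (nomut q Q h2); apply/(rl_arcs rQ rq); right; right.
    have := cov q rq; have b_q := arcP rq.
    move/(rl_arcs ru rq): h1; move/(rl_arcs rq rQ): h2.
    case: (arc_cases rQ rq) => [v|[v|[v|v]]]; geo2 Q u q; alia.
  subst q.
  case: sib => [kq|[w [rw dw lw]]]; last first.
    have wu : w <> u by move=> e; move: dw; rewrite e d; alia.
    have wQ : w <> Q by move=> e; move: dw; rewrite e dsii; alia.
    have [/(_ _)[|_ h]] := hg w wu wQ; last by case: (nomut _ _ uQ h).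
    by apply/(rl_arcs rw ru); have := arcP rw; geo2 Q u w; geo u w; alia.
  have [l2|l3] := leqP (l u) 2; first by split=> //; [alia|alia|left].
  have [c [rc lc dc]] := child ru l3; have bc := arcP rc.
  have cu : c <> u by move=> e; move: lc; rewrite e ltnn.
  have cQ : c <> Q by move=> e; move: lc; rewrite e; alia.
  have [A B] := hg c cu cQ.
  case: (child_adj ru rc lc dc) => h; first by case: (A h) => _ /(nomut _ _ uQ).
  case: (B h) => _ /(rl_arcs rQ rc) h2; move/(rl_arcs ru rc): h => h1.
  by geo2 Q u c; alia.
have {PC} : [/\ ds Q u = k, k + l u = l Q &
      k = 1 \/ exists w, [/\ ~~ rd w, ds Q w = 0 & l w = k]].
  case: PC => // -[h1 h2 _]; case: (nomut Q u Qu); apply/(rl_arcs ru rQ); geo Q u; alia.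
case=> d lu sib.
have Qne : Q <> u by move=> e; move: lu; rewrite e; alia.
have eq : q = Q.
  apply/eqP; apply: contraT => /eqP ne.
  have [/(_ Qu)[h1 h2] _] := hg Q Qne (nesym ne).
  have [rq|rq] := boolP (rd q).
    by move/(rl_arc_rad rQ rq): h1; move/(rl_rad_arc rq ru): h2; geo2 Q u q; geo2 Q q u; alia.
  have nm : ~ (0 < ds q Q /\ ds q Q + l Q = n).
    by move=> h; apply: (nomut Q q h1); apply/(rl_arcs rq rQ); right; right.
  have := cov q rq; have b_q := arcP rq.
  move/(rl_arcs rQ rq): h1; move/(rl_arcs rq ru): h2.
  case: (arc_cases rQ rq) => [v|[v|[v|v]]]; geo2 Q q u; alia.
subst q.
case: sib => [kq|[w [rw dw lw]]]; last first.
  have wu : w <> u by move=> e; move: dw; rewrite e d; alia.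
  have wQ : w <> Q by move=> e; move: lw; rewrite e; alia.
  have [_ /(_ _)[|h _]] := hg w wu wQ; last by case: (nomut _ _ Qu h).
  by apply/(rl_arcs ru rw); have := arcP rw; geo2 Q u w; geo u w; alia.
have [l2|l3] := leqP (l u) 2; first by split=> //; [alia|alia|right; alia].
have [c [rc lc dc]] := child ru l3; have bc := arcP rc.
have cu : c <> u by move=> e; move: lc; rewrite e ltnn.
have cQ : c <> Q by move=> e; move: lc; rewrite e; alia.
have [A B] := hg c cu cQ.
case: (child_adj ru rc lc dc) => h; last by case: (B h) => /(nomut _ _ Qu).
case: (A h) => /(rl_arcs rc rQ) h2 _; move/(rl_arcs rc ru): h => h1.
by geo2 Q u c; alia.
Qed.

(** An arc hangs only as a side of level 2 on an arc of level 3. Two such sides would cross, and a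
    radius hangs on no arc other than [p], whose level [n - 1] is not 3 because [n >= 5]. *)
Lemma c1_fork u v q : u <> v -> hang u q -> hang v q -> rd u.
Proof.
move=> ne hu hv; have [//|ru] := boolP (rd u).
have [rq lu lq du] := c1_hang_arc hu ru.
have [rv|rv] := boolP (rd v); last first.
  have [_ lv _ dv] := c1_hang_arc hv rv.
  have ne' : ds u v <> 0 by move=> e; apply: ne; apply: arc_inj e _ => //; rewrite lu lv.
  by have := arc_cases ru rv; geo2 q u v; alia.
have bq := arcP rq.
have qp : q <> p by move=> e; move: lq; rewrite e; alia.
have pv : p <> v by move=> e; move: rp; rewrite e rv.
case: (c1_arc rq) => // h3.
have [A B] := hv.2 p pv (nesym qp).
case: (c1_rad rv) => d.
  have [|h1 h2] := A; first by apply/(rl_arc_rad rp rv).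
  by move/(rl_arcs rp rq): h1; move/(rl_arc_rad rq rv): h2; geo2 p q v; alia.
have [|h1 h2] := B; first by apply/(rl_rad_arc rv rp); geo p v; alia.
by move/(rl_rad_arc rv rq): h1; move/(rl_arcs rq rp): h2; geo2 p v q; alia.
Qed.

Lemma c1_central u : rd u -> central rl u.
Proof.
move=> ru; apply: Or41; split; first exact: c1_nomut.
have : u = i \/ u = j by case: c1 => -[_ _ _ all] *; apply: all.
have ne : i <> j by case: c1 => -[].
case=> ->; [exists p, j|exists p, i]; split; try exact: c1_hang; congruence.
Qed.

End Config1.

(** A child of [a] shares exactly one endpoint with [a], so it is related to exactly one of the two
    radii at the ends of [a]. *)
Lemma split_of_child a i j : rd i -> rd j -> ~~ rd a -> ds i a = 0 -> ds i j = l a ->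
  3 <= l a -> (l a).+2 <= n -> split_mut rl i /\ split_mut rl j.
Proof.
move=> ri rj ra da dj l3 ln.
have [c [rc lc dc]] := child ra l3; have bc := arcP rc.
have ic : c <> i by move=> e; move: rc; rewrite e ri.
have jc : c <> j by move=> e; move: rc; rewrite e rj.
have mij : mut i j by apply: mut_radI => //; alia.
have ne : adj c i <> adj c j.
  move=> e; case: dc => dc.
    have : adj c i by apply/(adj_ra ri rc); left; geo2 i a c; alia.
    by rewrite e => /(adj_ra rj rc); geo2 i j c; geo2 i a c; alia.
  have : adj c j.
    by apply/(adj_ra rj rc); right; geo2 i j c; geo2 i a c; alia.
  by rewrite -e => /(adj_ra ri rc); geo2 i a c; alia.
split; first by exists j, c.
by exists i, c; split=> //; [rewrite mut_sym|apply: nesym].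
Qed.

(** From [l a + l b = n >= 5], one side of the digon has level at least 3 and thus a child. *)
Lemma c3_split a b i j : config3 t a b i j -> split_mut rl i /\ split_mut rl j.
Proof.
case=> -[[ri rj ne all] ra rb [lab da db]] dij; have ba := arcP ra; have bb := arcP rb.
have [l3|l2] := leqP 3 (l a); first by apply: (split_of_child ri rj ra) => //; alia.
have [] // := @split_of_child b j i rj ri rb; try by (geo2 i j b; alia).
Qed.

Lemma c4_split a i j h : config4 t a i j h -> split_mut rl i /\ split_mut rl j.
Proof.
case=> -[ri rj rh] all ra [la da dj dh]; apply: (split_of_child ri rj ra) => //; alia.
Qed.

Lemma c4_mut a i j h x y : config4 t a i j h -> rd x -> mut x y ->
  (x = i /\ y = j) \/ (x = j /\ y = i).
Proof.
case=> -[ri rj rh] all ra [la da dj dh] rx m; have [ry h1 h2] := mut_rad rx m.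
case: (all x rx) (all y ry) => [e|e|e] [e'|e'|e']; subst x y;
  try (by left); try (by right); exfalso; rewrite ?dsii in h1; geo2 i j h; geo2 i h j; alia.
Qed.

(** An arc and its mutual partner enclose the puncture in a digon, so radii can end at its two
    vertices only. *)
Lemma three_rads i j h x y : rd i -> rd j -> rd h -> ds i j <> 0 -> ds i h <> 0 ->
  ds j h <> 0 -> ~~ rd x -> ~ mut x y.
Proof.
move=> ri rj rh nij nih njh rx m; have [ry d e] := mut_arc rx m.
have at_end z : rd z -> ds x z = 0 \/ ds x z = l x.
  move=> rz; have := arc_rad rz rx; have := arc_rad rz ry; have := arcP rx; have := arcP ry.
  by geo2 x y z; alia.
have := at_end i ri; have := at_end j rj; have := at_end h rh.
by geo2 x i j; geo2 x i h; geo2 x j h; alia.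
Qed.

Lemma branch_rads i j j' : j <> j' -> mut i j -> mut i j' ->
  notwin t /\ [/\ rd i, rd j, rd j' & [/\ ds i j <> 0, ds i j' <> 0 & ds j j' <> 0]].
Proof.
move=> ne m m'; have ri := branch_rad ne m m'.
have [rj h1 h2] := mut_rad ri m; have [rj' h1' h2'] := mut_rad ri m'.
have nt : notwin t.
  case: (twinsVnot t) => // -[x [y tw]]; case: (tw) => rx ry _ /ds_eq0 e.
  have sx z : rd z -> s z = s x by move/(twins_only tw) => [->|->].
  by move: h1; rewrite /ds !sx // /dist leqnn subnn.
split=> //; split=> //; split; try alia.
by move=> e; apply: ne; apply: nt.
Qed.

Lemma branch_noarc x y : branch rl -> ~~ rd x -> ~ mut x y.
Proof.
move=> [i [j [j' [ne m m']]]].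
have [_ [ri rj rj' [h1 h2 h3]]] := branch_rads ne m m'; exact: three_rads h1 h2 h3.
Qed.

(** All radii at other vertices would be one step away from a radius without mutual partner, leaving
    room for two of them; a branch provides three. *)
Lemma branch_central u : branch rl -> rd u -> central rl u.
Proof.
move=> br ru; apply: Or43; split=> //; case: br => i [j [j' [ne m m']]].
have [nt [ri rj rj' [h1 h2 h3]]] := branch_rads ne m m'.
have [d1 d2] : 2 <= ds i j /\ ds i j + 2 <= n by case: (mut_rad ri m).
have [d3 d4] : 2 <= ds i j' /\ ds i j' + 2 <= n by case: (mut_rad ri m').
have [e|ui] := eqVneq i u; first by exists j; rewrite -e.
have [e|uj] := eqVneq j u; first by exists i; rewrite -e mut_sym.
have [e|uj'] := eqVneq j' u; first by exists i; rewrite -e mut_sym.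
have [/existsP[v muv]|no] := boolP [exists v, mut u v]; first by exists v.
have near v : rd v -> v != u -> ds u v = 1 \/ (ds u v).+1 = n.
  move=> rv vu; have n0 : ds u v <> 0 by move=> e; case/eqP: vu; rewrite (nt u v).
  move: no; rewrite negb_exists => /forallP/(_ v)/negP no.
  have [g1|g1] := leqP 2 (ds u v); last by left; alia.
  have [g2|g2] := leqP (ds u v + 2) n; first by case: no; apply: mut_radI.
  by right; geo u v; alia.
have := near i ri ui; have := near j rj uj; have := near j' rj' uj'.
by geo2 u i j; geo2 u i j'; geo2 u j j'; alia.
Qed.

Lemma c23_mut a b i j : config23 t a b i j -> mut a b.
Proof.
case=> -[ri rj ne all] ra rb [lab da db]; apply: mut_arcI => //.
by geo2 i a b; alia.
Qed.

Lemma c2_norad a b i j x y : config2 t a b i j -> rd x -> ~ mut x y.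
Proof.
case=> -[[ri rj ne all] ra rb _] d rx m; have [ry h1 h2] := mut_rad rx m.
have e := ds_eq0 d; have sx z : rd z -> s z = s i by move/all => [->|->].
by move: h1; rewrite /ds !sx // /dist leqnn subnn.
Qed.

Lemma c2_nobranch a b i j : config2 t a b i j -> ~ branch rl.
Proof.
move=> c [x [y [y' [ne m m']]]]; have rx := branch_rad ne m m'.
exact: (c2_norad c rx m).
Qed.

Lemma c2_central a b i j u : config2 t a b i j -> rd u -> central rl u.
Proof.
move=> c ru; apply: Or44; split; first exact: c2_nobranch c.
exists a, b; have m := c23_mut c.1.
case: (c) => -[[ri rj ne all] ra rb [lab da db]] d.
have du x : ds u x = ds i x.
  by case: (all u ru) => -> //; apply/ds_rw/esym/ds_eq0.
split=> //.
- apply/(rl_arc_rad ra ru); have := du a; geo u a; alia.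
- by apply/(rl_rad_arc ru rb); rewrite du; have := arcP ra; alia.
- by left=> /split_mut_rad; rewrite (negbTE ra).
Qed.

Lemma c3_central a b i j u : config3 t a b i j -> rd u -> central rl u.
Proof.
move=> c ru; have [si sj] := c3_split c; case: c => -[[ri rj ne all] _ _ _] _.
by apply: Or42; case: (all u ru) => ->.
Qed.

Lemma c4_nobranch a i j h : config4 t a i j h -> ~ branch rl.
Proof.
move=> c [x [y [y' [ne m m']]]]; have rx := branch_rad ne m m'.
case: (c4_mut c rx m) (c4_mut c rx m') => -[e1 e2] [[e3 e4]|[e3 e4]]; apply: ne; subst => //.
Qed.

Lemma c4_central a i j h u : config4 t a i j h -> rd u -> central rl u.
Proof.
move=> c ru; have [si sj] := c4_split c; have nb := c4_nobranch c.
case: (c) => -[ri rj rh] all ra [la da dj dh].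
case: (all u ru) => ->; try exact: Or42.
(* The remaining radius [h] has no mutual partner. It sits between [j] and [i], and no arc ends at
   its vertex, which lies between two boundary sides of the triangle. *)
apply: Or44; split=> //; exists j, i; split.
- by apply: mut_radI => //; geo i j; alia.
- by apply/(rl_rad_rad rj rh); geo2 i j h; alia.
- by apply/(rl_rad_rad rh ri); geo i h; alia.
right=> x ax; have [rx|rx] := boolP (rd x).
  case: (all x rx) => e; [by right|by left|].
  by move: ax; rewrite e /adj /rl eqxx.
move/(adj_ra rh rx): ax; have := rad_arc ri rx; have := rad_arc rj rx; have := arcP rx.
by geo2 i h x; geo2 i j x; alia.
Qed.

Lemma central_rad u : central rl u -> rd u.
Proof.
have HM i j : mut i j -> has_mut rl by exists i, j.
case.
- case=> nm [q [v [ne hu hv]]].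
  case: (classify t) => [[p [i [j c]]]|[a [b [i [j c]]]]|[a [b [i [j c]]]]|[[i [j [j' [_ m _]]]]|[a [i [j [h c]]]]]].
  + exact: c1_fork c _ _ _ ne hu hv.
  + by case: nm; apply: HM (c23_mut c.1).
  + by case: nm; apply: HM (c23_mut c.1).
  + by case: nm; apply: HM m.
  + case: c => -[ri rj rh] all ra [la da dj dh].
    by case: nm; apply: HM (mut_radI ri rj _ _); alia.
- exact: split_mut_rad.
- case=> br [v m]; apply: contraT => ru; case: (branch_noarc br ru m).
case=> nb [j [j' [m ju uj' iso]]].
have [rj|rj] := boolP (rd j); last exact: between_arcs rj m ju uj'.
have [rj' d1 d2] := mut_rad rj m.
(* An arc [u] would run from the vertex of [j'] to that of [j]. Unless it passes over a third
   radius, it has an adjacent arc, the other side of the digon or a child, while [split_mut j]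
   holds; this defeats both clauses. *)
have [//|ru] := boolP (rd u); have bu := arcP ru.
move/(rl_rad_arc rj ru): ju => -[d3 d4]; move/(rl_arc_rad ru rj'): uj' => d5.
case: (classify t) => [[p [i [k c]]]|[a [b [i [k c]]]]|[a [b [i [k c]]]]|[//|[a [i [k [h c]]]]]].
- by case: (c1_nomut c); apply: HM m.
- by case: (c2_norad c rj m).
- have [si sk] := c3_split c; have mab := c23_mut c.1.
  case: (c) => -[[ri rk ne all] ra rb [lab da db]] dik.
  case: iso => [ns|iso]; first by case: ns; case: (all j rj) => ->.
  have aj x : ~~ rd x -> adj x u -> False.
    by move=> rx /iso[e|e]; move: rx; rewrite e ?rj ?rj'.
  have : u = a \/ u = b.
    case: (all j rj) (all j' rj') => e [] e'; subst; rewrite ?dsii in d1; try alia.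
      by right; apply: (arc_inj (t := t)) => //; geo2 i k u; geo2 i b u; geo2 i k b; alia.
    by left; apply: (arc_inj (t := t)) => //; geo2 i k u; geo2 i a u; geo2 i k a; alia.
  case=> e; [case: (aj b)|case: (aj a)] => //; rewrite e; move: mab; rewrite /mut /adj.
    by case/andP => -> ->.
  by case/andP => -> ->.
have [si sk] := c4_split c.
case: (c) => -[ri rk rh] all ra [la da dj dh].
case: iso => [ns|iso]; first by case: ns; case: (c4_mut c rj m) => -[-> _].
have aj x : ~~ rd x -> adj x u -> False.
  by move=> rx /iso[e|e]; move: rx; rewrite e ?rj ?rj'.
have := rad_arc rh ru; case: (c4_mut c rj m) => -[e e']; subst j j'.
  by geo2 i k u; geo2 i h u; geo2 i k h; alia.
move=> _; have lu : 3 <= l u by geo2 i k u; alia.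
have [x [rx lx dx]] := child ru lu; case: (aj x rx).
by rewrite /adj; case: (child_adj ru rx lx dx) => ->; rewrite ?orbT.
Qed.

Theorem centralP u : rd u <-> central rl u.
Proof.
split; last exact: central_rad.
move=> ru.
case: (classify t) => [[p [i [k c]]]|[a [b [i [k c]]]]|[a [b [i [k c]]]]|[br|[a [i [k [h c]]]]]].
- exact: c1_central c _ ru.
- exact: c2_central c ru.
- exact: c3_central c ru.
- exact: branch_central.
- exact: c4_central c ru.
Qed.

End Recognition.

(** * Rigidity *)

Section Chains.
Variables (n : nat) (t : tri n).
Let n5 : 5 <= n := tri_n5 t.
Implicit Types i j : 'I_n.
Local Notation s := (ps t).
Local Notation l := (lv t).
Local Notation ds := (ds t).
Local Notation rd := (rd t).
Local Notation rl := (rl t).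
Local Notation tight := (tight t).
Ltac geo b x := have := dsa t b x.
Ltac geo2 b x y := geo b x; geo b y; geo x y; have := dst t b x y.

(* [lchain p k x]: the arc [x] lies inside the interval of length [k] at [p]
    and starts at [p]; [rchain p k x]: it ends at [p + k]. *)
Definition lchain p k x := l x < k /\ dist n p (s x) = 0.
Definition rchain p k x := l x < k /\ dist n p (s x) + l x = k.

(** An arc inside [c] at the endpoint shared with [m] is related to both; one at the other end of
    [c] is related to [c] but not to [m]. This lemma and the next three turn this into formulas in
    [rl]. *)
Lemma lchain_l m c x : ~~ rd m -> ~~ rd c -> ~~ rd x -> lchain (s m) (l m) c ->
  lchain (s c) (l c) x <-> rl x c /\ rl x m.
Proof.
rewrite /lchain -!/(ds _ _) => rm rc rx [lc dc]; have bx := arcP rx; split.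
  case=> lx dx; split; [apply/(rl_arcs rx rc)|apply/(rl_arcs rx rm)];
  by left; geo2 m c x; alia.
case=> /(rl_arcs rx rc) h1 /(rl_arcs rx rm) h2; have bm := arcP rm; have bc := arcP rc.
by case: (arc_cases rm rx) => [v|[v|[v|v]]]; geo2 m c x; alia.
Qed.

Lemma rchain_l m c x : ~~ rd m -> ~~ rd c -> ~~ rd x -> lchain (s m) (l m) c ->
  rchain (s c) (l c) x <-> [/\ rl c x, ~ rl x m, ~ rl m x & x <> m].
Proof.
rewrite /lchain /rchain -!/(ds _ _) => rm rc rx [lc dc].
have bx := arcP rx; have bm := arcP rm; have bc := arcP rc; split.
  case=> lx dx; split.
  - by apply/(rl_arcs rc rx); right; left; alia.
  - by move/(rl_arcs rx rm); geo2 m c x; alia.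
  - by move/(rl_arcs rm rx); geo2 m c x; alia.
  - by move=> e; move: lx; rewrite e; alia.
case=> /(rl_arcs rc rx) h1 h2 h3 ne.
have ne' : ds m x = 0 -> l m <> l x by move=> e1 e2; apply: ne; rewrite (arc_inj rm e1 e2).
have {}h2 : ~ (ds x m = 0 /\ l x < l m) by move=> h; apply: h2; apply/(rl_arcs rx rm); left.
have {}h3 : ~ (ds m x = 0 /\ l m < l x) /\ ~ (0 < ds m x /\ ds m x + l x = n).
  by split=> h; apply: h3; apply/(rl_arcs rm rx); [left|right; right].
case: h3 => h3 h4.
by case: (arc_cases rm rx) => [v|[v|[v|v]]]; geo2 m c x; alia.
Qed.

Lemma rchain_r m c x : ~~ rd m -> ~~ rd c -> ~~ rd x -> rchain (s m) (l m) c ->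
  rchain (s c) (l c) x <-> rl c x /\ rl m x.
Proof.
rewrite /rchain -!/(ds _ _) => rm rc rx [lc dc].
have bx := arcP rx; have bm := arcP rm; have bc := arcP rc; split.
  by case=> lx dx; split; [apply/(rl_arcs rc rx)|apply/(rl_arcs rm rx)]; geo2 m c x; alia.
case=> /(rl_arcs rc rx) h1 /(rl_arcs rm rx) h2.
by case: (arc_cases rm rx) => [v|[v|[v|v]]]; geo2 m c x; alia.
Qed.

Lemma lchain_r m c x : ~~ rd m -> ~~ rd c -> ~~ rd x -> rchain (s m) (l m) c ->
  lchain (s c) (l c) x <-> [/\ rl x c, ~ rl x m, ~ rl m x & x <> m].
Proof.
rewrite /lchain /rchain -!/(ds _ _) => rm rc rx [lc dc].
have bx := arcP rx; have bm := arcP rm; have bc := arcP rc; split.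
  case=> lx dx; split.
  - by apply/(rl_arcs rx rc); left; geo c x; alia.
  - by move/(rl_arcs rx rm); geo2 m c x; alia.
  - by move/(rl_arcs rm rx); geo2 m c x; alia.
  - by move=> e; move: lx; rewrite e; alia.
case=> /(rl_arcs rx rc) h1 h2 h3 ne.
have ne' : ds m x = 0 -> l m <> l x by move=> e1 e2; apply: ne; rewrite (arc_inj rm e1 e2).
have {}h3 : ~ (0 < ds m x /\ ds m x + l x = l m).
  by move=> h; apply: h3; apply/(rl_arcs rm rx); right; left.
have {}h2 : ~ (0 < ds x m /\ ds x m + l m = l x) /\ ~ (0 < ds x m /\ ds x m + l m = n).
  by split=> h; apply: h2; apply/(rl_arcs rx rm); [right; left|right; right].
case: h2 => h2 h4.
by case: (arc_cases rm rx) => [v|[v|[v|v]]]; geo2 m c x; alia.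
Qed.

(* The same when the enclosing interval is the whole polygon, cut at the vertex
   of a radius. *)
Lemma radius_chain i c x : rd i -> ~~ rd c -> ~~ rd x ->
  (ds i c = 0 ->
    (lchain (s c) (l c) x <-> rl x c /\ rl x i) /\
    (rchain (s c) (l c) x <-> [/\ rl c x, ~ rl x i & ~ rl i x])) /\
  (ds i c + l c = n ->
    (rchain (s c) (l c) x <-> rl c x /\ rl i x) /\
    (lchain (s c) (l c) x <-> [/\ rl x c, ~ rl x i & ~ rl i x])).
Proof.
rewrite /lchain /rchain -!/(ds _ _) => ri rc rx.
have bx := arcP rx; have bc := arcP rc; have vc := rad_arc ri rc; have vx := rad_arc ri rx.
have XI := rl_arc_rad rx ri; have IX := rl_rad_arc ri rx.
split=> d; split.
- split; first by case=> h1 h2; split; [apply/(rl_arcs rx rc)|apply/XI]; geo2 i c x; alia.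
  by case=> /(rl_arcs rx rc) h1 /XI h2; geo2 i c x; alia.
- split.
    case=> h1 h2; split; first by apply/(rl_arcs rc rx); alia.
      by move/XI; geo2 i c x; alia.
    by move/IX; geo2 i c x; alia.
  case=> /(rl_arcs rc rx) h1 h2 h3.
  have {}h2 : ds x i <> 0 by move/XI.
  have {}h3 : ~ (0 < ds i x /\ ds i x + l x = n) by move/IX.
  by geo2 i c x; alia.
- split; first by case=> h1 h2; split; [apply/(rl_arcs rc rx)|apply/IX]; geo2 i c x; alia.
  by case=> /(rl_arcs rc rx) h1 /IX h2; geo2 i c x; alia.
split.
  case=> h1 h2; split; first by apply/(rl_arcs rx rc); geo c x; alia.
    by move/XI; geo2 i c x; alia.
  by move/IX; geo2 i c x; alia.
case=> /(rl_arcs rx rc) h1 h2 h3.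
have {}h2 : ds x i <> 0 by move/XI.
have {}h3 : ~ (0 < ds i x /\ ds i x + l x = n) by move/IX.
have := arc_cases rc rx.
by geo2 i c x; alia.
Qed.

Lemma kids p k : p < n -> 2 <= k <= n -> tight p k -> exists2 h, 0 < h < k &
  [/\ forall x, ~~ rd x -> l x < k -> dist n p (s x) + l x <= k ->
         dist n p (s x) + l x <= h \/ h <= dist n p (s x),
    h = 1 \/ exists c, [/\ ~~ rd c, dist n p (s c) = 0, l c = h & tight (s c) (l c)] &
    h.+1 = k \/ exists c, [/\ ~~ rd c, dist n p (s c) = h, h + l c = k & tight (s c) (l c)]].
Proof.
move=> hp hk tk; have [h [hh sub [_ A] [_ B]]] := tight_split hp hk tk.
exists h => //; split.
- move=> x rx lx dx; have : x \in prp t p k by rewrite inE lx.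
  move/(subsetP sub); rewrite !inE (negbTE rx) /=.
  have hn : h < n by lia.
  have := dist_tri hp (shift_lt hp (ltnW hn)) (ps_lt t x); rewrite dist_shift //.
  have := dist_lt hp (ps_lt t x); have := dist_lt (shift_lt hp (ltnW hn)) (ps_lt t x).
  by have := arcP rx; lia.
- case: A => [|[c [rc sc lc]]]; [by left|right; exists c].
  by split=> //; [rewrite sc /dist leqnn subnn|exact: arc_tight].
case: B => [|[c [rc sc lc]]]; [by left; lia|right; exists c].
split=> //; [by rewrite sc dist_shift //; lia|by lia|exact: arc_tight].
Qed.

(** Radii at different vertices are related in at least one direction: a map is missing only towards
    the radius one step clockwise. *)
Lemma twinsP i j : twins t i j <-> [/\ rd i, rd j, i <> j, ~ rl i j & ~ rl j i].
Proof.
split=> -[ri rj ne].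
  by move=> d; split=> // /(rl_rad_rad _ _); [move/(_ ri rj)|move/(_ rj ri)]; geo i j; alia.
move=> h1 h2; split=> //; apply/eqP; apply: contraT => d.
have {}h1 : ~ (0 < ds i j /\ ds i j + 2 <= n) by move=> h; apply: h1; apply/(rl_rad_rad ri rj).
have {}h2 : ~ (0 < ds j i /\ ds j i + 2 <= n) by move=> h; apply: h2; apply/(rl_rad_rad rj ri).
by geo i j; alia.
Qed.

(** A missing map from [j] to [i] means that [j] is one step after [i]; a longer gap is recognized
    by its closing arc. *)
Lemma nxtP i j : notwin t -> nxt t i j <->
  [/\ rd i, rd j, i <> j & ~ rl j i \/ exists x, [/\ ~~ rd x, rl j x & rl x i]].
Proof.
move=> nt; split.
  move=> nx; case: (nx) => ri rj ne jmin; split=> //.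
  case: (nxt_gap nt nx) => _ [d|[a [ra sa la]]].
    by left=> /(rl_rad_rad rj ri); geo i j; alia.
  right; exists a; have ba := arcP ra; have da := ds_rw i (esym sa); rewrite dsii in da.
  by split=> //; [apply/(rl_rad_arc rj ra)|apply/(rl_arc_rad ra ri)]; geo2 i j a; geo a i; alia.
case=> ri rj ne h; split=> // x rx xi.
have d0 : ds i x <> 0 by move=> e; apply: xi; rewrite (nt i x).
have dj0 : ds i j <> 0 by move=> e; apply: ne; rewrite (nt i j).
case: h => [h|[a [ra /(rl_rad_arc rj ra) h1 /(rl_arc_rad ra ri) h2]]].
  have {}h : ~ (0 < ds j i /\ ds j i + 2 <= n) by move=> ?; apply: h; apply/(rl_rad_rad rj ri).
  by geo i j; geo i x; alia.
by have := arc_rad rx ra; geo2 i j a; geo2 a i x; alia.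
Qed.

End Chains.

Lemma dist_parallel n a x a' x' : a < n -> x < n -> a' < n -> x' < n ->
  dist n a x = dist n a' x' -> x' = shiftn n x (dist n a a').
Proof.
move=> ha hx ha' hx' e; rewrite /shiftn; move: e; rewrite /dist.
by case: (leqP a x); case: (leqP a' x'); case: (leqP a a') => *; case: ltnP; lia.
Qed.

Lemma top_arc n (t : tri n) (i j a x : 'I_n) : rd t i -> rd t j -> ~~ rd t a -> ~~ rd t x ->
  ds t i a = 0 -> lv t a = ds t i j ->
  (lchain t (ps t a) (lv t a) x <-> rl t x i /\ x <> a) /\
  (rchain t (ps t a) (lv t a) x <-> rl t j x /\ x <> a).
Proof.
rewrite /lchain /rchain -!/(ds _ _ _) => ri rj ra rx da la.
have ba := arcP ra; have bx := arcP rx.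
have ne' : x <> a -> ds t a x = 0 -> lv t a <> lv t x.
  by move=> ne e1 e2; apply: ne; rewrite (arc_inj ra e1 e2).
have vj := rad_arc rj rx; have vi := rad_arc ri rx.
have g1 := dsa t i a; have g2 := dsa t i x; have g3 := dst t i a x; have g4 := dsa t i j.
have g5 := dst t i j x; have g6 := dsa t a x; have g7 := dsa t j x.
split; split.
- move=> [h1 h2]; split; last by move=> e; move: h1; rewrite e; alia.
  by apply/(rl_arc_rad rx ri); alia.
- by case=> /(rl_arc_rad rx ri) h1 /ne'; alia.
- move=> [h1 h2]; split; last by move=> e; move: h1; rewrite e; alia.
  by apply/(rl_rad_arc rj rx); alia.
by case=> /(rl_rad_arc rj rx) h1 /ne'; alia.
Qed.

(** * Comparison of two families with the same relation *)

Section Rigidity.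
Variables (n : nat) (t t' : tri n).
Hypothesis same : forall i j, rl t i j = rl t' i j.
Let n5 : 5 <= n := tri_n5 t.

Lemma rd_same i : rd t i = rd t' i.
Proof.
have e : rl t = rl t' by apply: funext => x; apply: funext => y.
by apply/idP/idP => /centralP h; apply/centralP; move: h; rewrite e.
Qed.

Definition matched p k p' k' := forall x, ~~ rd t x ->
  (lchain t p k x <-> lchain t' p' k' x) /\ (rchain t p k x <-> rchain t' p' k' x).

Definition matched_arc m := matched (ps t m) (lv t m) (ps t' m) (lv t' m).

Lemma matched_desc m c : ~~ rd t m -> ~~ rd t c -> matched_arc m ->
  lchain t (ps t m) (lv t m) c \/ rchain t (ps t m) (lv t m) c -> matched_arc c.
Proof.
move=> rm rc mm lr x rx.
have [rm' rc' rx'] : [/\ ~~ rd t' m, ~~ rd t' c & ~~ rd t' x] by rewrite -!rd_same.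
case: lr => h.
  have h' := (mm c rc).1.1 h.
  have [A A'] := (lchain_l rm rc rx h, lchain_l rm' rc' rx' h').
  have [B B'] := (rchain_l rm rc rx h, rchain_l rm' rc' rx' h').
  by rewrite A A' B B' !same.
have h' := (mm c rc).2.1 h.
have [A A'] := (rchain_r rm rc rx h, rchain_r rm' rc' rx' h').
have [B B'] := (lchain_r rm rc rx h, lchain_r rm' rc' rx' h').
by rewrite A A' B B' !same.
Qed.

(* The fans of arcs at the two ends of an interval determine, as relations, the
   triangle on that interval, and matching fans are inherited by its two other
   sides: the two triangulations of the interval agree by induction. *)
Lemma matched_tight k : forall p p' k', p < n -> p' < n -> 2 <= k <= n -> 2 <= k' <= n ->
  tight t p k -> tight t' p' k' -> matched p k p' k' ->
  (forall c, ~~ rd t c -> lchain t p k c \/ rchain t p k c -> matched_arc c) ->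
  k = k' /\ forall x, ~~ rd t x -> lv t x < k -> dist n p (ps t x) + lv t x <= k ->
    lv t' x = lv t x /\ dist n p' (ps t' x) = dist n p (ps t x).
Proof.
elim/ltn_ind: k => k IH p p' k' hp hp' hk hk' tk tk' mt mtc.
have [h hh [cov A B]] := kids hp hk tk.
have [h' hh' [cov' A' B']] := kids hp' hk' tk'.
have step c : ~~ rd t c -> lv t c < k -> lchain t p k c \/ rchain t p k c ->
   lv t c = lv t' c /\ forall x, ~~ rd t x -> lv t x < lv t c -> ds t c x + lv t x <= lv t c ->
    lv t' x = lv t x /\ ds t' c x = ds t c x.
  move=> rc lc lr; have mc := mtc c rc lr.
  have rc' : ~~ rd t' c by rewrite -rd_same.
  have bc := arcP rc; have bc' := arcP rc'.
  apply: (IH (lv t c)) => //; rewrite ?ps_lt //; try exact: arc_tight; try alia.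
  by move=> x rx; apply: matched_desc.
have lch x : ~~ rd t x -> lchain t p k x -> lv t x <= h.
  move=> rx [lx dx]; have := cov x rx lx; alia.
have lch' x : ~~ rd t' x -> lchain t' p' k' x -> lv t' x <= h'.
  move=> rx [lx dx]; have := cov' x rx lx; alia.
have rch x : ~~ rd t x -> rchain t p k x -> h + lv t x <= k.
  by move=> rx [lx dx]; have := cov x rx lx; have := arcP rx; alia.
have rch' x : ~~ rd t' x -> rchain t' p' k' x -> h' + lv t' x <= k'.
  by move=> rx [lx dx]; have := cov' x rx lx; have := arcP rx; alia.
have eh : h = h'.
  case: A => [h1|[c [rc dc lc tc]]]; case: A' => [h1'|[c' [rc' dc' lc' tc']]].
  - by rewrite h1 h1'.
  - have rc : ~~ rd t c' by rewrite rd_same.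
    have /(lch c' rc) : lchain t p k c' by apply/(mt c' rc).1; split; alia.
    by have := arcP rc; alia.
  - have rc' : ~~ rd t' c by rewrite -rd_same.
    have /(lch' c rc') : lchain t' p' k' c by apply/(mt c rc).1; split; alia.
    by have := arcP rc'; alia.
  have cl : lchain t p k c by split; alia.
  have cl' : lchain t' p' k' c' by split; alia.
  have rcb : ~~ rd t' c by rewrite -rd_same.
  have rcb' : ~~ rd t c' by rewrite rd_same.
  have [d1 d1'] := (mt c rc).1.1 cl; have [d2 d2'] := (mt c' rcb').1.2 cl'.
  have e : c' = c.
    apply/eqP; apply: contraT => /eqP ne.
    have lt := lch c' rcb' (conj d2 d2'); have lt' := lch' c rcb (conj d1 d1').
    have d0 : ds t c' c = 0.
      have := dist_tri hp (ps_lt t c') (ps_lt t c); rewrite -/(ds t c' c).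
      by have := ds_lt t c' c; alia.
    have : rl t c' c.
      apply/(rl_arcs rcb' rc); left; split=> //.
      suff : lv t c' <> lv t c by alia.
      by move=> e; apply: ne; exact: arc_inj e.
    rewrite same => /(rl_arcs rc' rcb).
    have := dist_tri hp' (ps_lt t' c') (ps_lt t' c); rewrite -/(ds t' c' c).
    by have := ds_lt t' c' c; alia.
  have [e2 _] := step c rc cl.1 (or_introl cl).
  by rewrite -lc -lc' e e2.
have ek : k - h = k' - h'.
  case: B => [h1|[c [rc dc lc tc]]]; case: B' => [h1'|[c' [rc' dc' lc' tc']]].
  - by alia.
  - have rc : ~~ rd t c' by rewrite rd_same.
    have /(rch c' rc) : rchain t p k c' by apply/(mt c' rc).2; split; alia.
    by have := arcP rc; alia.
  - have rc' : ~~ rd t' c by rewrite -rd_same.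
    have /(rch' c rc') : rchain t' p' k' c by apply/(mt c rc).2; split; alia.
    by have := arcP rc'; alia.
  have cl : rchain t p k c by split; alia.
  have cl' : rchain t' p' k' c' by split; alia.
  have rcb : ~~ rd t' c by rewrite -rd_same.
  have rcb' : ~~ rd t c' by rewrite rd_same.
  have [d1 d1'] := (mt c rc).2.1 cl; have [d2 d2'] := (mt c' rcb').2.2 cl'.
  have e : c' = c.
    apply/eqP; apply: contraT => /eqP ne.
    have lt := rch c' rcb' (conj d2 d2'); have lt' := rch' c rcb (conj d1 d1').
    have tr := dist_tri hp (ps_lt t c) (ps_lt t c'); rewrite -/(ds t c c') in tr.
    have tr' := dist_tri hp' (ps_lt t' c) (ps_lt t' c'); rewrite -/(ds t' c c') in tr'.
    have b1 := ds_lt t c c'; have b2 := ds_lt t' c c'.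
    have : rl t c c'.
      apply/(rl_arcs rc rcb'); right; left.
      suff : ds t c c' <> 0 by alia.
      by move=> d0; apply: ne; apply/esym/(arc_inj rc d0); alia.
    rewrite same => /(rl_arcs rcb rc'); have := arcP rc'; have := arcP rcb; alia.
  have [e2 _] := step c rc cl.1 (or_intror cl).
  by move: lc'; rewrite e -e2; alia.
split; first by alia.
move=> x rx lx dx; have bx := arcP rx.
case: (cov x rx lx dx) => v.
  case: A => [|[c [rc dc lc tc]]]; first by alia.
  have cl : lchain t p k c by split; alia.
  have [e2 IHc] := step c rc cl.1 (or_introl cl).
  have [_ dc'] := (mt c rc).1.1 cl.
  have tr := dist_tri hp (ps_lt t c) (ps_lt t x); rewrite -/(ds t c x) in tr.
  have tr' := dist_tri hp' (ps_lt t' c) (ps_lt t' x); rewrite -/(ds t' c x) in tr'.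
  have [e|/eqP ne] := eqVneq x c; first by rewrite e; alia.
  have ne' : ds t c x = 0 -> lv t x <> lv t c.
    by move=> e1 e3; apply: ne; apply/esym/(arc_inj rc e1).
  by have := IHc x rx; alia.
case: B => [|[c [rc dc lc tc]]]; first by alia.
have cl : rchain t p k c by split; alia.
have [e2 IHc] := step c rc cl.1 (or_intror cl).
have [_ dc'] := (mt c rc).2.1 cl.
have tr := dist_tri hp (ps_lt t c) (ps_lt t x); rewrite -/(ds t c x) in tr.
have tr' := dist_tri hp' (ps_lt t' c) (ps_lt t' x); rewrite -/(ds t' c x) in tr'.
have [e|/eqP ne] := eqVneq x c; first by rewrite e; alia.
have ne' : ds t c x = 0 -> lv t x <> lv t c.
  by move=> e1 e3; apply: ne; apply/esym/(arc_inj rc e1).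
by have := IHc x rx; have := ds_lt t' c x; alia.
Qed.

Lemma matched_arc_tight m : ~~ rd t m -> matched_arc m ->
  lv t' m = lv t m /\ forall x, ~~ rd t x -> lv t x <= lv t m -> ds t m x + lv t x <= lv t m ->
    lv t' x = lv t x /\ ds t' m x = ds t m x.
Proof.
move=> rm mm; have rm' : ~~ rd t' m by rewrite -rd_same.
have bm := arcP rm; have bm' := arcP rm'.
have [||||||e h] := @matched_tight (lv t m) (ps t m) (ps t' m) (lv t' m)
  (ps_lt _ _) (ps_lt _ _); try exact: arc_tight; try alia; try done.
  by move=> c rc; apply: matched_desc.
split=> // x rx; rewrite leq_eqVlt => /orP[/eqP lx|lx]; last exact: h.
move=> dx; have -> : x = m by apply/esym/(arc_inj rm); alia.
by rewrite !dsii -e.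
Qed.

Lemma twins_same i j : twins t i j -> twins t' i j.
Proof. by move/twinsP => h; apply/twinsP; rewrite -!rd_same -!same. Qed.

Lemma nxt_same i j : notwin t -> notwin t' -> nxt t i j -> nxt t' i j.
Proof.
move=> nt nt' /(nxtP _ _ nt) [ri rj ne h]; apply/(nxtP _ _ nt').
rewrite -!rd_same -!same; split=> //; case: h; [by left|move=> [x [rx h1 h2]]].
by right; exists x; rewrite -!rd_same -!same.
Qed.

(** The closing arc [a] is characterized by [rl a i] and [rl j a]. So either both gaps have length
    1, or both are closed by the same [a], whose fans match by [top_arc]. *)
Lemma nxt_arcs i j : notwin t -> notwin t' -> nxt t i j -> ds t' i j = ds t i j /\
  forall x, ~~ rd t x -> ds t i x + lv t x <= ds t i j ->
    lv t' x = lv t x /\ ds t' i x = ds t i x.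
Proof.
move=> nt nt' nx; have nx' := nxt_same nt nt' nx.
case: (nx) => ri rj ne _.
have ri' : rd t' i by rewrite -rd_same.
have rj' : rd t' j by rewrite -rd_same.
case: (nxt_gap nt nx) => _ [d1|[a [ra sa la]]].
  split; last by move=> x rx; have := arcP rx; alia.
  case: (nxt_gap nt' nx') => _ [d1'|[a [ra' sa la]]]; first by rewrite d1 d1'.
  have ra : ~~ rd t a by rewrite rd_same.
  have da : ds t' i a = 0 by rewrite (ds_rwr i sa) dsii.
  have ba := arcP ra.
  have h1 : rl t' a i by apply/(rl_arc_rad ra' ri'); have := dsa t' i a; alia.
  have h2 : rl t' j a.
    apply/(rl_rad_arc rj' ra'); have := dsa t' i a; have := dsa t' i j; have := dst t' i j a.
    by have := arcP ra'; have := dsa t' j a; alia.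
  move: h1 h2; rewrite -!same => /(rl_arc_rad ra ri) h1 /(rl_rad_arc rj ra) h2.
  by have := dsa t i a; have := dsa t i j; have := dst t i j a; have := dsa t j a; alia.
have da : ds t i a = 0 by rewrite (ds_rwr i sa) dsii.
have ra' : ~~ rd t' a by rewrite -rd_same.
have ba := arcP ra; have ba' := arcP ra'.
have [h1 h2] : rl t a i /\ rl t j a.
  split; first by apply/(rl_arc_rad ra ri); have := dsa t i a; alia.
  apply/(rl_rad_arc rj ra); have := dsa t i a; have := dsa t i j; have := dst t i j a.
  by have := dsa t j a; alia.
have da' : ds t' i a = 0.
  by move: h1; rewrite same => /(rl_arc_rad ra' ri'); have := dsa t' i a; alia.
have la' : lv t' a = ds t' i j.
  move: h2; rewrite same => /(rl_rad_arc rj' ra').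
  have := dsa t' i a; have := dsa t' i j; have := dst t' i j a.
  by have := nxt_pos nt' nx'; have := dsa t' j a; alia.
have ma : matched_arc a.
  move=> x rx; have rx' : ~~ rd t' x by rewrite -rd_same.
  have [-> ->] := top_arc ri rj ra rx da la.
  have [-> ->] := top_arc ri' rj' ra' rx' da' la'.
  by rewrite !same.
have [el hx] := matched_arc_tight ra ma.
split; first by rewrite -la -la'.
move=> x rx dx.
have dax y : ds t a y = ds t i y by apply: ds_rw.
have dax' y : ds t' a y = ds t' i y.
  by apply: ds_rw; apply/esym/ds_eq0.
by have := hx x rx; rewrite dax dax'; apply; alia.
Qed.

Lemma notwin_rads i h : notwin t -> notwin t' -> rd t i -> rd t h -> ds t' i h = ds t i h.
Proof.
move=> nt nt'; move e : (ds t i h) => d; elim/ltn_ind: d i e => d IH i e ri rh.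
have [eh|/eqP ne] := eqVneq h i; first by rewrite -e eh !dsii.
have [j nx] := nxt_ex nt ri; have [dj _] := nxt_arcs nt nt' nx.
have pj := nxt_pos nt nx; case: (nx) => _ rj _ /(_ h rh ne) le.
have e' : ds t j h = ds t i h - ds t i j by have := dst t i j h; have := dsa t i h; alia.
have := IH (ds t j h) _ j erefl rj rh; rewrite e' => /(_ ltac:(alia)).
have := dst t' i j h; have := dsa t' i h; have := dsa t i h; have := dsa t' j h; alia.
Qed.

Lemma notwin_all i : notwin t -> notwin t' -> rd t i -> forall x,
  lv t' x = lv t x /\ ds t' i x = ds t i x.
Proof.
move=> nt nt' ri x; have [rx|rx] := boolP (rd t x).
  have rx' : rd t' x by rewrite -rd_same.
  by rewrite (radP rx) (radP rx') notwin_rads.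
have [k [j [nx le]]] := nxt_around nt rx; case: (nx) => rk _ _ _.
have [_ /(_ x rx le)[lx dx]] := nxt_arcs nt nt' nx; split=> //.
have := notwin_rads nt nt' ri rk.
have := dst t i k x; have := dst t' i k x; have := dsa t i x; have := dsa t' i x; alia.
Qed.

(** Cut at the vertex of the twins, the polygon is a single triangulated interval of length [n], and
    [radius_chain] starts the comparison of fans. *)
Lemma twins_all i j : twins t i j -> forall x,
  lv t' x = lv t x /\ ds t' i x = ds t i x.
Proof.
move=> tw x; have tw' := twins_same tw.
case: (tw) => ri rj _ d; case: (tw') => ri' rj' _ d'.
have [rx|rx] := boolP (rd t x).
  have rx' : rd t' x by rewrite -rd_same.
  rewrite (radP rx) (radP rx'); split=> //.
  by case: (twins_only tw rx) => ->; rewrite ?dsii ?d ?d'.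
have chain (u : tri n) y : rd u i -> ~~ rd u y ->
  (lchain u (ps u i) n y <-> rl u y i) /\ (rchain u (ps u i) n y <-> rl u i y).
  rewrite /lchain /rchain -!/(ds _ _ _) => riu ry; have b := arcP ry.
  split; split.
  - by move=> h; apply/(rl_arc_rad ry riu); have := dsa u i y; alia.
  - by move/(rl_arc_rad ry riu); have := dsa u i y; alia.
  - by move=> h; apply/(rl_rad_arc riu ry); have := dsa u i y; alia.
  - by move/(rl_rad_arc riu ry); have := dsa u i y; alia.
have mt : matched (ps t i) n (ps t' i) n.
  move=> y ry; have ry' : ~~ rd t' y by rewrite -rd_same.
  by have [-> ->] := chain t y ri ry; have [-> ->] := chain t' y ri' ry'; rewrite !same.
have nn : 1 < n <= n by alia.
have [|_ h] := matched_tight (ps_lt _ _) (ps_lt _ _) nn nn (twins_tight tw) (twins_tight tw') mt.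
  move=> c rc lr y ry; have ry' : ~~ rd t' y by rewrite -rd_same.
  have rc' : ~~ rd t' c by rewrite -rd_same.
  have [A B] := radius_chain ri rc ry; have [A' B'] := radius_chain ri' rc' ry'.
  case: lr => h; have h' := h.
    move/(mt c rc).1: h' => h'.
    by have [-> ->] := A h.2; have [-> ->] := A' h'.2; rewrite !same.
  move/(mt c rc).2: h' => h'.
  by have [-> ->] := B h.2; have [-> ->] := B' h'.2; rewrite !same.
have bx := arcP rx; apply: h => //; first by alia.
by have := rad_arc ri rx; rewrite -/(ds t i x); alia.
Qed.

(** [y] differs from [x] only if twins have to be exchanged, their tags being invisible to [rl].
    Without twins all radii have the same tag in each family, and one bit [b] compares the two. *)
Theorem tri_rigid : exists e b, e <= n /\ forall x, exists y,
  [/\ lv t' y = lv t x, ps t' y = shiftn n (ps t x) e & rd t x -> tg t' y = b (+) tg t x].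
Proof.
have fin i : (forall x, lv t' x = lv t x /\ ds t' i x = ds t i x) ->
    forall x, lv t' x = lv t x /\ ps t' x = shiftn n (ps t x) (dist n (ps t i) (ps t' i)).
  move=> h x; have [lx dx] := h x; split=> //.
  by apply: dist_parallel; rewrite ?ps_lt //; apply: esym.
have le i : dist n (ps t i) (ps t' i) <= n by rewrite ltnW // dist_lt ?ps_lt.
case: (twinsVnot t) => [[i [j tw]]|nt].
  exists (dist n (ps t i) (ps t' i)), false; split=> // x.
  have h := fin i (twins_all tw).
  have [rx|rx] := boolP (rd t x); last by exists x; case: (h x).
  have [y [ry ey]] : exists y, [/\ rd t y & tg t' y = tg t x].
    have tw' := twins_same tw; case: (tw) => ri rj ne d; case: (tw') => ri' rj' _ d'.
    have : tg t' i <> tg t' j by move=> e; apply: ne; apply: rad_inj e.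
    case e1: (tg t' i == tg t x); first by exists i; split=> //; apply/eqP.
    case e2: (tg t' j == tg t x); first by exists j; split=> //; apply/eqP.
    by move: e1 e2; case: (tg t' i) (tg t' j) (tg t x) => [] [] [].
  have px : ps t x = ps t y.
    case: (tw) => ri rj ne /ds_eq0 e.
    by case: (twins_only tw rx) (twins_only tw ry) => -> [] ->.
  exists y; case: (h y) => ly py; split=> //; last by rewrite px.
  by rewrite ly (radP ry) (radP rx).
have nt' : notwin t'.
  case: (twinsVnot t') => // -[i [j /twinsP tw]].
  have /twinsP[ri rj ne d] : [/\ rd t i, rd t j, i <> j, ~ rl t i j & ~ rl t j i].
    by rewrite !rd_same !same.
  by case: ne; apply: nt.
have [i ri] := rad_ex t; have h := fin i (notwin_all nt nt' ri).
have ri' : rd t' i by rewrite -rd_same.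
exists (dist n (ps t i) (ps t' i)), (tg t i (+) tg t' i); split=> // x; exists x.
case: (h x) => lx px; split=> // rx; have rx' : rd t' x by rewrite -rd_same.
have [->|/eqP ne] := eqVneq x i; first by rewrite addbC addbA addbb.
have -> : tg t x = tg t i.
  by case: (rad_rad ri rx) => [e|[]//]; case: ne; rewrite (nt i x).
have -> : tg t' x = tg t' i.
  by case: (rad_rad ri' rx') => [e|[]//]; case: ne; rewrite (nt' i x).
by rewrite addbC addbA addbb.
Qed.

End Rigidity.

Import GRing.Theory.

(** * The mesh category of tagged edges *)

Section Coord.
Variable n : nat.
Implicit Types M N : tedge n.

Definition ep M : nat := match M with inl p => (val p).1 | inr p => p.1 end.
Definition el M : nat :=
  match M with inl p => dist n (val p).1 (val p).2 | inr _ => n end.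
(** Arcs receive the dummy tag [true]; tags of two edges are compared at level [n] only. *)
Definition et M : bool := match M with inl _ => true | inr p => p.2 end.

Lemma ep_lt M : ep M < n.
Proof. by case: M => [p|[a e]] /=. Qed.

Lemma bsizeE (a b : 'I_n) : bsize a b = (dist n a b).+1.
Proof.
rewrite /bsize /dist; congr S; have := ltn_ord a; have := ltn_ord b.
case: (leqP a b) => h hb ha.
  by rewrite addnBA 1?ltnW // -addnBAC // modnDr modn_small //; lia.
by rewrite modn_small; lia.
Qed.

Lemma el_arc p : el (inl p) < n /\ 2 <= el (inl p).
Proof.
split; first exact: dist_lt.
by have := valP p; rewrite bsizeE.
Qed.

Hypothesis n2 : 2 <= n.

Lemma el_bounds M : 2 <= el M <= n.
Proof.
by case: M => [p|p]; [have [h ->] := el_arc p; rewrite ltnW|rewrite /= n2 leqnn].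
Qed.

Lemma edge_inj M N : ep M = ep N -> el M = el N -> (el M = n -> et M = et N) -> M = N.
Proof.
have lt (p : {p : 'I_n * 'I_n | 3 <= bsize p.1 p.2}) : dist n (val p).1 (val p).2 < n.
  by have [] := el_arc p.
case: M N => [p|[a e]] [q|[b f]] /= h1 h2 h3.
- congr inl; apply: val_inj; case: p q h1 h2 {h3} => [[a b] /= hp] [[c d] /= hq] /= h1.
  have {}h1 : a = c by apply: val_inj.
  rewrite -h1 => h2; congr pair; apply: val_inj => /=.
  by apply: (dist_inj (n := n) (a := a)).
- by have := lt p; rewrite h2 ltnn.
- by have := lt q; rewrite -h2 ltnn.
by rewrite h3 //; congr (inr (_, _)); apply: val_inj.
Qed.

Lemma edge_ex p l e : p < n -> 2 <= l <= n ->
  exists M, [/\ ep M = p, el M = l & l = n -> et M = e].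
Proof.
move=> hp hl; have [->|ln] := eqVneq l n; first by exists (inr (Ordinal hp, e)).
have hl' : l < n by lia.
have hq : shiftn n p l < n by apply: shift_lt => //; lia.
have hb : 3 <= bsize (Ordinal hp) (Ordinal hq).
  by rewrite bsizeE /= dist_shift //; lia.
exists (inl (exist _ (Ordinal hp, Ordinal hq) hb)); split=> //=.
  exact: dist_shift.
by move=> e'; rewrite e' eqxx in ln.
Qed.

Lemma ordSE (a : 'I_n) : ordS a = shiftn n a 1 :> nat.
Proof.
rewrite /= /shiftn; have h2 := ltn_ord a; case: (ltnP (a + 1) n) => h1.
  by rewrite modn_small; lia.
have -> : a.+1 = n by lia.
by rewrite modnn; lia.
Qed.

Lemma eq_ordS (c a : 'I_n) : (c == ordS a) = ((c : nat) == shiftn n a 1).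
Proof. by rewrite -ordSE. Qed.
Lemma eq_ord (c a : 'I_n) : (c == a) = ((c : nat) == a).
Proof. by []. Qed.

Lemma ord_predE (a : 'I_n) : ord_pred a = shiftn n a (n - 1) :> nat.
Proof.
rewrite /= /shiftn; have h2 := ltn_ord a; case: (ltnP (a + (n - 1)) n) => h1.
  have -> : (a + n).-1 = n - 1 by lia.
  by rewrite modn_small; lia.
have -> : (a + n).-1 = (a + (n - 1) - n) + n by lia.
by rewrite modnDr modn_small //; lia.
Qed.

Lemma ep_tau M : ep (etau M) = shiftn n (ep M) (n - 1).
Proof. by case: M => [p|[a e]] /=; rewrite -ord_predE. Qed.
Lemma el_tau M : el (etau M) = el M.
Proof.
case: M => [p|[a e]] //; apply: succn_inj.
change ((dist n (ord_pred (val p).1) (ord_pred (val p).2)).+1 =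
  (dist n (val p).1 (val p).2).+1).
by rewrite -!bsizeE bsize_pred.
Qed.
Lemma et_tau M : el M = n -> et (etau M) = ~~ et M.
Proof. by case: M => [p|[a e]] //= h; have [] := el_arc p; rewrite /= h ltnn. Qed.

(** Counting radii as level [n] reduces all elementary moves to two: lengthening at the end ([up])
    and shortening at the start ([dn]). *)
Definition up M N := (ep N == ep M) && (el N == (el M).+1).
Definition dn M N := (ep N == shiftn n (ep M) 1) && (el M == (el N).+1).

Lemma arc_moveE a b c d : a < n -> b < n -> c < n -> d < n ->
  2 <= dist n a b -> 2 <= dist n c d ->
  ((c == a) && (d == shiftn n b 1)) && (3 <= (dist n a b).+1 <= n - 1) ||
  ((c == shiftn n a 1) && (d == b)) && (4 <= (dist n a b).+1 <= n) =
  ((c == a) && (dist n c d == (dist n a b).+1)) ||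
  ((c == shiftn n a 1) && (dist n a b == (dist n c d).+1)).
Proof.
move=> ha hb hc hd; rewrite /shiftn.
have [->|ca] := eqVneq c a.
  have -> : a == (if a + 1 < n then a + 1 else a + 1 - n) = false by case: ltnP; lia.
  rewrite /= !orbF /dist; case: (ltnP (b + 1) n); case: (leqP a b); case: (leqP a d); lia.
rewrite /=; have [e|//] := eqVneq c (if a + 1 < n then a + 1 else a + 1 - n).
move: e; rewrite /dist.
by case: (ltnP (a + 1) n) => h1 ->; [case: (leqP (a + 1) d)|case: (leqP (a + 1 - n) d)];
  case: (leqP a b); lia.
Qed.

Lemma moveE M N : move M N = up M N || dn M N.
Proof.
rewrite /up /dn; case: M N => [p|[a e]] [q|[b f]]; rewrite /move /ep /el /=.
- have [hp1 hp2] := el_arc p; case: p hp1 hp2 => [[a b] hp] /= hp1 hp2.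
  have [hq1 hq2] := el_arc q; case: q hq1 hq2 => [[c d] hq] /= hq1 hq2.
  rewrite !xpair_eqE !eq_ordS !eq_ord !bsizeE.
  exact: arc_moveE.
- have [hq1 hq2] := el_arc p; case: p hq1 hq2 => [[c d] hq] /= hq1 hq2.
  rewrite eq_ord bsizeE.
  have -> : dist n c d == n.+1 = false by lia.
  by rewrite andbF orbF; congr andb; lia.
- have [hq1 hq2] := el_arc q; case: q hq1 hq2 => [[c d] hq] /= hq1 hq2.
  rewrite xpair_eqE eq_ordS eq_ord.
  have -> : dist n c d == n.+1 = false by lia.
  rewrite andbF /=; have hc := ltn_ord c; have ha := ltn_ord a; have hd := ltn_ord d.
  have [e1|] := eqVneq (c : nat) (shiftn n a 1); last by [].
  move: hq1 hq2; rewrite e1 /shiftn /dist.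
  by case: (ltnP (a + 1) n) => h1; [case: (leqP (a + 1) d)|case: (leqP (a + 1 - n) d)]; lia.
by have := ltn_ord b; have := ltn_ord a; lia.
Qed.
End Coord.

Lemma if_reflectF (P : Prop) (b : bool) (r : reflect P b) (T : Type) (f : P -> T) (d : T) :
  ~~ b -> (if r is ReflectT p then f p else d) = d.
Proof. by case: r. Qed.

Lemma if_reflectT (P : Prop) (b : bool) (r : reflect P b) (T : Type) (f : P -> T) (d : T) :
  b -> exists p, (if r is ReflectT p then f p else d) = f p.
Proof. by case: r => // p _; exists p. Qed.

Lemma shiftK n a : 1 < n -> a < n -> shiftn n (shiftn n a 1) (n - 1) = a.
Proof.
rewrite /shiftn; case: (ltnP (a + 1) n) => h.
  by case: (ltnP (a + 1 + (n - 1)) n); lia.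
by case: (ltnP (a + 1 - n + (n - 1)) n); lia.
Qed.

Local Open Scope ring_scope.
Local Open Scope kcat_scope.

(** * Mesh relations according to level *)

Section Mesh.
Variables (n : nat) (k : fieldType).
Hypothesis n5 : (5 <= n)%N.
Let n2 : (2 <= n)%N := leq_trans (isT : (2 <= 5)%N) n5.

Definition mcat : kcat k := presented (@mesh_rel n k).

Arguments mcat : simpl never.

Definition edge (M : tedge n) : mcat := M.

Definition ar (M N : mcat) : hom M N := pcls (@mesh_rel n k) (@arrow n k M N).

Lemma pcls_sum (I : Type) (s : seq I) (M N : mcat)
    (f : I -> term k (fun M N : tedge n => is_true (move M N)) M N) :
  pcls (@mesh_rel n k) (TSum s f) = \sum_(i <- s) pcls (@mesh_rel n k) (f i).
Proof. by elim: s => [|i s IH]; rewrite ?big_nil ?big_cons //= pclsD IH. Qed.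

Lemma mesh_full (N : tedge n) :
  \sum_(X : tedge n) (ar X N \oc ar (etau N) X) = 0 :> hom (edge (etau N)) (edge N).
Proof.
transitivity (pcls (@mesh_rel n k) (TSum (enum (tedge n))
  (fun X => TComp (@arrow n k X N) (@arrow n k (etau N) X)))).
  rewrite pcls_sum big_enum /=; apply: eq_bigr => X _.
  exact: pcompE.
by rewrite -pcls0; apply/pclsP/teq_rel/MeshRel.
Qed.

Lemma ar0 (M N : tedge n) : ~~ move M N -> ar M N = 0.
Proof. by move=> h; rewrite /ar /arrow if_reflectF. Qed.

Lemma mesh_seq (N P : tedge n) (S : seq (tedge n)) : P = etau N -> uniq S ->
  (forall X, move P X -> move X N -> X \in S) ->
  \sum_(X <- S) (ar X N \oc ar P X) = 0 :> hom (edge P) (edge N).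
Proof.
move=> -> uS hS; rewrite -[RHS](mesh_full N) big_uniq // big_mkcond; apply: eq_bigr => X _.
case: ifP => // nX; apply: esym.
have [m|m] := boolP (move (etau N) X); last by rewrite (ar0 m) compc0.
have [m'|m'] := boolP (move X N); last by rewrite (ar0 m') comp0c.
by rewrite (hS X m m') in nX.
Qed.

Lemma tau_eq (P N : tedge n) : ep N = shiftn n (ep P) 1 -> el N = el P ->
  (el P = n -> et P = ~~ et N) -> P = etau N.
Proof.
move=> h1 h2 h3; apply: edge_inj => //.
- by rewrite (ep_tau n2) h1 shiftK // ep_lt.
- by rewrite el_tau.
by move=> e; rewrite (et_tau (n := n)) ?h2 // h3.
Qed.

Lemma move_move (P X N : tedge n) : ep N = shiftn n (ep P) 1 -> el N = el P ->
  move P X -> move X N ->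
  (ep X = ep P /\ el X = (el P).+1) \/ (ep X = ep N /\ (el X).+1 = el P).
Proof.
move=> h1 h2; rewrite !(moveE n2) /up /dn => /orP[]/andP[/eqP a1 /eqP a2] /orP[]/andP[/eqP b1 /eqP b2].
- by move: h2; rewrite b2 a2; lia.
- by left.
- by right; rewrite b1.
by lia.
Qed.

(** Since [tau] flips tags, the mesh from a radius ends at the next radius of opposite tag and has a
    single middle term. *)
Lemma mesh_rad (P Q N : tedge n) : el N = n -> el P = n -> et P <> et N ->
  dn P Q -> up Q N -> ar Q N \oc ar P Q = 0 :> hom (edge P) (edge N).
Proof.
move=> lN lP tg /andP[/eqP h1 /eqP h2] /andP[/eqP h3 /eqP h4].
have hN : ep N = shiftn n (ep P) 1 by rewrite h3.
have hP : P = etau N.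
  apply: tau_eq => //; [by rewrite lN|move=> _].
  by move: tg; case: (et P) (et N) => [] [].
rewrite -[RHS](@mesh_seq N P [:: Q] hP) ?big_seq1 // => X m m'.
have [] := move_move hN _ m m'; first by rewrite lN.
  by case=> _; have := el_bounds n2 X; lia.
case=> e1 e2; rewrite inE; apply/eqP/edge_inj; lia.
Qed.

Lemma mesh_arc (P Q D N : tedge n) : (el Q < n)%N -> up P Q -> dn Q N -> dn P D -> up D N ->
  ar Q N \oc ar P Q = - (ar D N \oc ar P D) :> hom (edge P) (edge N).
Proof.
move=> lQ /andP[/eqP h1 /eqP h2] /andP[/eqP h3 /eqP h4] /andP[/eqP h5 /eqP h6] /andP[/eqP h7 /eqP h8].
have hN : ep N = shiftn n (ep P) 1 by rewrite h3 h1.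
have lN : el N = el P by lia.
have hP : P = etau N by apply: tau_eq => //; lia.
have nQD : Q \notin [:: D] by rewrite inE; apply: contraTneq lQ => e; move: h2; rewrite e; lia.
apply/eqP; rewrite -addr_eq0; apply/eqP.
rewrite -[RHS](@mesh_seq N P [:: Q; D] hP); first by rewrite big_cons big_seq1.
  by rewrite /= nQD.
move=> X m m'; rewrite !inE; apply/orP.
case: (move_move hN lN m m') => -[e1 e2]; [left|right]; apply/eqP/edge_inj; lia.
Qed.

Lemma mesh_low (P Q N : tedge n) : (el Q < n)%N -> up P Q -> dn Q N -> el P = 2 ->
  ar Q N \oc ar P Q = 0 :> hom (edge P) (edge N).
Proof.
move=> lQ /andP[/eqP h1 /eqP h2] /andP[/eqP h3 /eqP h4] l2.
have hN : ep N = shiftn n (ep P) 1 by rewrite h3 h1.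
have lN : el N = el P by lia.
have hP : P = etau N by apply: tau_eq => //; lia.
rewrite -[RHS](@mesh_seq N P [:: Q] hP) ?big_seq1 // => X m m'; rewrite inE.
case: (move_move hN lN m m') => -[e1 e2].
  by apply/eqP/edge_inj; lia.
by have := el_bounds n2 X; lia.
Qed.

Lemma mesh_top (P R1 R2 D N : tedge n) : el R1 = n -> el R2 = n -> et R1 <> et R2 ->
  up P R1 -> up P R2 -> dn R1 N -> dn R2 N -> dn P D -> up D N ->
  ar R1 N \oc ar P R1 = - (ar R2 N \oc ar P R2) - (ar D N \oc ar P D)
    :> hom (edge P) (edge N).
Proof.
move=> l1 l2 tg /andP[/eqP h1 /eqP h2] /andP[/eqP h1' /eqP h2'] /andP[/eqP h3 /eqP h4]
  /andP[/eqP h3' /eqP h4'] /andP[/eqP h5 /eqP h6] /andP[/eqP h7 /eqP h8].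
have hN : ep N = shiftn n (ep P) 1 by rewrite h3 h1.
have lN : el N = el P by lia.
have hP : P = etau N by apply: tau_eq => //; lia.
have uS : uniq [:: R1; R2; D].
  rewrite /= !inE andbT negb_or; apply/andP; split; [apply/andP; split|].
  - by apply/eqP => e; apply: tg; rewrite e.
  - by apply/eqP => e; move: l1; rewrite e; lia.
  - by apply/eqP => e; move: l2; rewrite e; lia.
apply/eqP; rewrite -opprD -addr_eq0; apply/eqP.
rewrite -[RHS](@mesh_seq N P [:: R1; R2; D] hP uS).
  by rewrite !big_cons big_nil addr0.
move=> X m m'; rewrite !inE.
case: (move_move hN lN m m') => -[e1 e2]; last first.
  suff -> : X = D by rewrite eqxx !orbT.
  by apply: edge_inj; lia.
have [e3|e3] := eqVneq (et X) (et R1).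
  suff -> : X = R1 by rewrite eqxx.
  by apply: edge_inj; [lia|lia|move=> _].
suff -> : X = R2 by rewrite eqxx !orbT.
apply: edge_inj; [lia|lia|move=> _].
by move: e3 tg; case: (et X) (et R1) (et R2) => [] [] [].
Qed.

End Mesh.

Notation mhom k := (@hom k (mcat _ k)).
Notation mcls := (pcls (@mesh_rel _ _)).

Lemma compNl (k : fieldType) (C : kcat k) (X Y Z : C) (g : hom Y Z) (f : hom X Y) :
  (- g) \oc f = - (g \oc f).
Proof. by rewrite -scaleN1r compZl scaleN1r. Qed.

Lemma shift1_mod n b : (0 < n)%N -> shiftn n (b %% n)%N 1 = (b.+1 %% n)%N.
Proof.
move=> n0; have -> : (b.+1 %% n = (b %% n + 1) %% n)%N by rewrite modnDml addn1.
have := ltn_pmod b n0; move: (b %% n)%N => r hr; rewrite /shiftn.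
case: (ltnP (r + 1)%N n) => h; first by rewrite modn_small.
have -> : (r + 1 = n)%N by lia.
by rewrite modnn subnn.
Qed.

(** * Morphisms reflected at the puncture *)

Section Span.
Variables (n : nat) (k : fieldType).
Hypothesis n5 : (5 <= n)%N.
Let n2 : (2 <= n)%N := leq_trans (isT : (2 <= 5)%N) n5.
Implicit Types (M N P Q R D : tedge n).

Local Notation H M N := (mhom k M N).
Local Notation ar := (@ar n k).

Lemma sq_ud P Q D N : up P Q -> dn Q N -> dn P D -> up D N.
Proof.
clear n2 n5; rewrite /up /dn => /andP[/eqP h1 /eqP h2] /andP[/eqP h3 /eqP h4] /andP[/eqP h5 /eqP h6].
by rewrite h3 h1 h5 eqxx; apply/eqP; lia.
Qed.
Lemma sq_du P Q D N : dn P D -> up D N -> up P Q -> dn Q N.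
Proof.
clear n2 n5; rewrite /up /dn => /andP[/eqP h1 /eqP h2] /andP[/eqP h3 /eqP h4] /andP[/eqP h5 /eqP h6].
by rewrite h3 h1 h5 eqxx; apply/eqP; lia.
Qed.
Lemma up_el P Q : up P Q -> el Q = (el P).+1. Proof. by case/andP => _ /eqP. Qed.
Lemma dn_el P Q : dn P Q -> el P = (el Q).+1. Proof. by case/andP => _ /eqP. Qed.

Lemma dn_ex P : (3 <= el P)%N -> exists D, dn P D.
Proof.
move=> h; have hb := el_bounds n2 P.
have [D [h1 h2 _]] := @edge_ex n n2 (shiftn n (ep P) 1) (el P).-1 true
  ltac:(apply: shift_lt; [exact: ep_lt|lia]) ltac:(lia).
by exists D; rewrite /dn h1 h2 eqxx; apply/eqP; lia.
Qed.
Lemma up_ex P e : (el P < n)%N -> exists Q, up P Q /\ ((el P).+1 = n -> et Q = e).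
Proof.
move=> h; have hb := el_bounds n2 P.
have [D [h1 h2 h3]] := @edge_ex n n2 (ep P) (el P).+1 e (ep_lt P) ltac:(lia).
by exists D; rewrite /up h1 h2 !eqxx.
Qed.

Lemma mesh_radf M P Q N (f : H M P) : el N = n -> el P = n -> et P <> et N ->
  dn P Q -> up Q N -> ar Q N \oc (ar P Q \oc f) = 0.
Proof. by move=> *; rewrite compA mesh_rad // comp0c. Qed.

Lemma mesh_arcf M P Q D N (f : H M P) : (el Q < n)%N -> up P Q -> dn Q N -> dn P D -> up D N ->
  ar Q N \oc (ar P Q \oc f) = - (ar D N \oc (ar P D \oc f)).
Proof. by move=> h1 h2 h3 h4 h5; rewrite !compA (mesh_arc k n5 h1 h2 h3 h4 h5) compNl. Qed.

Lemma mesh_lowf M P Q N (f : H M P) : (el Q < n)%N -> up P Q -> dn Q N -> el P = 2 ->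
  ar Q N \oc (ar P Q \oc f) = 0.
Proof. by move=> *; rewrite compA mesh_low // comp0c. Qed.

Lemma mesh_topf M P R1 R2 D N (f : H M P) : el R1 = n -> el R2 = n -> et R1 <> et R2 ->
  up P R1 -> up P R2 -> dn R1 N -> dn R2 N -> dn P D -> up D N ->
  ar R1 N \oc (ar P R1 \oc f) =
  - (ar R2 N \oc (ar P R2 \oc f)) - (ar D N \oc (ar P D \oc f)).
Proof.
move=> h1 h2 h3 h4 h5 h6 h7 h8 h9.
by rewrite !compA (mesh_top k n5 h1 h2 h3 h4 h5 h6 h7 h8 h9) compDl !compNl.
Qed.

(** Mesh rewriting introduces signs and may yield 0, so normal forms are reached only up to a
    scalar. *)
Definition mult M N (P : H M N -> Prop) (g : H M N) : Prop :=
  exists c f, (c = 0 \/ P f) /\ g = c *: f.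

Lemma mult0 M N (P : H M N -> Prop) g : g = 0 -> mult P g.
Proof. by move->; exists 0, 0; rewrite scale0r; split; [left|]. Qed.
Lemma mult1 M N (P : H M N -> Prop) g : P g -> mult P g.
Proof. by exists 1, g; rewrite scale1r; split; [right|]. Qed.
Lemma multZ M N (P : H M N -> Prop) g c : mult P g -> mult P (c *: g).
Proof.
case=> c' [f [h ->]]; exists (c * c'), f; rewrite scalerA; split=> //.
by case: h => [->|h]; [left; rewrite mulr0|right].
Qed.
Lemma multN M N (P : H M N -> Prop) g : mult P g -> mult P (- g).
Proof. by rewrite -scaleN1r; apply: multZ. Qed.
Lemma mult_comp M N N' (P : H M N -> Prop) (P' : H M N' -> Prop) (h : H N N') g :
  (forall f, P f -> P' (h \oc f)) -> mult P g -> mult P' (h \oc g).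
Proof.
move=> hP [c [f [hf ->]]]; exists c, (h \oc f); rewrite compZr; split=> //.
by case: hf => [|/hP]; [left|right].
Qed.

(* [Er X] are the images of the start [M] at the puncture, with tag [e], after
   [X] steps; [Ee X x] are the morphisms leaving [Er X] downwards, to the vertex
   [x] steps after [M]. By the mesh relations the latter are also reached from
   [Er X.-1], which forces them to vanish once [x] reaches [n.-1]. *)
Section Reflected.
Variables (M : tedge n) (e : bool).
Variable Er : nat -> forall N, H M N -> Prop.
Hypothesis Er_rad : forall X N f, @Er X N f -> el N = n /\ et N = e.
Hypothesis Er_next : forall X N f Q N', @Er X N f -> dn N Q -> up Q N' -> et N' = e ->
  mult (@Er X.+1 N') (ar Q N' \oc (ar N Q \oc f)).
Hypothesis Er_prev : forall X N g, @Er X.+1 N g -> g = 0 \/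
  exists c Q R f, [/\ @Er X R f, dn R Q, up Q N & g = c *: (ar Q N \oc (ar R Q \oc f))].

Inductive Ee : nat -> nat -> forall N, H M N -> Prop :=
| Ee0 X N N' f : @Er X N f -> dn N N' -> @Ee X X.+1 N' (ar N N' \oc f)
| EeS X x N N' f : @Ee X x N f -> dn N N' -> @Ee X x.+1 N' (ar N N' \oc f).

Lemma Ee_lv X x N f : @Ee X x N f -> (el N + x = X + n)%N /\ (X < x)%N.
Proof.
elim=> {X x N f} [X N N' f /Er_rad[h _]|X x N N' f _ [h1 h2]] /dn_el h3; lia.
Qed.

Lemma Ee_inv X x N f : @Ee X x N f ->
  (x = X.+1 /\ exists R g, [/\ @Er X R g, dn R N & f = ar R N \oc g]) \/
  (exists x' R g, [/\ x = x'.+1, @Ee X x' R g, dn R N & f = ar R N \oc g]).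
Proof.
case=> {X x N f} [X N N' f h1 h2|X x N N' f h1 h2]; first by left; split=> //; exists N, f.
by right; exists x, N, f.
Qed.

Lemma Er_tag X N f Q N' : @Er X N f -> dn N Q -> up Q N' -> et N' <> e ->
  ar Q N' \oc (ar N Q \oc f) = 0.
Proof.
move=> /Er_rad[h1 h2] h3 h4 h5; apply: mesh_radf => //.
  by rewrite (up_el h4) -(dn_el h3).
by rewrite h2; apply: nesym.
Qed.

(** An upward step is moved back through the descent by the mesh relations. At level [n] the branch
    of tag other than [e] vanishes by [Er_tag], and the branch of tag [e] leads to [Er X.+1]. *)
Lemma Ee_up X x N f N' : @Ee X x N f -> up N N' -> (el N' < n)%N ->
  mult (@Ee X.+1 x N') (ar N N' \oc f).
Proof.
move=> h; elim: h N' => {X x N f} [X N N' f h1 h2|X x N0 N f h IH h2] N1 u l1.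
  by have [h3 _] := Er_rad h1; move: l1; rewrite (up_el u) -(dn_el h2) h3 ltnn.
have bN0 := el_bounds n2 N0.
have l0 : el N0 = el N1 by rewrite (up_el u) -(dn_el h2).
have [Q [uQ tQ]] := @up_ex N0 e ltac:(lia).
have dQ := sq_du h2 u uQ.
have [lQ|lQ] := ltnP (el Q) n.
  rewrite -[_ \oc _]opprK -(mesh_arcf f lQ uQ dQ h2 u); apply: multN.
  apply: (mult_comp (P := @Ee X.+1 x Q)); last exact: IH.
  by move=> f' hf'; apply: EeS.
have ln : (el N0).+1 = n by move: lQ; rewrite (up_el uQ); lia.
have {lQ} lQ : el Q = n by rewrite (up_el uQ).
have {}tQ := tQ ln.
have [R [uR tR]] := @up_ex N0 (~~ e) ltac:(lia).
have {}tR := tR ln; have dR := sq_du h2 u uR; have lR : el R = n by rewrite (up_el uR).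
have te : et Q <> et R by rewrite tQ tR; case: (e).
have E : ar N N1 \oc (ar N0 N \oc f) =
   - (ar Q N1 \oc (ar N0 Q \oc f)) - (ar R N1 \oc (ar N0 R \oc f)).
  by rewrite (mesh_topf f lQ lR te uQ uR dQ dR h2 u) opprD !opprK addrAC subrr add0r.
have [lv1 lv2] := Ee_lv h.
case: (Ee_inv h) => [[xX [P [g [hg dP ef]]]]|[x' [P [g [xX hg dP _]]]]]; last first.
  by have [lv3 lv4] := Ee_lv hg; have := dn_el dP; lia.
rewrite E ef (Er_tag hg dP uR) ?tR; last by case: (e).
rewrite compc0 subr0; apply: multN; apply: (mult_comp (P := @Er X.+1 Q)).
  by move=> f' hf'; rewrite xX; apply: Ee0.
exact: Er_next hg dP uQ tQ.
Qed.

(** Reverse of [Ee_up]: it lowers [X] while keeping [x], as needed in [Ee_vanish]. *)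
Lemma Ee_prev X x N f : @Ee X.+1 x N f -> f = 0 \/
  exists c P g, [/\ @Ee X x P g, up P N & f = c *: (ar P N \oc g)].
Proof.
move E : X.+1 => X1 h; elim: h X E => {X1 x N f} [X1 R N g hg dN|X1 x N0 N f h IH dN] X E; subst.
  case: (Er_prev hg) => [->|[c [Q [R' [g0 [hg0 dQ uQ eg]]]]]]; first by left; rewrite compc0.
  have [lR tR] := Er_rad hg; have lQ := up_el uQ; have bQ := el_bounds n2 Q.
  have [R2 [uR2 tR2]] := @up_ex Q (~~ e) ltac:(lia).
  have {}tR2 := tR2 ltac:(lia).
  have [D dD] := @dn_ex Q ltac:(lia).
  have lR2 : el R2 = n by rewrite (up_el uR2) -lQ.
  have uD := sq_ud uQ dN dD; have dR2 := sq_du dD uD uR2.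
  have te : et R <> et R2 by rewrite tR tR2; case: (e).
  right; exists (- c), D, (ar Q D \oc (ar R' Q \oc g0)); split=> //.
    by apply: EeS => //; apply: Ee0.
  rewrite eg compZr (mesh_topf _ lR lR2 te uQ uR2 dN dR2 dD uD).
  rewrite (Er_tag hg0 dQ uR2) ?tR2; last by case: (e).
  by rewrite compc0 oppr0 sub0r scalerN scaleNr.
case: (IH X erefl) => [->|[c [P [g [hg uP ef]]]]]; first by left; rewrite compc0.
have lN0 := up_el uP; have bP := el_bounds n2 P; have [lv _] := Ee_lv h.
have l0 : (el N0 < n)%N by have := Ee_lv h; lia.
have [l2|l3] := leqP (el P) 2.
  by left; rewrite ef compZr (mesh_lowf _ l0 uP dN) ?scaler0 //; lia.
have [D dD] := dn_ex l3; have uD := sq_ud uP dN dD.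
right; exists (- c), D, (ar P D \oc g); split=> //; first exact: EeS.
by rewrite ef compZr (mesh_arcf _ l0 uP dN dD uD) scalerN scaleNr.
Qed.

(** After lowering [X] to 0, the equation [el N + x = n] and [el N >= 2] leave no room for
    [x >= n - 1]. *)
Lemma Ee_vanish X x N f : @Ee X x N f -> (n <= x.+1)%N -> f = 0.
Proof.
elim: X x N f => [|X IH] x N f h hx.
  by have := Ee_lv h; have := el_bounds n2 N; lia.
case: (Ee_prev h) => // -[c [P [g [hg uP ->]]]].
by rewrite (IH _ _ _ hg hx) compc0 scaler0.
Qed.

Lemma Er_vanish X N f : @Er X.+1 N f -> (n <= X.+2)%N -> f = 0.
Proof.
case/Er_prev => // -[c [Q [R [g [hg dQ uQ ->]]]]] hX.
by rewrite (@Ee_vanish X X.+1 Q (ar R Q \oc g)) ?compc0 ?scaler0 //; apply: Ee0.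
Qed.

Lemma Ee_ep X x N f : (forall X N f, @Er X N f -> ep N = (ep M + X) %% n)%N ->
  @Ee X x N f -> ep N = ((ep M + x) %% n)%N.
Proof.
move=> hr; elim=> {X x N f} [X N N' f /hr h|X x N N' f _ h] /andP[/eqP -> _];
  by rewrite h shift1_mod ?addnS //; lia.
Qed.

End Reflected.

End Span.

(** * Spanning sets for the morphisms out of an edge *)

Section Start.
Variables (n : nat) (k : fieldType).
Hypothesis n5 : (5 <= n)%N.
Let n2 : (2 <= n)%N := leq_trans (isT : (2 <= 5)%N) n5.
Implicit Types (N P Q R D : tedge n).
Variable M : tedge n.

Local Notation H M N := (mhom k M N).
Local Notation ar := (@ar n k).
Local Notation m := (el M).

Inductive span (Pr : forall N, H M N -> Prop) : forall N, H M N -> Prop :=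
| span0 N : span Pr (0 : H M N)
| spanD N (f g : H M N) : span Pr f -> span Pr g -> span Pr (f + g)
| spanZ N c (f : H M N) : span Pr f -> span Pr (c *: f)
| span1 N (f : H M N) : Pr N f -> span Pr f.

Lemma mult_span (Pr : forall N, H M N -> Prop) N (Q : H M N -> Prop) g :
  (forall f, Q f -> Pr N f) -> mult Q g -> span Pr g.
Proof.
move=> h [c [f [[->|hf] ->]]]; first by rewrite scale0r; apply: span0.
by apply/spanZ/span1/h.
Qed.

Lemma span_all (Pr : forall N, H M N -> Prop) :
  (forall N f N', Pr N f -> move N N' -> span Pr (ar N N' \oc f)) ->
  Pr M (idc (M : mcat n k)) -> forall N (f : H M N), span Pr f.
Proof.
move=> step base.
(* For the induction on terms, the claim is generalized to post-composition of any element of the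
   span. *)
suff all X Y (s' : term k (fun M N : tedge n => is_true (move M N)) X Y) (g : H M X) :
    span Pr g -> span Pr ((mcls s' : mhom k X Y) \oc g).
  move=> N; elim/phom_ind => s; have := all M N s _ (span1 base).
  by rewrite compc1.
move: g; induction s' as [X Y mv|X|X Y Z s1 IH1 s2 IH2|X Y|X Y s1 IH1 s2 IH2|X Y c s1 IH] => g hg.
- have -> : mcls (TGen k mv) = ar X Y.
    rewrite /ar /arrow; have [p ->] := @if_reflectT _ _ (@idP (move X Y)) _
      (fun mv => @TGen k _ (fun M N : tedge n => is_true (move M N)) X Y mv) (TZero k _ X Y) mv.
    by congr (pcls _ (TGen k _)); apply: bool_irrelevance.
  elim: hg mv => {X g} [X|X f1 f2 _ IH1 _ IH2|X c f1 _ IH|X f1 hf1] mv.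
  + by rewrite compc0; apply: span0.
  + by rewrite compDr; apply: spanD; [apply: IH1|apply: IH2].
  + by rewrite compZr; apply/spanZ/IH.
  + exact: step.
- by have -> : mcls (TId k _ X) = idc (X : mcat n k) by []; rewrite comp1c.
- have -> : mcls (TComp s1 s2) =
     (mcls s1 : mhom k Y Z) \oc
     (mcls s2 : mhom k X Y).
    exact: esym (pcompE _ _ _).
  by rewrite -compA; apply: IH1; apply: IH2.
- by rewrite pcls0 comp0c; apply: span0.
- by rewrite pclsD compDl; apply: spanD; [apply: IH1|apply: IH2].
- by rewrite pclsZ compZl; apply/spanZ/IH.
Qed.

Section Arc.
Hypothesis mn : (m < n)%N.
Let m2 : (2 <= m)%N. Proof. by have := el_bounds n2 M; lia. Qed.

(* [Cr x y f]: [f] goes from [M] to the arc from [ep M + x] to [ep M + y]. *)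
Inductive Cr : nat -> nat -> forall N, H M N -> Prop :=
| Cr0 : Cr 0 m (idc (M : mcat n k))
| Crd x N N' (f : H M N) : Cr x m f -> dn N N' -> Cr x.+1 m (ar N N' \oc f)
| Cru x y N N' (f : H M N) : Cr x y f -> up N N' -> Cr x y.+1 (ar N N' \oc f).

Lemma Cr_lv x y N (f : H M N) : Cr x y f -> (el N + x = y)%N /\ (x + 2 <= m <= y)%N.
Proof.
elim=> {x y N f} [|x N N' f _ [h1 h2] /dn_el h|x y N N' f _ [h1 h2] /up_el h].
- by lia.
- by have := el_bounds n2 N'; lia.
by lia.
Qed.

Lemma Cr_ep x y N (f : H M N) : Cr x y f -> ep N = ((ep M + x) %% n)%N.
Proof.
elim=> {x y N f} [|x N N' f _ h /andP[/eqP -> _]|x y N N' f _ h /andP[/eqP -> _] //].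
  by rewrite addn0 modn_small ?ep_lt.
by rewrite h shift1_mod ?addnS //; lia.
Qed.

Lemma Cr_inv x y N (f : H M N) : Cr x y f -> (m < y)%N ->
  exists y' N0 g, [/\ y = y'.+1, Cr x y' g, up N0 N & f = ar N0 N \oc g].
Proof.
case=> {x y N f} [|x N N' f h1 h2|x y N N' f h1 h2]; rewrite ?ltnn // => _.
by exists y, N, f.
Qed.

(** Anticommuting squares move the down step in front of the up steps, until it joins the initial
    descent or meets a mesh at level 2 and gives 0. *)
Lemma Cr_dn x y N N' (f : H M N) : Cr x y f -> dn N N' -> (el N < n)%N ->
  mult (@Cr x.+1 y N') (ar N N' \oc f).
Proof.
move=> h; elim: h N' => {x y N f} [|x N0 N f h1 _ h2|x y N0 N f h IH u] N' d lN.
- by apply/mult1/Crd => //; apply: Cr0.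
- by apply/mult1/Crd => //; apply: Crd.
have bN0 := el_bounds n2 N0; have lu := up_el u.
have [l2|l3] := leqP (el N0) 2.
  by apply: mult0; apply: mesh_lowf => //; lia.
have [D dD] := dn_ex n5 l3; have uD := sq_ud u d dD.
rewrite (mesh_arcf n5 f lN u d dD uD); apply: multN.
apply: (mult_comp (P := @Cr x.+1 y D)); last by apply: IH => //; lia.
by move=> f' hf'; apply: Cru.
Qed.

Lemma Cr_prev x y N (h : H M N) : Cr x.+1 y h -> (el N + 2 <= n)%N -> h = 0 \/
  exists c P g, [/\ Cr x y g, dn P N & h = c *: (ar P N \oc g)].
Proof.
move E : x.+1 => x1 hC; elim: hC x E => {x1 y N h} [|x1 N0 N f h1 _ d|x1 y N0 N f h IH u] x E lN //.
  by right; exists 1, N0, f; rewrite scale1r; case: E => ->.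
subst; have lu := up_el u.
case: (IH x erefl ltac:(lia)) => [->|[c [P [g [hg d ef]]]]]; first by left; rewrite compc0.
have lP := dn_el d.
have [P2 [uP _]] := @up_ex n n5 P true ltac:(lia).
have dP := sq_du d u uP.
right; exists (- c), P2, (ar P P2 \oc g); split=> //; first exact: Cru.
rewrite ef compZr scaleNr -scalerN; congr (_ *: _).
by rewrite (mesh_arcf n5 g _ uP dP d u) ?opprK // (up_el uP); lia.
Qed.

(** The tag [true] is a choice: by the mesh with two radii, descending from the other radius is a
    combination of descending from this one and of a [Cr]. *)
Definition Er X N (f : H M N) := [/\ Cr X (X + n) f, el N = n & et N = true].

Lemma Er_radA X N f : @Er X N f -> el N = n /\ et N = true. Proof. by case. Qed.

Lemma Er_nextA X N f Q N' : @Er X N f -> dn N Q -> up Q N' -> et N' = true ->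
  mult (@Er X.+1 N') (ar Q N' \oc (ar N Q \oc f)).
Proof.
case=> hC lN tN dQ uQ tN'.
have [y [N0 [g [ey hg uN ef]]]] := Cr_inv hC ltac:(lia).
have l0 := up_el uN; have lQ := dn_el dQ; have lN' : el N' = n by rewrite (up_el uQ); lia.
have [D dD] := @dn_ex n n5 N0 ltac:(lia).
have uD := sq_ud uN dQ dD.
have [R [uR tR]] := @up_ex n n5 N0 false ltac:(lia).
have {}tR := tR ltac:(lia); have lR : el R = n by rewrite (up_el uR); lia.
have dR := sq_du dD uD uR.
have te : et N <> et R by rewrite tN tR.
rewrite ef (mesh_topf n5 g lN lR te uN uR dQ dR dD uD) compDr -scaleN1r compZr.
rewrite (mesh_radf n5 _ lN' lR _ dR uQ) ?tR ?tN' // scaler0 add0r.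
rewrite -scaleN1r compZr scaleN1r; apply: multN.
have hd := Cr_dn hg dD ltac:(lia).
rewrite /mult; case: hd => c [f' [hf' ->]].
exists c, (ar Q N' \oc (ar D Q \oc f')); rewrite !compZr; split=> //.
case: hf' => [|hf']; [by left|right]; split=> //.
have -> : (X.+1 + n = y.+2)%N by lia.
by apply: Cru => //; apply: Cru.
Qed.

Lemma Er_prevA X N g : @Er X.+1 N g -> g = 0 \/
  exists c Q R f, [/\ @Er X R f, dn R Q, up Q N & g = c *: (ar Q N \oc (ar R Q \oc f))].
Proof.
case=> hC lN tN.
have [y [N0 [g1 [ey hg1 uN ->]]]] := Cr_inv hC ltac:(lia).
have l0 := up_el uN.
have [y1 [Q [h [ey1 hh uQ ->]]]] := Cr_inv hg1 ltac:(lia).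
have lQ := up_el uQ.
case: (Cr_prev hh ltac:(lia)) => [->|[c [P [h' [hh' dP eh]]]]]; first by left; rewrite !compc0.
have lP := dn_el dP.
have [R1 [uR1 tR1]] := @up_ex n n5 P true ltac:(lia).
have [R2 [uR2 tR2]] := @up_ex n n5 P false ltac:(lia).
have {}tR1 := tR1 ltac:(lia). have {}tR2 := tR2 ltac:(lia).
have lR1 : el R1 = n by rewrite (up_el uR1); lia.
have lR2 : el R2 = n by rewrite (up_el uR2); lia.
have dR1 := sq_du dP uQ uR1; have dR2 := sq_du dP uQ uR2.
have te : et R1 <> et R2 by rewrite tR1 tR2.
right; exists (- c), N0, R1, (ar P R1 \oc h'); split=> //.
  split=> //; have -> : (X + n = y1.+1)%N by lia.
  exact: Cru.
rewrite eh compZr compZr scaleNr -scalerN; congr (_ *: _).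
rewrite (mesh_topf n5 h' lR1 lR2 te uR1 uR2 dR1 dR2 dP uQ).
rewrite -opprD -[in RHS]scaleN1r compZr scaleN1r opprK compDr.
by rewrite (mesh_radf n5 _ lN lR2 _ dR2 uN) ?tR2 ?tN // add0r.
Qed.

Definition CE N (f : H M N) := (exists x y, Cr x y f) \/ (exists X x, Ee Er X x f).

Lemma CE_span N (f : H M N) : span CE f.
Proof.
apply: span_all; last by left; exists 0%N, m; apply: Cr0.
move=> {N f} N f N' hf; rewrite (moveE n2) => /orP[u|d].
  case: hf => [[x [y h]]|[X [x h]]].
    by apply: span1; left; exists x, y.+1; apply: Cru.
  have [lt|ge] := ltnP (el N') n.
    apply: mult_span (Ee_up n5 Er_radA Er_nextA h u lt) => f' hf'.
    by right; exists X.+1, x.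
  have [lv1 lv2] := Ee_lv n5 Er_radA h; have lu := up_el u.
  have bN' := el_bounds n2 N'.
  case: (Ee_inv h) => [[xX [R [g [hg d ->]]]]|[x' [R [g [xX hg d _]]]]]; last first.
    by have [lv3 lv4] := Ee_lv n5 Er_radA hg; have := dn_el d; lia.
  case tN' : (et N').
    apply: mult_span (Er_nextA hg d u tN') => f' [hf' _ _].
    by left; exists X.+1, (X.+1 + n)%N.
  rewrite (Er_tag n5 Er_radA hg d u) ?tN' //; exact: span0.
have dl := dn_el d.
case: hf => [[x [y h]]|[X [x h]]]; last first.
  by apply: span1; right; exists X, x.+1; apply: EeS.
have [lt|ge] := ltnP (el N) n.
  by apply: mult_span (Cr_dn h d lt) => f' hf'; left; exists x.+1, y.
have bN := el_bounds n2 N; have lN : el N = n by lia.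
have [lv1 lv2] := Cr_lv h.
case tN : (et N).
  apply: span1; right; exists x, x.+1; apply: Ee0 => //; split=> //.
  by have -> : (x + n = y)%N by lia.
have [y' [N0 [g [ey hg u ->]]]] := Cr_inv h ltac:(lia).
have l0 := up_el u.
have [D dD] := @dn_ex n n5 N0 ltac:(lia); have uD := sq_ud u d dD.
have [R [uR tR]] := @up_ex n n5 N0 true ltac:(lia).
have {}tR := tR ltac:(lia); have lR : el R = n by rewrite (up_el uR); lia.
have dR := sq_du dD uD uR.
have te : et N <> et R by rewrite tN tR.
rewrite (mesh_topf n5 g lN lR te u uR d dR dD uD) -opprD -scaleN1r.
apply: spanZ; apply: spanD.
  apply: span1; right; exists x, x.+1; apply: Ee0 => //; split=> //.
  have -> : (x + n = y'.+1)%N by lia. exact: Cru.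
have [c [f' [hf' ->]]] := Cr_dn hg dD ltac:(lia).
rewrite compZr; case: hf' => [->|hf']; first by rewrite scale0r; apply: span0.
by apply/spanZ/span1; left; exists x.+1, y'.+1; apply: Cru.
Qed.

End Arc.

Section Rad.
Hypothesis mn : m = n.

Inductive Rr : nat -> forall N, H M N -> Prop :=
| Rr0 : Rr 0 (idc (M : mcat n k))
| RrS X N Q N' (f : H M N) : Rr X f -> dn N Q -> up Q N' -> et N' = et M ->
    Rr X.+1 (ar Q N' \oc (ar N Q \oc f)).

Lemma Rr_rad X N (f : H M N) : Rr X f -> el N = n /\ et N = et M.
Proof.
case=> {X N f} [//|X N Q N' f h d u e]; split=> //.
have [lN _] : el N = n /\ et N = et M.
  by elim: h {d} => {X N f} [//|X N Q' N'' f _ [l _] /dn_el h1 /up_el h2 ->]; split=> //; lia.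
by rewrite (up_el u) -(dn_el d).
Qed.

Lemma Rr_ep X N (f : H M N) : Rr X f -> ep N = ((ep M + X) %% n)%N.
Proof.
elim=> {X N f} [|X N Q N' f _ h /andP[/eqP d _] /andP[/eqP -> _] _].
  by rewrite addn0 modn_small ?ep_lt.
by rewrite d h shift1_mod ?addnS //; lia.
Qed.

Lemma Rr_next X N f Q N' : @Rr X N f -> dn N Q -> up Q N' -> et N' = et M ->
  mult (@Rr X.+1 N') (ar Q N' \oc (ar N Q \oc f)).
Proof. by move=> *; apply/mult1/RrS. Qed.

Lemma Rr_prev X N g : @Rr X.+1 N g -> g = 0 \/
  exists c Q R f, [/\ @Rr X R f, dn R Q, up Q N & g = c *: (ar Q N \oc (ar R Q \oc f))].
Proof.
move E : X.+1 => X1 h; case: h E => {X1 N g} [//|X1 N Q N' f h d u e] [->].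
by right; exists 1, Q, N, f; rewrite scale1r.
Qed.

Definition RE N (f : H M N) := (exists X, Rr X f) \/ (exists X x, Ee Rr X x f).

Lemma RE_span N (f : H M N) : span RE f.
Proof.
apply: span_all; last by left; exists 0%N; apply: Rr0.
move=> {N f} N f N' hf; rewrite (moveE n2) => /orP[u|d]; last first.
  case: hf => [[X h]|[X [x h]]]; apply: span1; right.
    by exists X, X.+1; apply: Ee0.
  by exists X, x.+1; apply: EeS.
have lu := up_el u; have bN' := el_bounds n2 N'.
case: hf => [[X h]|[X [x h]]]; first by have [lN _] := Rr_rad h; lia.
have [lt|ge] := ltnP (el N') n.
  apply: mult_span (Ee_up n5 Rr_rad Rr_next h u lt) => f' hf'.
  by right; exists X.+1, x.
have [lv1 lv2] := Ee_lv n5 Rr_rad h.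
case: (Ee_inv h) => [[xX [R [g [hg d ->]]]]|[x' [R [g [xX hg d _]]]]]; last first.
  by have [lv3 lv4] := Ee_lv n5 Rr_rad hg; have := dn_el d; lia.
have [tN'|tN'] := eqVneq (et N') (et M).
  by apply: span1; left; exists X.+1; apply: RrS.
rewrite (Er_tag n5 Rr_rad hg d u) ?tN' //; [exact: span0|exact/eqP].
Qed.

End Rad.

Definition ehits (M N : tedge n) :=
  hits n (el M) (et M) (dist n (ep M) (ep N)) (el N) (et N).

Lemma dist_mod x : (x < n)%N -> dist n (ep M) ((ep M + x) %% n) = x.
Proof.
move=> hx; have hM := ep_lt M; have [h|h] := ltnP (ep M + x)%N n.
  by rewrite modn_small // /dist leq_addr; lia.
have -> : ((ep M + x) %% n = ep M + x - n)%N.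
  by rewrite -[in LHS](subnK h) modnDr modn_small //; lia.
by rewrite /dist leqNgt (_ : (ep M + x - n < ep M)%N) /=; lia.
Qed.

(** The condition is void unless [M = N], so it can accompany the support condition through
    inductions over all targets. *)
Definition scalar_at N (g : H M N) : Prop :=
  exists c, forall E : M = N, g = c *: ecast X (H M X) E (idc (M : mcat n k)).

Lemma scalar_ne N (g : H M N) : M <> N -> scalar_at g.
Proof. by move=> h; exists 0 => E; case: h. Qed.

Lemma scalar_id : scalar_at (idc (M : mcat n k)).
Proof. by exists 1 => E; rewrite eq_axiomK scale1r. Qed.

Lemma span_hits (Pr : forall N, H M N -> Prop) :
  (forall N f, Pr N f -> [/\ f <> 0 -> ehits M N & scalar_at f]) ->
  forall N f, span Pr f -> (f <> 0 -> ehits M N) /\ @scalar_at N f.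
Proof.
move=> h N f; elim=> {N f} [N|N f g _ [f1 [c1 f2]] _ [g1 [c2 g2]]|N c f _ [f1 [c1 f2]]|N f /h[]//].
- by split=> //; exists 0 => E; rewrite scale0r.
- split.
    by move=> ne; have [f0|/eqP] := eqVneq f 0; [apply: g1 => g0; rewrite f0 g0 addr0 in ne|].
  by exists (c1 + c2) => E; rewrite [in LHS](f2 E) (g2 E) scalerDl.
split; first by move=> ne; apply: f1 => f0; rewrite f0 scaler0 in ne.
by exists (c * c1) => E; rewrite [in LHS](f2 E) scalerA.
Qed.

Lemma Ee_hits (Er' : nat -> forall N, H M N -> Prop) (e : bool) :
  (forall X N f, @Er' X N f -> el N = n /\ et N = e) ->
  (forall X N f Q N', @Er' X N f -> dn N Q -> up Q N' -> et N' = e ->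
    mult (@Er' X.+1 N') (ar Q N' \oc (ar N Q \oc f))) ->
  (forall X N g, @Er' X.+1 N g -> g = 0 \/
  exists c Q R f, [/\ @Er' X R f, dn R Q, up Q N & g = c *: (ar Q N \oc (ar R Q \oc f))]) ->
  (forall X N f, @Er' X N f -> ep N = (ep M + X) %% n)%N ->
  (forall X N f, @Er' X N f -> (X + 2 <= m)%N \/ f = 0) ->
  forall X x N f, @Ee n k M Er' X x N f -> [/\ f <> 0 -> ehits M N & scalar_at f].
Proof.
move=> h1 h1' h2 h3 h4 X x N f hE.
have [l1 l2] := Ee_lv n5 h1 hE; have eN := Ee_ep n5 h3 hE.
have b := el_bounds n2 N; have bM := el_bounds n2 M.
have [hx|hx] := leqP n x.+1.
  rewrite (Ee_vanish n5 h1 h1' h2 hE hx); split=> //.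
  by exists 0 => E; rewrite scale0r.
have d : dist n (ep M) (ep N) = x by rewrite eN dist_mod; lia.
have hX : (X + 2 <= m)%N \/ f = 0.
  elim: hE {hx d l1 l2 eN b} => {X x N f} [X N N' f /h4[?|->] _|X x N N' f _ [?|->] _].
  - by left.
  - by right; rewrite compc0.
  - by left.
  by right; rewrite compc0.
split.
  case: hX => // hX _; rewrite /ehits /hits /trap d; lia.
apply: scalar_ne => E; move: d; rewrite -E /dist leqnn subnn; lia.
Qed.

(** Both properties are linear and are checked on the spanning set, where every nonzero generator
    other than the identity ends at an edge different from [M]. *)
Lemma mesh_hom N (f : H M N) : (f <> 0 -> ehits M N) /\ scalar_at f.
Proof.
have bM := el_bounds n2 M.
have [mn|mn] := ltnP m n.
  apply: span_hits (CE_span mn f) => {N f} N f [[x [y h]]|[X [x h]]]; last first.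
    apply: (Ee_hits (@Er_radA) (Er_nextA mn) (Er_prevA mn) _ _ h) => {X x N f h} X N f [h _ _].
      exact: (Cr_ep mn h).
    by left; have [_] := Cr_lv mn h; lia.
  have [l1 l2] := Cr_lv mn h; have b := el_bounds n2 N.
  have d : dist n (ep M) (ep N) = x by rewrite (Cr_ep mn h) dist_mod; lia.
  split; first by move=> _; rewrite /ehits /hits /trap d; lia.
  case: h l1 l2 b d => {x y N f} [|x N N' f h u|x y N N' f h u] l1 l2 b d.
  - exact: scalar_id.
  - by apply: scalar_ne => E; move: d; rewrite -E /dist leqnn subnn; lia.
  apply: scalar_ne => E; have [_ l4] := Cr_lv mn h.
  by move: d; rewrite -E in l1 *; rewrite /dist leqnn subnn; lia.
have {}mn : m = n by lia.
apply: span_hits (RE_span mn f) => {N f} N f [[X h]|[X [x h]]]; last first.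
  apply: (Ee_hits (Rr_rad mn) (@Rr_next) (@Rr_prev) (Rr_ep mn) _ h) => {X x N f h} X N f h.
  rewrite mn; case: X h => [|X] h; first by left; lia.
  have [lt|ge] := leqP (X.+1 + 2) n; [by left|right].
  by apply: (Er_vanish n5 (Rr_rad mn) (@Rr_next) (@Rr_prev) h); lia.
have [lN tN] := Rr_rad mn h.
have [X0|X0] := posnP X.
  case: h lN tN X0 => {X N f} [|X N Q N' f _ _ _ _] _ _ // _.
  split; last exact: scalar_id.
  by rewrite /ehits /hits /trap /dist leqnn subnn; move: (et M) => ? _; rewrite eqxx; lia.
case: X X0 h => // X _ h.
have [lt|ge] := leqP (X.+1 + 2) n; last first.
  rewrite (Er_vanish n5 (Rr_rad mn) (@Rr_next) (@Rr_prev) h); last by lia.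
  by split=> //; exists 0 => E; rewrite scale0r.
have d : dist n (ep M) (ep N) = X.+1 by rewrite (Rr_ep mn h) dist_mod; lia.
split; first by move=> _; rewrite /ehits /hits /trap d tN eqxx; lia.
by apply: scalar_ne => E; move: d; rewrite -E /dist leqnn subnn; lia.
Qed.

End Start.

Lemma mesh_hom0 n k (n5 : (5 <= n)%N) (M N : tedge n) (f : mhom k M N) :
  ~~ ehits M N -> f = 0.
Proof.
move=> h; apply/eqP; apply: contraNT h => /eqP; by case: (mesh_hom n5 f).
Qed.

Lemma mesh_end n k (n5 : (5 <= n)%N) (M : tedge n) (f : mhom k M M) :
  exists c, f = c *: idc (M : mcat n k).
Proof. by case: (mesh_hom n5 f) => _ [c /(_ erefl) ->]; exists c. Qed.

(** * Nonzero morphisms *)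

Section Thin.
Variables (n : nat) (k : fieldType).
Variables (supp : pred (tedge n)) (w : tedge n -> tedge n -> k).

Definition wt M N : k := if supp M && supp N then w M N else 0.
Definition wa M N : k := if move M N then wt M N else 0.

(* A representation of the mesh category of dimension one at the edges in [supp]
   and zero elsewhere, given by the scalars of the elementary moves: a nonzero
   value of [ev] certifies a nonzero morphism. *)
Fixpoint ev M N (s : term k (fun M N : tedge n => is_true (move M N)) M N) : k :=
  match s with
  | TGen M N _ => wt M N
  | TId M => (supp M)%:R
  | TComp _ _ _ s t => ev s * ev t
  | TZero _ _ => 0
  | TAdd _ _ s t => ev s + ev t
  | TScale _ _ a s => a * ev s
  end.

Lemma ev_supp M N s : ~~ (supp M && supp N) -> @ev M N s = 0.
Proof.
elim: s => {M N} //=.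
- by move=> M N _ h; rewrite /wt ifN.
- by move=> M; case: (supp M).
- move=> X Y Z s IHs t IHt; rewrite negb_and => /orP[] h.
    by rewrite IHt ?mulr0 // negb_and h.
  by rewrite IHs ?mul0r // negb_and h orbT.
- by move=> X Y s IHs t IHt h; rewrite IHs // IHt // addr0.
by move=> X Y a s IHs h; rewrite IHs // mulr0.
Qed.

Lemma ev_arrow M N : ev (@arrow n k M N) = wa M N.
Proof.
rewrite /wa; have [h|h] := boolP (move M N).
  have [p] := @if_reflectT _ _ (@idP (move M N)) _
    (fun p => TGen k (p : (fun M N : tedge n => is_true (move M N)) M N)) (TZero k _ M N) h.
  by rewrite /arrow => ->.
by rewrite /arrow if_reflectF.
Qed.

Hypothesis mesh0 : forall N, \sum_X wa X N * wa (etau N) X = 0.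

Lemma ev_teq M N s t : teq (@mesh_rel n k) s t -> @ev M N s = ev t.
Proof.
elim=> {M N s t} //=.
- move=> M N s t []{M N s t} N; rewrite /= -(mesh0 N) -big_enum /=.
  by elim: (enum _) => [|X s IH]; rewrite ?big_nil ?big_cons //= !ev_arrow IH.
- by move=> X Y s t u _ -> _ ->.
- by move=> X Y Z s s' t t' _ -> _ ->.
- by move=> X Y s s' t t' _ -> _ ->.
- by move=> X Y a t t' _ ->.
- by move=> *; rewrite addrA.
- by move=> *; rewrite addrC.
- by move=> *; rewrite add0r.
- by move=> *; rewrite mulN1r addNr.
- by move=> *; rewrite mulrA.
- by move=> *; rewrite mul1r.
- by move=> *; rewrite mulrDr.
- by move=> *; rewrite mulrDl.
- by move=> *; rewrite mulrA.
- move=> X Y t; have [|h] := boolP (supp Y); first by rewrite mul1r.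
  by rewrite mul0r ev_supp // negb_and h orbT.
- move=> X Y t; have [|h] := boolP (supp X); first by rewrite mulr1.
  by rewrite mulr0 ev_supp // negb_and h.
- by move=> *; rewrite mulrDl.
- by move=> *; rewrite mulrA.
- by move=> *; rewrite mulrDr.
by move=> *; rewrite mulrCA.
Qed.

Definition pev (M N : mcat n k) (f : hom M N) : k := @ev M N (repr (f : phom (@mesh_rel n k) M N)).

Lemma pev_cls M N s : @pev M N (mcls s) = ev s.
Proof. exact/ev_teq/repr_pcls. Qed.

Lemma pev_comp (M N P : mcat n k) (g : hom N P) (f : hom M N) :
  pev (g \oc f) = pev g * pev f.
Proof.
move: g f; apply: phom_ind => s; apply: phom_ind => t.
rewrite (_ : comp _ _ = mcls (TComp s t) :> mhom k M P).
  by rewrite !pev_cls.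
exact: pcompE.
Qed.

Lemma pev_ar (M N : mcat n k) : pev (ar M N) = wa M N.
Proof. by rewrite /ar pev_cls ev_arrow. Qed.

Lemma pev_id (M : mcat n k) : pev (idc M) = (supp M)%:R.
Proof. exact: pev_cls. Qed.

Lemma pev0 (M N : mcat n k) : pev (0 : hom M N) = 0.
Proof. by rewrite -pcls0 pev_cls. Qed.

Lemma pev_lin (M N : mcat n k) a (f g : hom M N) : pev (a *: f + g) = a * pev f + pev g.
Proof.
move: f g; apply: phom_ind => s; apply: phom_ind => t.
by rewrite -pclsZ -pclsD !pev_cls.
Qed.

Lemma pev_supp (M N : mcat n k) (f : hom M N) : ~~ (supp M && supp N) -> pev f = 0.
Proof. exact: ev_supp. Qed.

End Thin.

Section Augmentation.
Variables (n : nat) (k : fieldType).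

(* The scalar by which an endomorphism of [M] acts modulo the radical. *)
Definition aug (M : tedge n) := @pev n k (pred1 M) (fun _ _ => 0) M M.

Lemma aug_mesh (M N : tedge n) :
  \sum_X wa (k := k) (pred1 M) (fun _ _ => 0) X N * wa (pred1 M) (fun _ _ => 0) (etau N) X = 0.
Proof. by rewrite big1 // => X _; rewrite /wa /wt !if_same mul0r. Qed.

Lemma aug1 M : aug (idc (M : mcat n k)) = 1.
Proof. by rewrite /aug (pev_id (aug_mesh M)) /= eqxx. Qed.

Lemma aug_lin M a f g : aug (M := M) (a *: f + g) = a * aug f + aug g.
Proof. exact: (pev_lin (aug_mesh M)). Qed.

Lemma aug_through (M N : tedge n) (g : hom (N : mcat n k) M) (f : hom (M : mcat n k) N) :
  M <> N -> aug (g \oc f) = 0.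
Proof.
move=> /eqP h; rewrite /aug (pev_comp (aug_mesh M)) (pev_supp _ f) ?mulr0 //=.
by rewrite eqxx eq_sym.
Qed.

End Augmentation.

(** * The shapes of meshes *)

Section MeshSum.
Variables (n : nat) (k : fieldType).
Hypothesis n5 : (5 <= n)%N.
Let n2 : (2 <= n)%N := leq_trans (isT : (2 <= 5)%N) n5.

(** The shapes are: a radius, level [n - 1] with two radii in the middle, level 2 with one middle
    term, and ordinary squares. [F] is arbitrary so that all thin representations share this case
    analysis. *)
Lemma mesh_sum (F : tedge n -> k) (N : tedge n) :
  let P := etau N in
  (forall X, ~~ (move P X && move X N) -> F X = 0) ->
  [\/ [/\ el P = n & exists Q, [/\ dn P Q, up Q N & \sum_X F X = F Q]],
      [/\ (el P).+1 = n & exists R1 R2 D, [/\ et R1, ~~ et R2, [/\ up P R1, up P R2, dn R1 N & dn R2 N],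
          dn P D /\ up D N & \sum_X F X = F R1 + F R2 + F D]],
      [/\ el P = 2%N & exists Q, [/\ up P Q, dn Q N & \sum_X F X = F Q]] |
      [/\ ((el P).+1 < n)%N, (2 < el P)%N & exists Q D, [/\ up P Q, dn Q N, dn P D, up D N &
         \sum_X F X = F Q + F D]]].
Proof.
move=> P hF.
have hN : ep N = shiftn n (ep P) 1.
  rewrite (ep_tau n2) /shiftn; have := ep_lt N => h.
  by case: (ltnP (ep N + (n - 1)) n) => h1;
    [case: (ltnP (ep N + (n - 1) + 1) n)|case: (ltnP (ep N + (n - 1) - n + 1) n)]; lia.
have lN : el N = el P by rewrite el_tau.
have bP := el_bounds n2 P.
have sumE (S : seq (tedge n)) : uniq S ->
    (forall X, move P X -> move X N -> X \in S) -> \sum_X F X = \sum_(X <- S) F X.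
  move=> uS hS; rewrite [RHS]big_uniq // [RHS]big_mkcond; apply: eq_bigr => X _.
  case: ifP => // nX; apply: hF; apply/negP => /andP[h1 h2].
  by rewrite hS in nX.
have updn Q : up P Q -> dn Q N.
  by move=> /andP[/eqP h1 /eqP h2]; rewrite /dn h1 h2 hN lN !eqxx.
have dnup Q : dn P Q -> up Q N.
  by move=> /andP[/eqP h1 /eqP h2]; rewrite /up h1 -hN lN h2 !eqxx.
have [lt|ge] := ltnP (el P) n; last first.
  have lP : el P = n by lia.
  constructor 1; split=> //; have [Q hQ] := @dn_ex n n5 P ltac:(lia).
  exists Q; split; [by []|exact: dnup|].
  rewrite (sumE [:: Q]) ?big_seq1 // => X m m'; rewrite inE.
  case: (move_move n5 hN lN m m') => -[e1 e2].
    by have := el_bounds n2 X; lia.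
  move: hQ => /andP[/eqP q1 /eqP q2]; apply/eqP/edge_inj; lia.
have [lt1|ge1] := ltnP (el P).+1 n; last first.
  have lP : (el P).+1 = n by lia.
  constructor 2; split=> //; have [D hD] := @dn_ex n n5 P ltac:(lia).
  have [R1 [h1 /(_ lP) t1]] := @up_ex n n5 P true lt.
  have [R2 [h2 /(_ lP) t2]] := @up_ex n n5 P false lt.
  exists R1, R2, D; split; [by rewrite t1|by rewrite t2|by split; auto|by split; auto|].
  have l1 := up_el h1; have l2 := up_el h2; have lD := dn_el hD.
  rewrite (sumE [:: R1; R2; D]) ?big_cons ?big_nil ?addr0 ?addrA //.
    rewrite /= !inE andbT negb_or; apply/andP; split; [apply/andP; split|].
    - by apply/eqP => e; move: t1; rewrite e t2.
    - by apply/eqP => e; move: l1; rewrite e; lia.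
    - by apply/eqP => e; move: l2; rewrite e; lia.
  move=> X m m'; rewrite !inE.
  case: (move_move n5 hN lN m m') => -[e1 e2]; last first.
    suff -> : X = D by rewrite eqxx !orbT.
    move: hD => /andP[/eqP q1 /eqP q2]; apply: edge_inj; lia.
  move: h1 h2 => /andP[/eqP q1 /eqP q2] /andP[/eqP q3 /eqP q4].
  case tX : (et X).
    suff -> : X = R1 by rewrite eqxx.
    by apply: edge_inj; [lia|lia|move=> _; rewrite tX].
  suff -> : X = R2 by rewrite eqxx !orbT.
  by apply: edge_inj; [lia|lia|move=> _; rewrite tX].
have [Q [hQ _]] := @up_ex n n5 P true lt.
have [lt2|ge2] := ltnP 2 (el P); last first.
  constructor 3; split; first lia.
  exists Q; split; [by []|exact: updn|].
  rewrite (sumE [:: Q]) ?big_seq1 // => X m m'; rewrite inE.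
  case: (move_move n5 hN lN m m') => -[e1 e2]; last by have := el_bounds n2 X; lia.
  move: hQ => /andP[/eqP q1 /eqP q2]; apply/eqP/edge_inj; lia.
constructor 4; split=> //; have [D hD] := @dn_ex n n5 P lt2.
exists Q, D; split; [by []|exact: updn|by []|exact: dnup|].
have lQ := up_el hQ; have lD := dn_el hD.
rewrite (sumE [:: Q; D]) ?big_cons ?big_nil ?addr0 ?addrA //.
  by rewrite /= !inE andbT; apply/eqP => e; move: lQ; rewrite e; lia.
move=> X m m'; rewrite !inE; apply/orP.
move: hQ hD => /andP[/eqP q1 /eqP q2] /andP[/eqP q3 /eqP q4].
case: (move_move n5 hN lN m m') => -[e1 e2]; [left|right]; apply/eqP/edge_inj; lia.
Qed.

End MeshSum.

Lemma dist_next n a p : (a < n)%N -> (p < n)%N -> (dist n a p).+1 != n ->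
  dist n a (shiftn n p 1) = (dist n a p).+1.
Proof.
rewrite /dist /shiftn; case: (ltnP (p + 1) n) => h; case: (leqP a p) => h1 /=.
- by rewrite leq_eqVlt; case: (leqP a (p + 1)); lia.
- by case: (leqP a (p + 1)); lia.
- by case: (leqP a (p + 1 - n)); lia.
by lia.
Qed.

Lemma dist_wrap n a p : (a < n)%N -> (p < n)%N -> (dist n a p).+1 = n ->
  dist n a (shiftn n p 1) = 0%N.
Proof.
rewrite /dist /shiftn; case: (ltnP (p + 1) n) => h; case: (leqP a p) => h1 /=.
- by case: (leqP a (p + 1)); lia.
- by case: (leqP a (p + 1)); lia.
- by case: (leqP a (p + 1 - n)); lia.
by lia.
Qed.

Ltac edge_lia := repeat match goal with
  | H : is_true (up _ _) |- _ => clear H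
  | H : is_true (dn _ _) |- _ => clear H
  | H : is_true (et _) |- _ => clear H
  | H : is_true (~~ et _) |- _ => clear H
  | H : is_true (_ ?P) |- _ => match type of P with Finite.sort (tedge _) => clear H end
  end; lia.

(** * Thin representations detecting nonzero morphisms *)

Section Nonzero.
Variables (n : nat) (k : fieldType).
Hypothesis n5 : (5 <= n)%N.
Let n2 : (2 <= n)%N := leq_trans (isT : (2 <= 5)%N) n5.
Variable M : tedge n.
Local Notation m := (el M).
Local Notation x N := (dist n (ep M) (@ep n N)).

Lemma x_up (P Q : tedge n) : up P Q -> x Q = x P.
Proof. by move=> /andP[/eqP -> _]. Qed.

Lemma x_dn (P Q : tedge n) : dn P Q -> x Q = if (x P).+1 == n then 0%N else (x P).+1.
Proof.
move=> /andP[/eqP -> _]; case: eqP => h; first by rewrite dist_wrap ?ep_lt.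
by rewrite dist_next ?ep_lt //; apply/eqP.
Qed.

Lemma thin_mesh (supp : pred (tedge n)) (w : tedge n -> tedge n -> k) :
  (forall P Q N, el P = n -> dn P Q -> up Q N -> et P != et N -> ~~ (supp P && supp N)) ->
  (forall P R1 R2 D N, (el P).+1 = n -> et R1 -> ~~ et R2 -> up P R1 -> up P R2 ->
     dn R1 N -> dn R2 N -> dn P D -> up D N -> supp P -> supp N ->
     wt supp w R1 N * wt supp w P R1 + wt supp w R2 N * wt supp w P R2
     + wt supp w D N * wt supp w P D = 0) ->
  (forall P Q N, el P = 2%N -> up P Q -> dn Q N -> ~~ (supp P && supp N)) ->
  (forall P Q D N, ((el P).+1 < n)%N -> up P Q -> dn Q N -> dn P D -> up D N ->
     supp P -> supp N ->
     wt supp w Q N * wt supp w P Q + wt supp w D N * wt supp w P D = 0) ->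
  forall N, \sum_X wa supp w X N * wa supp w (etau N) X = 0.
Proof.
move=> h1 h2 h3 h4 N.
have [/andP[sP sN]|h] := boolP (supp (etau N) && supp N); last first.
  rewrite big1 // => X _; rewrite /wa /wt; move: h; rewrite negb_and => /orP[]/negPf ->.
    by rewrite andFb if_same mulr0.
  by rewrite andbF if_same mul0r.
pose F X := wa supp w X N * wa supp w (etau N) X.
have hF X : ~~ (move (etau N) X && move X N) -> F X = 0.
  by rewrite negb_and /F /wa => /orP[]/negPf->; rewrite ?mulr0 ?mul0r.
have mu X Y : up X Y -> wa supp w X Y = wt supp w X Y.
  by move=> h; rewrite /wa moveE // h.
have md X Y : dn X Y -> wa supp w X Y = wt supp w X Y.
  by move=> h; rewrite /wa moveE // h orbT.
change (\sum_X F X = 0); case: (mesh_sum n5 hF) =>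
  [[e [Q [q1 q2 _]]]|[e [R1 [R2 [D [t1 t2 [u1 u2 d1 d2] [d3 u3]]]]]]
  |[e [Q [q1 q2 _]]]|[e _ [Q [D [u1 d1 d2 u2]]]]].
- have t : et (etau N) != et N by rewrite et_tau -?[in RHS]e ?el_tau //; case: (et N).
  by case/negP: (h1 _ _ _ e q1 q2 t); rewrite sP sN.
- move=> ->; rewrite /F (mu _ _ u1) (mu _ _ u2) (mu _ _ u3) (md _ _ d1) (md _ _ d2) (md _ _ d3).
  exact: h2 e t1 t2 u1 u2 d1 d2 d3 u3 sP sN.
- by case/negP: (h3 _ _ _ e q1 q2); rewrite sP sN.
move=> ->; rewrite /F (mu _ _ u1) (mu _ _ u2) (md _ _ d1) (md _ _ d2).
exact: h4 e u1 d1 d2 u2 sP sN.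
Qed.

Lemma thin_step (supp : pred (tedge n)) (w : tedge n -> tedge n -> k) :
  (forall N, \sum_X wa supp w X N * wa supp w (etau N) X = 0) -> (forall P Q, w P Q != 0) ->
  forall P Q (f : mhom k M P), pev supp w f != 0 -> move P Q -> supp P -> supp Q ->
  exists f : mhom k M Q, pev supp w f != 0.
Proof.
move=> mesh0 w0 P Q f nz mv sP sQ; exists (ar P Q \oc f).
by rewrite (pev_comp mesh0) (pev_ar mesh0) /wa mv /wt sP sQ mulf_neq0.
Qed.

Lemma dn_from (N : tedge n) e : (el N < n)%N ->
  exists P, [/\ dn P N, el P = (el N).+1 & el P = n -> et P = e].
Proof.
move=> lN; have bN := el_bounds n2 N; have hN := ep_lt N.
have [P [p1 p2 p3]] := @edge_ex n n2 (shiftn n (ep N) (n - 1)) (el N).+1 e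
  ltac:(apply: shift_lt => //; lia) ltac:(lia).
exists P; split=> //; last by rewrite p2.
rewrite /dn p1 p2 eqxx andbT /shiftn; apply/eqP.
by case: (ltnP (ep N + (n - 1)) n) => h;
  [case: (ltnP (ep N + (n - 1) + 1) n)|case: (ltnP (ep N + (n - 1) - n + 1) n)]; lia.
Qed.

Section Trap.
Variable e : bool.
Hypothesis eM : m = n -> et M = e.

(** Of the two radii at a vertex only the one of tag [e] is kept, so that the mesh at level [n - 1]
    cancels like an ordinary square. *)
Definition tsupp N := (x N + 2 <= m <= x N + el N)%N && ((el N == n) ==> (et N == e)).
(* The sign makes the two paths around each mesh cancel. *)
Definition tw (P Q : tedge n) : k := if up P Q then 1 else (-1) ^+ (x P + el P).

Lemma tw_neq0 P Q : tw P Q != 0.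
Proof. by rewrite /tw; case: ifP; rewrite ?oner_eq0 // signr_eq0. Qed.

Lemma tsupp_up P Q : (el Q < n)%N || (et Q == e) -> up P Q -> tsupp P -> tsupp Q.
Proof.
move=> h u /andP[h1 _]; have l := up_el u; rewrite /tsupp (x_up u).
apply/andP; split; first edge_lia.
by apply/implyP => /eqP lQ; move: h; rewrite lQ ltnn.
Qed.

Lemma upNdn (P Q : tedge n) : dn P Q -> up P Q = false.
Proof. by move/dn_el => h; rewrite /up; apply/negP => /andP[_ /eqP]; edge_lia. Qed.

Lemma trap_mesh N : \sum_X wa tsupp tw X N * wa tsupp tw (etau N) X = 0.
Proof.
have bM := el_bounds n2 M.
have xd P Q : dn P Q -> tsupp P -> x Q = (x P).+1.
  by move=> d /andP[h _]; rewrite (x_dn d); case: eqP => // h'; edge_lia.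
apply: thin_mesh => {N}.
- move=> P Q N lP d u; have lN : el N = n by rewrite -[RHS]lP (up_el u) (dn_el d).
  rewrite /tsupp lP lN eqxx /=; apply: contraNN => /andP[/andP[_ /eqP ->] /andP[_ /eqP ->]].
  by [].
- move=> P R1 R2 D N lP t1 t2 u1 u2 d1 d2 d3 u3 sP sN.
  have l1 := up_el u1; have l2 := up_el u2; have l3 := dn_el d3.
  have xN : x N = (x P).+1 by rewrite (x_up u3) (xd _ _ d3).
  have xD := xd _ _ d3 sP; have x1 := x_up u1; have x2 := x_up u2.
  have sD : tsupp D.
    move: sP sN; rewrite /tsupp xN xD => /andP[/andP[a1 a2] _] /andP[/andP[a3 a4] _].
    by apply/andP; split; [edge_lia|apply/implyP => /eqP; edge_lia].
  have s1 : tsupp R1 = e.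
    move: sP sN; rewrite /tsupp x1 l1 lP eqxx t1 => /andP[/andP[a1 a2] _] _.
    by move: a1 a2 lP; case: e => /=; rewrite ?andbT ?andbF //; clear; lia.
  have s2 : tsupp R2 = ~~ e.
    move: sP sN; rewrite /tsupp x2 l2 lP eqxx (negPf t2) => /andP[/andP[a1 a2] _] _.
    by move: a1 a2 lP; case: e => /=; rewrite ?andbT ?andbF //; clear; lia.
  rewrite /wt s1 s2 sP sN sD /tw u1 u2 u3 !upNdn //= x1 x2 l1 l2 addnS exprS mulN1r.
  by case: e; rewrite /= !(mulr1, mul1r, mul0r, mulr0, addr0, add0r) addNr.
- move=> P Q N lP u d; apply/negP => /andP[/andP[sP _] /andP[sN _]].
  by have xQ := x_up u; have := x_dn d; rewrite xQ; case: eqP; edge_lia.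
move=> P Q D N lP u d d' u' sP sN.
have l1 := up_el u; have l3 := dn_el d'.
have xN : x N = (x P).+1 by rewrite (x_up u') (xd _ _ d').
have xD := xd _ _ d' sP; have x1 := x_up u.
have sD : tsupp D.
  move: sP sN; rewrite /tsupp xN xD => /andP[/andP[a1 a2] _] /andP[/andP[a3 a4] _].
  by apply/andP; split; [edge_lia|apply/implyP => /eqP; edge_lia].
have sQ : tsupp Q by apply: tsupp_up u sP; edge_lia.
rewrite /wt sQ sP sN sD /tw u u' !upNdn //= x1 l1 addnS exprS mulN1r.
by rewrite !(mulr1, mul1r) addNr.
Qed.

Lemma trap_reach N : tsupp N -> exists f : mhom k M N, pev tsupp tw f != 0.
Proof.
have bM := el_bounds n2 M.
have sM : tsupp M.
  by rewrite /tsupp /dist leqnn subnn; apply/andP; split; [edge_lia|apply/implyP => /eqP/eM ->].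
have step := thin_step trap_mesh tw_neq0.
(* Undoing an [up] step lowers [x + el]; undoing a [dn] step lowers [x] and keeps [x + el]. The
   measure drops by one in both cases. *)
have [s] := ubnP (x N + (x N + el N))%N; elim: s N => // s IH N hs sN.
have bN := el_bounds n2 N.
have [lt|ge] := ltnP m (x N + el N); last have [x0|x0] := posnP (x N).
- have [P [p1 p2 p3]] := @edge_ex n n2 (ep N) (el N).-1 true (ep_lt N)
    ltac:(move: sN; rewrite /tsupp; edge_lia).
  have xP : x P = x N by rewrite p1.
  have sP : tsupp P.
    move: sN; rewrite /tsupp xP p2 => /andP[h _]; apply/andP; split; first edge_lia.
    by apply/implyP => /eqP; edge_lia.
  have [f nz] := IH P ltac:(edge_lia) sP.
  by apply: step nz _ sP sN; rewrite moveE // /up p1 p2 eqxx; edge_lia.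
- have lN : el N = m by move: sN; rewrite /tsupp; edge_lia.
  have pN : ep N = ep M.
    by apply/esym/eqP; rewrite -(@dist_eq0 n) ?ep_lt // x0.
  have <- : M = N.
    apply: edge_inj => // h; rewrite (eM h); move: sN; rewrite /tsupp lN h eqxx /=.
    by case/andP => _ /eqP.
  by exists (idc (M : mcat n k)); rewrite (pev_id trap_mesh) sM oner_eq0.
have hx : (x N < n)%N by apply: dist_lt; apply: ep_lt.
have hlN : (el N < n)%N by move: sN; rewrite /tsupp; edge_lia.
have [P [d p2 p3]] := @dn_from N e hlN.
have xP : (x P).+1 = x N by have := x_dn d; case: eqP; edge_lia.
have sP : tsupp P.
  move: sN; rewrite /tsupp -xP p2 => /andP[h _]; apply/andP; split; first edge_lia.
  by apply/implyP => /eqP h1; rewrite p3 ?p2.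
have [f nz] := IH P ltac:(edge_lia) sP.
by apply: step nz _ sP sN; rewrite moveE // d orbT.
Qed.

End Trap.

Section Hook.
Hypothesis mn : (m < n)%N.

(* From [M] up to the puncture and then down along the reflected ray; the sign in
   [hw] cancels the two radii in the mesh where the ray turns. *)
Definition hsupp N := (x N == 0%N) && (m <= el N)%N || (0 < x N)%N && (x N + el N == n)%N.
Definition hw (P Q : tedge n) : k := if (el P == n) && ~~ et P then -1 else 1.

Lemma hw_neq0 P Q : hw P Q != 0.
Proof. by rewrite /hw; case: ifP; rewrite ?oppr_eq0 oner_eq0. Qed.

Lemma hook_mesh N : \sum_X wa hsupp hw X N * wa hsupp hw (etau N) X = 0.
Proof.
have bM := el_bounds n2 M.
apply: thin_mesh => {N}.
- move=> P Q N lP d u _; apply/negP => /andP[].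
  have b := el_bounds n2 N; have lN : el N = n by rewrite -[RHS]lP (up_el u) (dn_el d).
  rewrite /hsupp lN lP (x_up u); have := x_dn d; case: eqP; edge_lia.
- move=> P R1 R2 D N lP t1 t2 u1 u2 d1 d2 d3 u3.
  have l1 := up_el u1; have l2 := up_el u2; have l3 := dn_el d3; have lN := up_el u3.
  have x1 := x_up u1; have x2 := x_up u2.
  have xN : x N = x D by rewrite (x_up u3).
  have := x_dn d3; case: eqP => [h|h] xD sP sN.
    by move: sP sN; rewrite /hsupp xN xD; edge_lia.
  have x0 : x P = 0%N by move: sP sN; rewrite /hsupp xN xD; edge_lia.
  have sD : hsupp D = false by rewrite /hsupp xD x0; edge_lia.
  have s1 : hsupp R1 by rewrite /hsupp x1 x0; edge_lia.
  have s2 : hsupp R2 by rewrite /hsupp x2 x0; edge_lia.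
  have nP : (el P == n) = false by edge_lia.
  rewrite /wt s1 s2 sD sP sN /hw l1 l2 lP eqxx t1 t2 nP.
  by rewrite !(mulr0, mulr1, mul1r, addr0) addrN.
- move=> P Q N lP u d; apply/negP => /andP[].
  have lN := dn_el d; have lQ := up_el u; rewrite /hsupp.
  by have xQ := x_up u; have := x_dn d; rewrite xQ; case: eqP; edge_lia.
move=> P Q D N lP u d d' u' sP sN; exfalso; move: sP sN.
have l1 := up_el u; have l3 := dn_el d'; have lN := up_el u'; have xN := x_up u'.
by rewrite /hsupp xN; have := x_dn d'; case: eqP; edge_lia.
Qed.

Lemma hook_reach N : hsupp N -> (el N = n -> et N) ->
  exists f : mhom k M N, pev hsupp hw f != 0.
Proof.
have bM := el_bounds n2 M.
have step := thin_step hook_mesh hw_neq0.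
have [s] := ubnP (x N + (x N + el N))%N; elim: s N => // s IH N hs sN tN.
have bN := el_bounds n2 N.
have [x0|x0] := posnP (x N); last first.
  have hx : (x N < n)%N by apply: dist_lt; apply: ep_lt.
  have hlN : (el N < n)%N by move: sN; rewrite /hsupp; edge_lia.
  have [P [d p2 p3]] := @dn_from N true hlN.
  have xP : (x P).+1 = x N by have := x_dn d; case: eqP; edge_lia.
  have sP : hsupp P by move: sN; rewrite /hsupp -xP p2; edge_lia.
  have [f nz] := IH P ltac:(edge_lia) sP ltac:(by move/p3->).
  by apply: step nz _ sP sN; rewrite moveE // d orbT.
have pN : ep N = ep M by apply/esym/eqP; rewrite -(@dist_eq0 n) ?ep_lt // x0.
have [lN|lN] := eqVneq (el N) m.
  have <- : M = N by apply: edge_inj => //; edge_lia.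
  exists (idc (M : mcat n k)); rewrite (pev_id hook_mesh) (_ : hsupp M) ?oner_eq0 //.
  by rewrite /hsupp /dist leqnn subnn; edge_lia.
have [P [p1 p2 p3]] := @edge_ex n n2 (ep N) (el N).-1 true (ep_lt N)
  ltac:(move: sN; rewrite /hsupp; edge_lia).
have xP : x P = x N by rewrite p1.
have sP : hsupp P by move: sN; rewrite /hsupp xP p2; edge_lia.
have [f nz] := IH P ltac:(edge_lia) sP ltac:(edge_lia).
by apply: step nz _ sP sN; rewrite moveE // /up p1 p2 eqxx; edge_lia.
Qed.

End Hook.

Lemma trap_nz N : trap n m (et M) (x N) (el N) (et N) -> exists f : mhom k M N, f <> 0.
Proof.
move=> /andP[h1 h2].
have hE : m = n -> et M = (if m == n then et M else et N) by move=> ->; rewrite eqxx.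
have [|f nz] := @trap_reach _ hE N.
  rewrite /tsupp h1 /=; apply/implyP => lN; move: h2; rewrite lN /=.
  by case: eqP => //= _ /eqP->.
by exists f => f0; move: nz; rewrite f0 (pev0 (trap_mesh hE)) eqxx.
Qed.

Lemma hook_nz N : (m < n)%N -> (x N + el N = n)%N -> (0 < x N)%N ->
  exists f : mhom k M N, f <> 0.
Proof.
move=> mn h h0; have [||f nz] := @hook_reach mn N.
- by rewrite /hsupp; edge_lia.
- by edge_lia.
by exists f => f0; move: nz; rewrite f0 (pev0 (hook_mesh mn)) eqxx.
Qed.

(** In the reflected region the absence of a crossing forces [x + el = n], which is the ray reached
    by [hook_nz]. *)
Lemma hits_nz N : ~~ cross n (el N) (et N) (dist n (ep N) (ep M)) m (et M) -> ehits M N ->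
  exists f : mhom k M N, f <> 0.
Proof.
move=> hc /orP[]; first exact: trap_nz.
move=> /and5P[h1 h2 h3 h4 h5]; apply: hook_nz => //; last by edge_lia.
have := dist_sym (ep_lt M) (ep_lt N) => -[[? ?]|[? h7]]; first by edge_lia.
by apply/eqP; apply: contraNT hc; rewrite /cross h7; edge_lia.
Qed.

(** Ext^1 is Hom into [tau]: moving the start one step back and flipping the tag turns [cross] into
    [trap]. *)
Lemma cross_nz N : cross n m (et M) (x N) (el N) (et N) ->
  exists f : mhom k M (etau N), f <> 0.
Proof.
move=> /andP[/andP[h1 h2] h3]; apply: trap_nz; rewrite el_tau (ep_tau n2).
have -> : dist n (ep M) (shiftn n (ep N) (n - 1)) = (x N).-1.
  have := ep_lt M; have := ep_lt N => hN hM; move: h1; rewrite /dist /shiftn.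
  by case: (ltnP (ep N + (n - 1)) n) => h4; [case: (leqP (ep M) (ep N + (n - 1)))
    |case: (leqP (ep M) (ep N + (n - 1) - n))]; case: (leqP (ep M) (ep N)); edge_lia.
apply/andP; split; first edge_lia.
apply/implyP => /[dup] hm /eqP hm'; apply/implyP => /[dup] hl /eqP hl'.
by move: h3; rewrite hm hl /= et_tau //; case: (et M) (et N) => [] [].
Qed.

End Nonzero.

(** * Linear categories and endomorphism algebras *)

Section Isom.
Variables (k : fieldType) (C : kcat k).
Implicit Types X Y Z : C.

Lemma isom_refl X : isom X X.
Proof. by exists (idc X), (idc X); rewrite comp1c. Qed.

Lemma isom_sym X Y : isom X Y -> isom Y X.
Proof. by case=> f [g [h1 h2]]; exists g, f. Qed.

Lemma isom_trans X Y Z : isom X Y -> isom Y Z -> isom X Z.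
Proof.
case=> f [g [h1 h2]] [f' [g' [h3 h4]]]; exists (f' \oc f), (g \oc g'); split.
  by rewrite compA -(compA g) h3 compc1.
by rewrite compA -(compA f') h2 compc1.
Qed.

Lemma isom_zero X Y : isom X Y -> zero_object X -> zero_object Y.
Proof. by case=> f [g [h1 h2]] z; rewrite /zero_object -h2 -(compc1 f) z compc0 comp0c. Qed.

Lemma is_direct_sum_iso (I : finType) (X Y : I -> C) S S' :
  (forall i, isom (X i) (Y i)) -> isom S S' -> is_direct_sum X S -> is_direct_sum Y S'.
Proof.
move=> XY [u [v [vu uv]]] [inj [prj [h1 h2 h3]]].
pose f i := projT1 (cid (XY i)); have fP i := projT2 (cid (XY i)).
pose g i := projT1 (cid (fP i)).
have gP i : g i \oc f i = idc _ /\ f i \oc g i = idc _ := projT2 (cid (fP i)).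
exists (fun i => u \oc (inj i \oc g i)), (fun i => (f i \oc prj i) \oc v).
have E i j : ((f j \oc prj j) \oc v) \oc (u \oc (inj i \oc g i)) =
    f j \oc ((prj j \oc inj i) \oc g i).
  by rewrite -!compA (compA v) vu comp1c.
split=> [i|i j ij|].
- by rewrite E h1 comp1c; case: (gP i).
- by rewrite E h2 // comp0c compc0.
rewrite -uv -[v in RHS]comp1c -h3 comp_suml comp_sumr; apply: eq_bigr => i _.
have [gf _] := gP i.
by rewrite -!compA (compA (g i)) gf comp1c.
Qed.

Lemma isom_direct_sum (I : finType) (X Y : I -> C) (q : I -> I) S S' :
  injective q -> (forall i, isom (X i) (Y (q i))) ->
  is_direct_sum X S -> is_direct_sum Y S' -> isom S S'.
Proof.
move=> q_inj XY dX [inj' [prj' [h1' h2' h3']]].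
have [inj [prj [h1 h2 h3]]] := is_direct_sum_iso XY (isom_refl S) dX.
exists (\sum_i (inj' (q i) \oc prj i)), (\sum_i (inj i \oc prj' (q i))).
split.
  rewrite -h3 comp_suml; apply: eq_bigr => i _; rewrite comp_sumr (bigD1 i) //= big1 ?addr0.
    by rewrite -compA (compA (prj' _)) h1' comp1c.
  move=> j ji; rewrite -compA (compA (prj' _)) h2' ?comp0c ?compc0 //.
  by rewrite (inj_eq q_inj).
rewrite -h3' [RHS](reindex_inj q_inj) comp_suml; apply: eq_bigr => i _.
rewrite comp_sumr (bigD1 i) //= big1 ?addr0.
  by rewrite -compA (compA (prj _)) h1 comp1c.
by move=> j ji; rewrite -compA (compA (prj _)) h2 ?comp0c ?compc0.
Qed.

End Isom.

(** * Functors and equivalences of linear categories *)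

Section Functor.
Variables (k : fieldType).

Lemma fmapD (A B : kcat k) (F : kfunctor A B) (X Y : A) (f g : hom X Y) :
  fmap F (f + g) = fmap F f + fmap F g.
Proof. by have := fmap_lin F 1 f g; rewrite !scale1r. Qed.

Lemma fmap0 (A B : kcat k) (F : kfunctor A B) (X Y : A) : fmap F (0 : hom X Y) = 0.
Proof. by have := fmap_lin F (-1) (0 : hom X Y) 0; rewrite scaler0 addr0 scaleN1r addNr. Qed.

Lemma fmapZ (A B : kcat k) (F : kfunctor A B) (X Y : A) a (f : hom X Y) :
  fmap F (a *: f) = a *: fmap F f.
Proof. by have := fmap_lin F a f 0; rewrite fmap0 !addr0. Qed.

Lemma fmap_sum (A B : kcat k) (F : kfunctor A B) (X Y : A) (I : finType) (f : I -> hom X Y) :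
  fmap F (\sum_i f i) = \sum_i fmap F (f i).
Proof. by elim/big_rec2: _ => [|i x y _ <-]; rewrite ?fmap0 ?fmapD. Qed.

Lemma fmap_isom (A B : kcat k) (F : kfunctor A B) (X Y : A) : isom X Y -> isom (F X) (F Y).
Proof.
by case=> f [g [h1 h2]]; exists (fmap F f), (fmap F g); rewrite -!fmap_comp h1 h2 !fmap_id.
Qed.

Lemma fmap_direct_sum (A B : kcat k) (F : kfunctor A B) (I : finType) (X : I -> A) S :
  is_direct_sum X S -> is_direct_sum (fun i => F (X i)) (F S).
Proof.
case=> inj [prj [h1 h2 h3]]; exists (fun i => fmap F (inj i)), (fun i => fmap F (prj i)).
split=> [i|i j ij|]; first by rewrite -fmap_comp h1 fmap_id.
  by rewrite -fmap_comp h2 ?fmap0.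
by rewrite -fmap_id -h3 fmap_sum; apply: eq_bigr => i _; rewrite fmap_comp.
Qed.

Lemma natiso_isom (A B : kcat k) (F G : kfunctor A B) (e : natiso F G) (X : A) : isom (F X) (G X).
Proof. by exists (nfwd e X), (nbwd e X); rewrite nfwdK nbwdK. Qed.

Definition faithful (A B : kcat k) (F : kfunctor A B) :=
  forall (X Y : A) (f g : hom X Y), fmap F f = fmap F g -> f = g.
Definition full (A B : kcat k) (F : kfunctor A B) :=
  forall (X Y : A) (h : hom (F X) (F Y)), exists f : hom X Y, fmap F f = h.

Lemma natiso_faithful (A B : kcat k) (F : kfunctor A B) (G : kfunctor B A) :
  natiso (fun_comp G F) (fun_id A) -> faithful F.
Proof.
move=> e X Y f g fg.
have E (h : hom X Y) : h = nfwd e Y \oc fmap (fun_comp G F) h \oc nbwd e X.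
  by rewrite nfwd_nat -compA nbwdK compc1.
by rewrite (E f) (E g) /= fg.
Qed.

(** The preimage of [h] is [fmap G h] conjugated by the natural isomorphism; that it works is tested
    after applying the faithful [G]. *)
Lemma natiso_full (A B : kcat k) (F : kfunctor A B) (G : kfunctor B A) :
  natiso (fun_comp G F) (fun_id A) -> faithful G -> full F.
Proof.
move=> e fG X Y h; pose f := nfwd e Y \oc fmap G h \oc nbwd e X; exists f; apply: fG.
have E : nfwd e Y \oc fmap G (fmap F f) = f \oc nfwd e X := nfwd_nat e f.
have nK Z : nbwd e Z \oc nfwd e Z = idc (G (F Z)) := nfwdK e Z.
by rewrite -[LHS]comp1c -nK -compA E /f !compA nK comp1c -compA nK compc1.
Qed.

Definition natiso_sym (A B : kcat k) (F G : kfunctor A B) (e : natiso F G) : natiso G F.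
Proof.
refine (@NatIso k A B G F (nbwd e) (nfwd e) (nbwdK e) (nfwdK e) _) => X Y f.
rewrite -(compc1 (_ \oc fmap G f)) -(nbwdK e X) compA -(compA (nbwd e Y)) -nfwd_nat.
by rewrite (compA (nbwd e Y)) nfwdK comp1c.
Defined.

Lemma efun_faithful (A B : kcat k) (E : kequiv A B) : faithful E.
Proof. exact: natiso_faithful (natiso_sym (eunit E)). Qed.

Lemma einv_faithful (A B : kcat k) (E : kequiv A B) : faithful (einv E).
Proof. exact: natiso_faithful (ecounit E). Qed.

Lemma efun_full (A B : kcat k) (E : kequiv A B) : full E.
Proof. exact: natiso_full (natiso_sym (eunit E)) (@einv_faithful _ _ E). Qed.

Lemma einv_full (A B : kcat k) (E : kequiv A B) : full (einv E).
Proof. exact: natiso_full (ecounit E) (@efun_faithful _ _ E). Qed.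

Lemma comp_faithful (A B C : kcat k) (G : kfunctor B C) (F : kfunctor A B) :
  faithful G -> faithful F -> faithful (fun_comp G F).
Proof. by move=> fG fF X Y f g /fG/fF. Qed.

Lemma comp_full (A B C : kcat k) (G : kfunctor B C) (F : kfunctor A B) :
  full G -> full F -> full (fun_comp G F).
Proof.
by move=> fG fF X Y h; have [f <-] := fG _ _ h; have [g <-] := fF _ _ f; exists g.
Qed.

End Functor.

Section Endop.
Variables (k : fieldType).

Lemma endop_isomorphic_intro (C : kcat k) (T T' : C) (f : endop T -> endop T') :
  (forall a (x y : endop T), f (a *: x + y) = a *: f x + f y) -> bijective f ->
  f (idc T) = idc T' -> (forall x y : hom T T, f (x \oc y) = comp (f x) (f y)) ->
  endop_isomorphic T T'.
Proof.
move=> flin fbij f1 fM.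
pose F : {linear endop T -> endop T'} :=
  HB.pack f (GRing.isLinear.Build k (endop T) (endop T') _ f flin).
by exists F; split=> //; split=> // x y; apply: fM.
Qed.

Lemma endop_iso_sym (C : kcat k) (T T' : C) : endop_isomorphic T T' -> endop_isomorphic T' T.
Proof.
case=> f [[g fK gK] [f1 fM]].
apply: (@endop_isomorphic_intro C T' T g) => [a x y||| x y].
- by apply: (can_inj fK); rewrite gK linearP !gK.
- by exists f.
- by apply: (can_inj fK); rewrite gK; apply: esym.
by apply: (can_inj fK); rewrite gK [RHS](fM (g y) (g x)) !gK.
Qed.

Lemma endop_iso_trans (C : kcat k) (T T' T'' : C) :
  endop_isomorphic T T' -> endop_isomorphic T' T'' -> endop_isomorphic T T''.
Proof.
case=> f [fb [f1 fM]] [g [gb [g1 gM]]].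
apply: (@endop_isomorphic_intro C T T'' (g \o f)) => [a x y||| x y].
- by rewrite /= !linearP.
- exact: bij_comp.
- by rewrite /= [f _]f1.
by rewrite /= [f _](fM y x) [g _]gM.
Qed.

Lemma endop_iso_isom (C : kcat k) (T T' : C) : isom T T' -> endop_isomorphic T T'.
Proof.
case=> u [v [vu uv]].
apply: (@endop_isomorphic_intro C T T' (fun x => u \oc x \oc v)) => [a x y||| x y].
- by rewrite comp_linr comp_linl.
- exists (fun x => v \oc x \oc u) => x; rewrite !compA ?vu ?uv comp1c -compA ?vu ?uv compc1 //.
- by rewrite compc1.
by rewrite !compA -[u \oc x \oc v \oc u]compA vu compc1.
Qed.

Lemma endop_iso_functor (C : kcat k) (F : kfunctor C C) (T : C) :
  full F -> faithful F -> endop_isomorphic T (F T).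
Proof.
move=> Ffull Ffaith; have [h hP] := choice (Ffull T T).
apply: (@endop_isomorphic_intro C T (F T) (fun x => fmap F x)) => [a x y||| x y].
- exact: fmap_lin.
- by exists h => x //; apply: Ffaith; rewrite hP.
- exact: fmap_id.
exact: fmap_comp.
Qed.

End Endop.

(* What distinguishes the indecomposable summands of a tilting object, without
   recourse to Krull-Schmidt: scalar endomorphisms, and no identity factors
   through another summand. *)
Definition bricks (k : fieldType) (C : kcat k) (I : Type) (X : I -> C) : Prop :=
  [/\ forall i (f : hom (X i) (X i)), exists c, f = c *: idc (X i),
      forall i, idc (X i) <> 0
    & forall i j (f : hom (X i) (X j)) (g : hom (X j) (X i)), i <> j -> g \oc f = 0].

(** * Characters of an endomorphism algebra at its brick summands *)

Section Bricks.
Variables (k : fieldType) (C : kcat k) (I : finType) (X : I -> C) (T : C).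
Hypothesis brX : bricks X.
Variables (inj : forall i, hom (X i) T) (prj : forall i, hom T (X i)).
Hypothesis pi1 : forall i, prj i \oc inj i = idc (X i).
Hypothesis pi0 : forall i j, i != j -> prj j \oc inj i = 0.
Hypothesis ip1 : \sum_i (inj i \oc prj i) = idc T.

Definition bidem i : hom T T := inj i \oc prj i.

Lemma bidem0 i j : i != j -> bidem j \oc bidem i = 0.
Proof. by move=> ij; rewrite /bidem -compA (compA (prj j)) pi0 // comp0c compc0. Qed.

Lemma bidem_neq0 i : bidem i <> 0.
Proof.
move=> h; case: brX => _ /(_ i) ne _; apply: ne.
by rewrite -(comp1c (idc _)) -pi1 -compA (compA (inj i)) -/(bidem i) h comp0c compc0.
Qed.

Lemma bchar_ex i (f : hom T T) : exists c, prj i \oc f \oc inj i = c *: idc (X i).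
Proof. by case: brX. Qed.

Definition bchar i f := projT1 (cid (bchar_ex i f)).

Lemma bcharE i f : prj i \oc f \oc inj i = bchar i f *: idc (X i).
Proof. exact: projT2 (cid (bchar_ex i f)). Qed.

Lemma bchar_uniq i f c : prj i \oc f \oc inj i = c *: idc (X i) -> bchar i f = c.
Proof.
rewrite bcharE => /eqP; rewrite -subr_eq0 -scalerBl scaler_eq0 subr_eq0.
by case/orP => /eqP // h; case: brX => _ /(_ i) /(_ h).
Qed.

Lemma bchar_idem i f : bidem i \oc f \oc bidem i = bchar i f *: bidem i.
Proof.
by rewrite /bidem -!compA (compA f) (compA (prj i)) (compA (prj i) f) bcharE compZl comp1c compZr.
Qed.

(** Inserting the sum of the idempotents between [g] and [f], only the term through [X i] survives:
    composites through another summand vanish by [bricks]. *)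
Lemma bcharM i f g : bchar i (g \oc f) = bchar i g * bchar i f.
Proof.
apply: bchar_uniq; case: brX => _ _ b0.
have -> : prj i \oc (g \oc f) \oc inj i =
    \sum_j ((prj i \oc g \oc inj j) \oc (prj j \oc f \oc inj i)).
  rewrite -[f in LHS]comp1c -ip1 comp_suml comp_sumr comp_sumr comp_suml.
  by apply: eq_bigr => j _; rewrite !compA.
rewrite (bigD1 i) //= big1 ?addr0; last by move=> j /eqP ji; apply: b0; apply: nesym.
by rewrite !bcharE compZl comp1c scalerA.
Qed.

Lemma bchar1 i : bchar i (idc T) = 1.
Proof. by apply: bchar_uniq; rewrite compc1 pi1 scale1r. Qed.

Lemma bchar0 i : bchar i 0 = 0.
Proof. by apply: bchar_uniq; rewrite compc0 comp0c scale0r. Qed.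

Lemma bcharD i f g : bchar i (f + g) = bchar i f + bchar i g.
Proof. by apply: bchar_uniq; rewrite compDr compDl !bcharE scalerDl. Qed.

Lemma bchar_sum i (J : finType) (f : J -> hom T T) : bchar i (\sum_j f j) = \sum_j bchar i (f j).
Proof. by elim/big_rec2: _ => [|j x y _ <-]; rewrite ?bchar0 ?bcharD. Qed.

Lemma hom_nz i j : (exists f : hom (X i) (X j), f <> 0) <->
  (exists f : hom T T, bidem j \oc f \oc bidem i <> 0).
Proof.
split=> [[f nz]|[f nz]].
  exists (inj j \oc f \oc prj i) => h; apply: nz.
  have : prj j \oc (bidem j \oc (inj j \oc f \oc prj i) \oc bidem i) \oc inj i = f.
    by rewrite /bidem -!compA pi1 compc1 pi1 compc1 !compA pi1 comp1c pi1 comp1c.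
  by rewrite h compc0 comp0c.
exists (prj j \oc f \oc inj i) => h; apply: nz.
by rewrite /bidem -!compA (compA f) (compA (prj j)) !(compA (prj j)) h comp0c compc0.
Qed.

End Bricks.

Section Transfer.
Variables (k : fieldType) (C : kcat k) (I : finType) (X X' : I -> C) (T T' : C).

(* The image of the idempotent at [X i] has a nonzero component at exactly one
   idempotent [X' (q i)]; each of the two factors through the other. *)
Lemma brick_transfer : bricks X -> bricks X' -> is_direct_sum X T -> is_direct_sum X' T' ->
  endop_isomorphic T T' ->
  exists q : I -> I, injective q /\ forall i j,
    (exists f : hom (X i) (X j), f <> 0) <-> (exists f : hom (X' (q i)) (X' (q j)), f <> 0).
Proof.
move=> bX bX' [inj [prj [p1 p0 i1]]] [inj' [prj' [p1' p0' i1']]] [F [[G FK GK] [F1 FM]]].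
have {}FM (g f : hom T T) : F (g \oc f) = comp (F g) (F f) by exact: (FM f g).
have {}F1 : F (idc T) = idc T' by [].
have F0 : F 0 = 0 by rewrite linear0.
have FZ c (f : hom T T) : F (c *: f) = c *: F f by rewrite linearZ.
have G1 : G (idc T') = idc T by apply: (can_inj FK); rewrite GK.
pose e := bidem inj prj; pose e' := bidem inj' prj'.
pose ch := bchar bX inj prj; pose ch' := bchar bX' inj' prj'.
have e0 i : e i <> 0 by apply: bidem_neq0.
have chE i f : e i \oc f \oc e i = ch i f *: e i by exact: bchar_idem.
have chE' i f : e' i \oc f \oc e' i = ch' i f *: e' i by exact: bchar_idem.
have e_or i j : i != j -> e j \oc e i = 0 by exact: bidem0.
have e_sum : \sum_j e' j = idc T' by exact: i1'.
have hz i j : (exists f : hom (X i) (X j), f <> 0) <->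
    (exists f : hom T T, e j \oc f \oc e i <> 0) := hom_nz p1 i j.
have hz' i j : (exists f : hom (X' i) (X' j), f <> 0) <->
    (exists f : hom T' T', e' j \oc f \oc e' i <> 0) := hom_nz p1' i j.
clearbody e e'.
(* The character at [X i] is 1 on the identity, which is the sum of the transported idempotents, so
   it is nonzero on one of them. *)
have qex i : exists j, ch i (G (e' j)) != 0.
  apply/existsP; apply: contraT; rewrite negb_exists => /forallP h.
  have := bchar1 bX p1 i; rewrite -/(ch i _) -G1 -e_sum => s.
  have : ch i (\sum_j G (e' j)) = 1.
    rewrite -[RHS]s; congr (ch i _); apply: (can_inj FK); rewrite GK linear_sum.
    by apply: eq_bigr => j _; rewrite GK.
  rewrite /ch bchar_sum big1 => [/eqP|j _]; first by rewrite eq_sym oner_eq0.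
  by apply/eqP; have := h j; rewrite negbK.
have [q qP] := choice qex.
have EeE i : F (e i) \oc e' (q i) \oc F (e i) = ch i (G (e' (q i))) *: F (e i).
  by rewrite -FZ -chE !FM GK.
(* With this coefficient 0, alternating three copies of [F (e i)] with two of [e' (q i)] gives 0,
   but the product is also a nonzero multiple of [F (e i)]. *)
have q0 i : ch' (q i) (F (e i)) != 0.
  apply/eqP => h; apply: (e0 i).
  have := chE' (q i) (F (e i)); rewrite h scale0r => z.
  have : (F (e i) \oc e' (q i) \oc F (e i)) \oc (e' (q i) \oc F (e i)) = 0.
    by rewrite -!compA (compA (e' (q i))) (compA (e' (q i) \oc _)) z comp0c compc0.
  rewrite EeE compZl compA EeE scalerA => /eqP.
  rewrite scaler_eq0 mulf_eq0 (negPf (qP i)) /= => /eqP E.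
  by apply: (can_inj FK); rewrite E F0.
exists q; split.
  move=> i j qij; apply/eqP; apply: contraT => ij.
  have : ch' (q i) (F (e i) \oc F (e j)) = ch' (q i) (F (e i)) * ch' (q j) (F (e j)).
    by rewrite -qij; apply: bcharM.
  rewrite -FM (_ : e i \oc e j = 0); last by apply: e_or; rewrite eq_sym.
  rewrite F0 /ch' bchar0 -/ch' => /eqP; rewrite eq_sym mulf_eq0.
  by rewrite (negPf (q0 i)) (negPf (q0 j)).
move=> i j; rewrite hz hz'; split=> -[f nz].
  exists (F (e j) \oc F f \oc F (e i)) => h; apply: nz.
  apply: (can_inj FK); rewrite F0 !FM.
  have cc : ch j (G (e' (q j))) * ch i (G (e' (q i))) != 0 by rewrite mulf_neq0.
  apply: (scalerI cc); rewrite scaler0 -scalerA -compZr -EeE -compZl -compZl -EeE.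
  have {}h : e' (q j) \oc (F (e j) \oc F f \oc F (e i)) \oc e' (q i) = 0 by exact: h.
  by have := comp0c T' (F (e i)); rewrite -[in LHS]h -!compA => ->; rewrite compc0.
exists (G (e' (q j)) \oc G f \oc G (e' (q i))) => h; apply: nz.
have cc : ch' (q j) (F (e j)) * ch' (q i) (F (e i)) != 0 by rewrite mulf_neq0.
apply: (scalerI cc); rewrite scaler0 -scalerA -compZr -chE' -compZl -compZl -chE'.
have {}h : F (e j \oc (G (e' (q j)) \oc G f \oc G (e' (q i))) \oc e i) = 0 by rewrite h F0.
rewrite !FM !GK in h.
by have := comp0c T' (e' (q i)); rewrite -[in LHS]h -!compA => ->; rewrite compc0.
Qed.

End Transfer.

(** * Additive hulls and the automorphism sigma *)

Section EqHom.
Variables (k : fieldType) (C : kcat k).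

(** The identity transported along an equality of objects, needed because summands of a mapped
    sequence agree only propositionally. *)
Definition eqhom (X Y : C) (e : X = Y) : hom X Y := ecast Z (hom X Z) e (idc X).

Lemma eqhom_id (X : C) (e : X = X) : eqhom e = idc X.
Proof. by rewrite (Prop_irrelevance e erefl). Qed.

Lemma eqhom_comp (X Y Z : C) (e : X = Y) (e' : Y = Z) (e'' : X = Z) :
  eqhom e' \oc eqhom e = eqhom e''.
Proof. by case: Z / e' e''; case: Y / e => e; rewrite !eqhom_id comp1c. Qed.

Lemma eqhomK (X Y : C) (e : X = Y) (e' : Y = X) : eqhom e' \oc eqhom e = idc X.
Proof. by rewrite (eqhom_comp _ _ erefl). Qed.

End EqHom.

Section HullFunctor.
Variables (k : fieldType) (A B : kcat k) (F : kfunctor A B).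

Definition unmap (s : seq A) (i : 'I_(size (map F s))) : 'I_(size s) := cast_ord (size_map F s) i.
Definition remap (s : seq A) (i : 'I_(size s)) : 'I_(size (map F s)) :=
  cast_ord (esym (size_map F s)) i.

Lemma unmapK (s : seq A) : cancel (@unmap s) (@remap s). Proof. exact: cast_ordK. Qed.
Lemma remapK (s : seq A) : cancel (@remap s) (@unmap s). Proof. exact: cast_ordKV. Qed.

Lemma summand_map (s : seq A) (i : 'I_(size (map F s))) :
  @summand k B (map F s) i = F (@summand k A s (unmap i)).
Proof.
rewrite /summand !(tnth_nth (F (summand (unmap i)))) /=.
rewrite (nth_map (summand (unmap i))); last by rewrite -(size_map F).
by congr (fob F _); apply: set_nth_default; rewrite -(size_map F).
Qed.

Definition hull_map (s t : additive_hull A) (f : hom s t) :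
    @hom k (additive_hull B) (map F s) (map F t) :=
  fun i j => eqhom (esym (summand_map j)) \oc (fmap F (f (unmap i) (unmap j)) \oc eqhom (summand_map i)).

Lemma hull_mapE (s t : additive_hull A) (f : hom s t) i j :
  fmap F (f (unmap i) (unmap j)) =
    eqhom (summand_map j) \oc (hull_map f i j \oc eqhom (esym (summand_map i))).
Proof. by rewrite /hull_map -!compA eqhomK compc1 compA eqhomK comp1c. Qed.

Lemma hull_map_id (s : additive_hull A) : hull_map (idc s) = @idc k (additive_hull B) (map F s).
Proof.
apply: hhomP => i j; rewrite /hull_map.
change (idc s) with (@hid k A s); change (idc _) with (@hid k B (map F s)).
have [<-|ij] := eqVneq i j; first by rewrite !hidE fmap_id comp1c eqhomK.
by rewrite !hidN ?fmap0 ?comp0c ?compc0 //; apply: contraNN ij => /eqP/(can_inj (@unmapK s))->.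
Qed.

Lemma hull_map_comp (s t u : additive_hull A) (g : hom t u) (f : hom s t) :
  hull_map (g \oc f) = hull_map g \oc hull_map f.
Proof.
apply: hhomP => i l; change (hull_map (hcomp g f) i l = hcomp (hull_map g) (hull_map f) i l).
rewrite /hcomp /hull_map (reindex (@unmap t)) /=; last first.
  by exists (@remap t) => j _; rewrite ?unmapK ?remapK.
rewrite fmap_sum comp_suml comp_sumr; apply: eq_bigr => j _.
rewrite fmap_comp -!compA; congr (_ \oc (_ \oc _)).
by rewrite (compA (eqhom _) (eqhom _)) eqhomK comp1c.
Qed.

Lemma hull_map_lin (s t : additive_hull A) a (f g : hom s t) :
  hull_map (a *: f + g) = a *: hull_map f + hull_map g.
Proof.
apply: hhomP => i j; rewrite /hull_map.
change (eqhom (esym (summand_map j)) \oc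
  (fmap F (a *: f (unmap i) (unmap j) + g (unmap i) (unmap j)) \oc eqhom (summand_map i)) =
  a *: (hull_map f i j) + hull_map g i j).
by rewrite fmap_lin comp_linl comp_linr.
Qed.

Definition hull_functor : kfunctor (additive_hull A) (additive_hull B) :=
  @KFunctor k (additive_hull A) (additive_hull B) (map F) hull_map
    hull_map_id hull_map_comp hull_map_lin.

Lemma hull_faithful : faithful F -> faithful hull_functor.
Proof.
move=> fF s t f g fg; apply: hhomP => i j; rewrite -(remapK i) -(remapK j).
apply: fF; rewrite !hull_mapE; congr (_ \oc (_ \oc _)).
exact: (congr1 (fun h : hhom _ _ => h (remap i) (remap j)) fg).
Qed.

Lemma summand_remap (s : seq A) (i : 'I_(size s)) :
  @summand k B (map F s) (remap i) = F (@summand k A s i).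
Proof. by rewrite summand_map remapK. Qed.

Lemma hull_entry (s t : additive_hull B) (h : hom s t) i i' j j'
    (ei : i' = i) (ej : j' = j) (a : summand i = summand i') (b : summand j' = summand j) :
  eqhom b \oc (h i' j' \oc eqhom a) = h i j.
Proof. by subst i' j'; rewrite !eqhom_id comp1c compc1. Qed.

Lemma hull_full : full F -> full hull_functor.
Proof.
move=> fF s t h.
have ex i j := fF _ _ (eqhom (@summand_remap t j) \oc
  (h (@remap s i) (@remap t j) \oc eqhom (esym (@summand_remap s i)))).
exists (fun i j => projT1 (cid (ex i j))); apply: hhomP => i j.
change (hull_map (fun i j => projT1 (cid (ex i j))) i j = h i j).
rewrite /hull_map (projT2 (cid (ex (unmap i) (unmap j)))).
have ei := unmapK i; have ej := unmapK j.
have a : @summand k B (map F s) i = @summand k B (map F s) (remap (unmap i)) by rewrite ei.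
have b : @summand k B (map F t) (remap (unmap j)) = @summand k B (map F t) j by rewrite ej.
rewrite -(hull_entry h ei ej a b) -!compA (eqhom_comp _ _ a) !compA.
by rewrite (eqhom_comp _ _ b).
Qed.

End HullFunctor.

Section Embedding.
Variables (k : fieldType) (A : kcat k).

Definition emb_map (X Y : A) (f : hom X Y) : @hom k (additive_hull A) [:: X] [:: Y] :=
  fun i j => ecast i (hom (@summand k A [:: X] i) (@summand k A [:: Y] j)) (esym (ord1 i))
    (ecast j (hom (@summand k A [:: X] ord0) (@summand k A [:: Y] j)) (esym (ord1 j)) f).

Lemma emb_mapE (X Y : A) (f : hom X Y) : emb_map f ord0 ord0 = f.
Proof. by rewrite /emb_map !eq_axiomK. Qed.

Lemma emb_homP (X Y : A) (f g : @hom k (additive_hull A) [:: X] [:: Y]) :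
  f ord0 ord0 = g ord0 ord0 -> f = g.
Proof. by move=> fg; apply: hhomP => i j; rewrite (ord1 i) (ord1 j). Qed.

Definition emb : kfunctor A (additive_hull A).
Proof.
refine (@KFunctor k A (additive_hull A) (fun X => [:: X]) emb_map _ _ _).
- by move=> X; apply: emb_homP; rewrite emb_mapE; apply: esym; apply: hidE.
- move=> X Y Z g f; apply: emb_homP; rewrite emb_mapE.
  change (g \oc f = \sum_j (emb_map g j ord0 \oc emb_map f ord0 j)).
  by rewrite big_ord1 !emb_mapE.
move=> X Y a f g; apply: emb_homP; rewrite emb_mapE.
change (a *: f + g = a *: emb_map f ord0 ord0 + emb_map g ord0 ord0).
by rewrite !emb_mapE.
Defined.

Lemma emb_faithful : faithful emb.
Proof. by move=> X Y f g fg; rewrite -(emb_mapE f) -(emb_mapE g); congr (_ ord0 ord0). Qed.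

Lemma emb_full : full emb.
Proof. by move=> X Y h; exists (h ord0 ord0); apply: emb_homP; apply: emb_mapE. Qed.

Lemma hull_nil_zero : @zero_object k (additive_hull A) [::].
Proof. by apply: hhomP => -[]. Qed.

Lemma hull_sumE (I : finType) (s t : seq A) (f : I -> @hom k (additive_hull A) s t) a b :
  (\sum_i f i : hhom s t) a b = \sum_i (f i : hhom s t) a b.
Proof. by elim/big_rec2: _ => // i x y _ <-. Qed.

(** The maps [g i] partition the positions of [s]; injections and projections are the corresponding
    matrices with identities and zeros as entries. *)
Lemma hull_direct_sum (I : finType) (ss : I -> seq A) (s : seq A)
    (g : forall i, 'I_(size (ss i)) -> 'I_(size s))
    (gE : forall i a, @summand k A (ss i) a = @summand k A s (g i a)) :
  (forall i, injective (g i)) -> (forall i j a b, i != j -> g i a != g j b) ->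
  (forall c, exists i a, g i a = c) -> @is_direct_sum k (additive_hull A) I ss s.
Proof.
move=> g_inj g_dis g_surj.
pose J i : @hom k (additive_hull A) (ss i) s := fun a c =>
  if @eqP _ (g i a) c is ReflectT e
  then eqhom (etrans (gE i a) (congr1 (@summand k A s) e)) else 0.
pose J' i : @hom k (additive_hull A) s (ss i) := fun c a =>
  if @eqP _ (g i a) c is ReflectT e
  then eqhom (esym (etrans (gE i a) (congr1 (@summand k A s) e))) else 0.
have JE i a e : J i a (g i a) = @eqhom k A _ _ e.
  by rewrite /J; case: eqP => // e'; congr eqhom; apply: Prop_irrelevance.
have J'E i a e : J' i (g i a) a = @eqhom k A _ _ e.
  by rewrite /J'; case: eqP => // e'; congr eqhom; apply: Prop_irrelevance.
have J0 i a c : g i a != c -> J i a c = 0 by rewrite /J; case: eqP.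
have J'0 i a c : g i a != c -> J' i c a = 0 by rewrite /J'; case: eqP.
exists J, J'; split=> [i|i j ij|].
- apply: hhomP => a b; change (\sum_c (J' i c b \oc J i a c) = @hid k A (ss i) a b).
  rewrite (bigD1 (g i a)) //= big1 ?addr0; last first.
    by move=> c ca; rewrite (J0 i a c) ?compc0 // eq_sym.
  rewrite (JE _ _ (gE i a)); have [<-|ab] := eqVneq a b.
    by rewrite (J'E _ _ (esym (gE i a))) eqhomK hidE.
  by rewrite hidN // J'0 ?comp0c // (inj_eq (g_inj i)) eq_sym.
- apply: hhomP => a b; change (\sum_c (J' j c b \oc J i a c) = 0).
  rewrite big1 // => c _; have [<-|h] := eqVneq (g i a) c; last by rewrite J0 // compc0.
  by rewrite J'0 ?comp0c //; apply: g_dis; rewrite eq_sym.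
apply: hhomP => c d; rewrite hull_sumE; have [i0 [a0 <-]] := g_surj c.
change (\sum_i \sum_a (J i a d \oc J' i (g i0 a0) a) = @hid k A s (g i0 a0) d).
rewrite (bigD1 i0) //= [X in _ + X]big1 ?addr0; last first.
  by move=> i ii; rewrite big1 // => a _; rewrite J'0 ?compc0 // g_dis.
rewrite (bigD1 a0) //= big1 ?addr0; last first.
  by move=> a arc_cases; rewrite J'0 ?compc0 // (inj_eq (g_inj i0)).
rewrite (J'E _ _ (esym (gE i0 a0))); have [<-|h] := eqVneq (g i0 a0) d.
  by rewrite (JE _ _ (gE i0 a0)) eqhomK hidE.
by rewrite J0 // comp0c hidN.
Qed.

Lemma hull_cons (X : A) (s : seq A) :
  @is_direct_sum k (additive_hull A) bool (fun b => if b then [:: X] else s) (X :: s).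
Proof.
pose g b : 'I_(size (if b then [:: X] else s)) -> 'I_(size (X :: s)) :=
  if b return 'I_(size (if b then [:: X] else s)) -> 'I_(size (X :: s))
  then fun _ => ord0 else fun i => lift ord0 i.
apply: (@hull_direct_sum bool (fun b => if b then [:: X] else s) (X :: s) g).
- move=> [] i; last by rewrite /summand !(tnth_nth X).
  by rewrite (ord1 i).
- case=> i j; first by rewrite (ord1 i) (ord1 j).
  exact: lift_inj.
- by case=> -[] a b.
move=> c; have [j ->|->] := unliftP ord0 c; first by exists false, j.
by exists true, ord0.
Qed.

End Embedding.

Section Sigma.
Variables (n : nat) (k : fieldType).

Implicit Types M N X : tedge n.

Lemma esigmaK : involutive (@esigma n).
Proof. by case=> [p|[a []]]. Qed.

Lemma move_sigma M N : move (esigma M) (esigma N) = move M N.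
Proof. by case: M N => [p|[a e]] [q|[b f]]. Qed.

Lemma esigma_tau N : esigma (etau N) = etau (esigma N).
Proof. by case: N => [p|[a e]]. Qed.

Lemma ep_sigma M : ep (esigma M) = ep M. Proof. by case: M => [p|[a e]]. Qed.
Lemma el_sigma M : el (esigma M) = el M. Proof. by case: M => [p|[a e]]. Qed.
Lemma et_sigma M : el M = n -> et (esigma M) = ~~ et M.
Proof. by case: M => [p|[a e]] // h; have [] := el_arc p; rewrite h ltnn. Qed.

Let G := fun M N : tedge n => is_true (move M N).

Definition sgen M N (mv : G M N) : mhom k (esigma M) (esigma N) :=
  mcls (TGen k (etrans (move_sigma M N) mv : G (esigma M) (esigma N))).

Local Notation seval := (@teval k (tedge n) G (mcat n k) (@esigma n) sgen _ _).

Lemma seval_arrow M N : seval (@arrow n k M N) = ar (esigma M) (esigma N).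
Proof.
have [h|h] := boolP (move M N); last first.
  rewrite ar0 ?move_sigma // /arrow if_reflectF //.
have [p] := @if_reflectT _ _ (@idP (move M N)) _ (fun p => TGen k (p : G M N)) (TZero k _ M N) h.
rewrite /arrow => -> /=; rewrite /sgen /ar /arrow.
have h' : move (esigma M) (esigma N) by rewrite move_sigma.
have [p' ->] := @if_reflectT _ _ (@idP (move (esigma M) (esigma N))) _
  (fun p => TGen k (p : G (esigma M) (esigma N))) (TZero k _ (esigma M) (esigma N)) h'.
by congr (pcls _ (TGen _ _)); apply: bool_irrelevance.
Qed.

Lemma seval_rel M N (s t : term k G M N) : mesh_rel s t -> seval s = seval t.
Proof.
case=> {M N s t} N /=.
have -> : forall s : seq (tedge n),
    seval (TSum s (fun X => TComp (@arrow n k X N) (@arrow n k (etau N) X)))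
    = \sum_(X <- map (@esigma n) s) (ar X (esigma N) \oc ar (esigma (etau N)) X).
  by elim=> [|X s IH]; rewrite ?big_nil ?big_cons //= !seval_arrow IH.
refine (@mesh_seq n k (esigma N) (esigma (etau N)) (map (@esigma n) (enum (tedge n))) _ _ _).
- exact: esigma_tau.
- by rewrite (map_inj_uniq (can_inj esigmaK)) enum_uniq.
by move=> X _ _; rewrite -(esigmaK X) map_f // mem_enum.
Qed.

Definition sfun : kfunctor (mcat n k) (mcat n k) := lift_functor seval_rel.

Lemma sfun_cls M N (s : term k G M N) :
  fmap sfun (mcls s : mhom k M N) = seval s.
Proof. exact: (teval_repr seval_rel). Qed.

Lemma eqhom_gen M N M' N' (eM : M' = M) (eN : N' = N) (g : G M N) (g' : G M' N') :
  @eqhom k (mcat n k) _ _ eN \oc (mcls (TGen k g') : mhom k M' N') =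
  (mcls (TGen k g) : mhom k M N) \oc @eqhom k (mcat n k) _ _ eM.
Proof.
subst M' N'; rewrite !eqhom_id comp1c compc1.
by congr (pcls _ (TGen _ _)); apply: bool_irrelevance.
Qed.

(** [esigma] is involutive only up to propositional equality, so the square of [sfun] is the
    identity up to transport. This natural isomorphism suffices for [sfun] to be full and
    faithful. *)
Lemma sfunK M N (f : mhom k M N) :
  @eqhom k (mcat n k) _ _ (esigmaK N) \oc fmap sfun (fmap sfun f) =
  f \oc @eqhom k (mcat n k) _ _ (esigmaK M).
Proof.
move: f; apply: phom_ind; elim=> {M N} [M N g|M|M N P s IHs t IHt|M N|M N s IHs t IHt|M N a s IHs].
- have E1 := sfun_cls (TGen k (g : G M N)).
  have E2 := sfun_cls (TGen k (etrans (move_sigma M N) g : G (esigma M) (esigma N))).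
  refine (etrans (congr1 (fun u => _ \oc fmap sfun u) E1) _).
  refine (etrans (congr1 (fun u => _ \oc u) E2) _).
  exact: eqhom_gen.
- have -> : mcls (TId k G M) = idc (M : mcat n k) by [].
  by rewrite !fmap_id comp1c compc1.
- have -> : mcls (TComp s t) =
      comp (mcls s : mhom k N P)
        (mcls t : mhom k M N).
    by rewrite -pcompE.
  rewrite !fmap_comp compA IHs -!compA.
  exact: (congr1 (fun u => (mcls s : mhom k N P) \oc u) IHt).
- by rewrite pcls0 !fmap0 compc0 comp0c.
- by rewrite pclsD !fmapD compDr compDl IHs IHt.
by rewrite pclsZ !fmapZ compZr compZl IHs.
Qed.

Lemma sfun_nat : natiso (fun_comp sfun sfun) (fun_id (mcat n k)).
Proof.
refine (@NatIso k _ _ (fun_comp sfun sfun) (fun_id (mcat n k))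
  (fun M => @eqhom k (mcat n k) _ _ (esigmaK M))
  (fun M => @eqhom k (mcat n k) _ _ (esym (esigmaK M))) _ _ _).
- by move=> M; apply: eqhomK.
- by move=> M; apply: eqhomK.
by move=> M N f; apply: sfunK.
Qed.

Lemma sfun_faithful : faithful sfun.
Proof. exact: natiso_faithful sfun_nat. Qed.

Lemma sfun_full : full sfun.
Proof. exact: natiso_full sfun_nat sfun_faithful. Qed.

End Sigma.

(** * The cluster category *)

Lemma shiftn_inj n e p p' : (p < n)%N -> (p' < n)%N -> (e <= n)%N ->
  shiftn n p e = shiftn n p' e -> p = p'.
Proof. by rewrite /shiftn; case: (ltnP (p + e)); case: (ltnP (p' + e)); lia. Qed.

Section Cluster.
Variables (k : fieldType) (n : nat) (H : algType k) (CH : cluster_category H).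

(** [orb_eta] makes [tau^-1[1]] isomorphic to the identity after projection, and shift and [tau] are
    both induced from the derived category. *)
Lemma shift_tau_isom (Z : CH) : isom (cl_shift CH Z) (cl_tau CH Z).
Proof.
have [Y ZY] := orb_surj Z; pose F := fun_comp (einv (ar_tau (cl_ar CH))) (Db_shift H).
apply: isom_trans (fmap_isom (cl_shift CH) ZY) _.
apply: isom_trans (isom_sym (fmap_isom (cl_tau CH) ZY)).
apply: isom_trans (natiso_isom (cl_shift_induced CH) Y) _.
apply: (@isom_trans _ _ _ (cl_tau CH (orb_pi CH (F Y)))); last first.
  exact: fmap_isom (natiso_isom (orb_eta CH) Y).
apply: isom_trans (isom_sym (natiso_isom (cl_tau_induced CH) (F Y))).
apply: (fmap_isom (orb_pi CH)); apply: isom_sym.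
exact: (natiso_isom (ecounit (ar_tau (cl_ar CH))) (Db_shift H Y)).
Qed.

Hypothesis n5 : (5 <= n)%N.
Let n2 : (2 <= n)%N := leq_trans (isT : (2 <= 5)%N) n5.
Variable phi : tagged_equiv n CH.

Definition Phi : kfunctor (mcat n k) CH := fun_comp phi (emb (mcat n k)).

Lemma Phi_faithful : faithful Phi.
Proof. exact: comp_faithful (@efun_faithful _ _ _ phi) (@emb_faithful _ _). Qed.

Lemma Phi_full : full Phi.
Proof. exact: comp_full (@efun_full _ _ _ phi) (@emb_full _ _). Qed.

Lemma Phi_tau (M : tedge n) : isom (Phi (etau M)) (cl_tau CH (Phi M)).
Proof. exact: (te_tau phi [:: M]). Qed.

Lemma aug0 (M : tedge n) : aug (0 : mhom k M M) = 0.
Proof.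
have := @aug_lin n k M (-1) 0 0.
by rewrite scaler0 addr0 mulN1r addNr.
Qed.

Lemma mesh_id_neq0 (M : tedge n) : idc (M : mcat n k) <> 0.
Proof.
move=> h; have := aug1 (M : mcat n k); rewrite h.
rewrite aug0 => /eqP; by rewrite eq_sym oner_eq0.
Qed.

(** By [mesh_end] the composite is a scalar multiple of the identity, and the augmentation shows the
    scalar to be 0. *)
Lemma mesh_through (M N : tedge n) (g : mhom k N M) (f : mhom k M N) :
  M <> N -> g \oc f = 0.
Proof.
move=> MN; have [c h] := mesh_end n5 (g \oc f); have := aug_through g f MN.
have := @aug_lin n k M c (idc (M : mcat n k)) 0.
by rewrite addr0 aug1 aug0 addr0 mulr1 h => -> ->; rewrite scale0r.
Qed.

Lemma Phi_bricks (M : 'I_n -> tedge n) : injective M -> bricks (fun i => Phi (M i)).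
Proof.
move=> M_inj; split=> [i f|i|i j f g ij].
- have [f0 <-] := Phi_full f; have [c ->] := mesh_end n5 f0.
  by exists c; rewrite fmapZ fmap_id.
- rewrite -(fmap_id Phi) => h; apply: (@mesh_id_neq0 (M i)).
  by apply: Phi_faithful; rewrite h fmap0.
have [f0 <-] := Phi_full f; have [g0 <-] := Phi_full g.
by rewrite -fmap_comp mesh_through ?fmap0 // => /M_inj.
Qed.

Lemma Phi_hom (M N : tedge n) : (exists f : hom (Phi M) (Phi N), f <> 0) <->
  (exists f : mhom k M N, f <> 0).
Proof.
split=> -[f nz].
  by have [g gf] := Phi_full f; exists g => g0; apply: nz; rewrite -gf g0 fmap0.
by exists (fmap Phi f) => h; apply: nz; apply: Phi_faithful; rewrite h fmap0.
Qed.

Definition sum_of (T : CH) (M : 'I_n -> tedge n) : Prop := is_direct_sum (fun i => Phi (M i)) T.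

(** Splitting the first edge off the list corresponding to [Z] leaves a zero object, since the image
    of an edge is nonzero. *)
Lemma indecomposable_edge (Z : CH) : indecomposable Z -> exists M, isom Z (Phi M).
Proof.
case=> nz dec; pose s := einv phi Z.
have es : isom (phi s) Z by exact: (natiso_isom (ecounit phi) Z).
case: s es => [|M s] es.
  case: nz; apply: isom_zero es _; rewrite /zero_object -fmap_id.
  by rewrite (@hull_nil_zero k (mcat n k)) fmap0.
have d : is_direct_sum (fun b : bool => if b then Phi M else phi s) Z.
  apply: is_direct_sum_iso es (fmap_direct_sum phi (@hull_cons k (mcat n k) M s)).
  by case; apply: isom_refl.
exists M; case: (dec _ _ d) => [z|z].
  case: (@mesh_id_neq0 M); apply: Phi_faithful; rewrite fmap_id fmap0.
  exact: z.
case: d => inj [prj [p1 _ i1]]; exists (prj true), (inj true); split; last exact: (p1 true).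
rewrite -[RHS]i1 big_bool /= [X in _ + X](_ : _ = 0) ?addr0 //.
by rewrite -(comp1c (prj false)) z comp0c compc0.
Qed.

Lemma tilting_edges (T : CH) : basic_tilting n T -> exists M : 'I_n -> tedge n,
  [/\ injective M, sum_of T M & forall i j,
    ~~ cross n (el (M i)) (et (M i)) (dist n (ep (M i)) (ep (M j))) (el (M j)) (et (M j))].
Proof.
case=> -[Ts [Tind Tdist dT]] ext.
have [M MP] := choice (fun i => indecomposable_edge (Tind i)).
have dTM : sum_of T M by apply: is_direct_sum_iso (isom_refl T) dT.
exists M; split=> // [i j Mij|i j].
  apply/eqP; apply: contraT => /Tdist []; apply: isom_trans (MP i) _.
  by rewrite Mij; apply: isom_sym.
(* A crossing gives a nonzero map from the summand [i] to [tau] of the summand [j]; extended by zero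
   it becomes a map from [T] to its shift, which must vanish. *)
apply/negP => /(cross_nz k n5)[f]; apply; apply: Phi_faithful; rewrite fmap0.
have [u [v [vu uv]]] := Phi_tau (M j).
have [u' [v' [vu' uv']]] := shift_tau_isom T.
case: dTM => inj [prj [p1 _ _]].
have := ext (v' \oc (fmap (cl_tau CH) (inj j) \oc (u \oc fmap Phi f \oc prj i))).
move=> h; have := congr1 (fun g => v \oc (fmap (cl_tau CH) (prj j) \oc (u' \oc g)) \oc inj i) h.
rewrite /= !compc0 comp0c => <-.
rewrite (compA u') uv' comp1c (compA (fmap _ _)) -fmap_comp p1 fmap_id comp1c.
by rewrite -!compA (compA v) vu comp1c p1 compc1.
Qed.

Lemma sum_of_tau (T : CH) M : sum_of T M -> sum_of (cl_tau CH T) (@etau n \o M).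
Proof.
move=> d; apply: is_direct_sum_iso (isom_refl _) (fmap_direct_sum (cl_tau CH) d) => i.
exact: isom_sym (Phi_tau _).
Qed.

Lemma sum_of_sigma (T : CH) M : sum_of T M -> sum_of (sigma phi T) (@esigma n \o M).
Proof.
move=> d; have := fmap_direct_sum (hull_functor (sfun n k)) (fmap_direct_sum (einv phi) d).
move/(fmap_direct_sum phi); apply: is_direct_sum_iso (isom_refl _) => i.
have : isom (einv phi (Phi (M i))) [:: M i] := isom_sym (natiso_isom (eunit phi) [:: M i]).
by move/(fmap_isom (hull_functor (sfun n k)))/(fmap_isom phi).
Qed.

Lemma sum_of_isom (T T' : CH) M M' (q : 'I_n -> 'I_n) : injective q ->
  (forall i, M i = M' (q i)) -> sum_of T M -> sum_of T' M' -> isom T T'.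
Proof. by move=> qi h; apply: isom_direct_sum qi _ => i; rewrite h; apply: isom_refl. Qed.

Lemma sum_of_tau_pow (T : CH) M e : sum_of T M -> sum_of (tau_pow e%:Z T) (iter e (@etau n) \o M).
Proof. by move=> d; elim: e => [|e IH] //; apply: sum_of_tau IH. Qed.

Lemma endop_tau_pow (T : CH) i : endop_isomorphic T (tau_pow i T).
Proof.
have step (F : kfunctor CH CH) : full F -> faithful F -> forall m, endop_isomorphic T (iter m F T).
  move=> fu fa; elim=> [|m IH]; first exact: endop_iso_isom (isom_refl _).
  exact: endop_iso_trans IH (endop_iso_functor _ fu fa).
case: i => m; apply: step; [exact: efun_full|exact: efun_faithful|exact: einv_full|].
exact: einv_faithful.
Qed.

Definition sigma_functor : kfunctor CH CH :=
  fun_comp phi (fun_comp (hull_functor (sfun n k)) (einv phi)).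

Lemma sigma_faithful : faithful sigma_functor.
Proof.
apply: comp_faithful (@efun_faithful _ _ _ phi) (comp_faithful _ (@einv_faithful _ _ _ phi)).
exact: hull_faithful (@sfun_faithful n k).
Qed.

Lemma sigma_full : full sigma_functor.
Proof.
apply: comp_full (@efun_full _ _ _ phi) (comp_full _ (@einv_full _ _ _ phi)).
exact: hull_full (@sfun_full n k).
Qed.

Lemma endop_sigma (T : CH) : endop_isomorphic T (sigma phi T).
Proof. exact: (endop_iso_functor T sigma_full sigma_faithful). Qed.

Lemma iter_etau (e : nat) (M : tedge n) :
  [/\ el (iter e (@etau n) M) = el M,
      (e <= n)%N -> shiftn n (ep (iter e (@etau n) M)) e = ep M
    & el M = n -> et (iter e (@etau n) M) = odd e (+) et M].
Proof.
elim: e => [|e [IH1 IH2 IH3]] /=.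
  by split=> // _; rewrite /shiftn addn0 ep_lt.
split=> [|en|l]; first by rewrite el_tau.
  rewrite -IH2 1?ltnW // (ep_tau n2); have := ep_lt (iter e (@etau n) M).
  move: (ep _) => p hp; rewrite /shiftn; case: (ltnP (p + e)%N n) => h1;
  by case: (ltnP (p + (n - 1))%N n) => h2; [case: (ltnP (p + (n - 1) + e.+1)%N n)
    |case: (ltnP (p + (n - 1) - n + e.+1)%N n)]; lia.
by rewrite et_tau ?IH1 // IH3 // addNb.
Qed.

Definition edges_tri (M : 'I_n -> tedge n) (M_inj : injective M)
  (M_cross : forall i j,
    ~~ cross n (el (M i)) (et (M i)) (dist n (ep (M i)) (ep (M j))) (el (M j)) (et (M j))) : tri n :=
  @Tri n n5 (fun i => ep (M i)) (fun i => el (M i)) (fun i => et (M i))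
    (fun i => ep_lt (M i)) (fun i => el_bounds n2 (M i))
    (fun i j h1 h2 h3 => M_inj _ _ (edge_inj h1 h2 h3)) M_cross.

(** The non-crossing hypothesis is used for nonvanishing in the reflected region; a tilting object
    satisfies it for all pairs of summands. *)
Lemma ehitsP (M N : tedge n) :
  ~~ cross n (el N) (et N) (dist n (ep N) (ep M)) (el M) (et M) ->
  ehits M N <-> exists f : hom (Phi M) (Phi N), f <> 0.
Proof.
move=> h; rewrite Phi_hom; split; first exact: hits_nz.
by case=> f nz; apply/negPn/negP => h0; apply: nz; exact: (mesh_hom0 n5 f h0).
Qed.

Theorem tilting_endop (T T' : CH) : basic_tilting n T -> basic_tilting n T' ->
  endop_isomorphic T T' <->
  (exists i : int, isom T (tau_pow i T')) \/
  (exists j : int, isom T (sigma phi (tau_pow j T'))).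
Proof.
move=> hT hT'; split; last first.
  case=> -[i /endop_iso_isom h]; apply: endop_iso_trans h _; apply: endop_iso_sym.
    exact: endop_tau_pow.
  exact: endop_iso_trans (endop_tau_pow _ _) (endop_sigma _).
move=> hE; have [M [M_inj dM cM]] := tilting_edges hT; have [M' [M_inj' dM' cM']] := tilting_edges hT'.
have [q [q_inj hq]] := brick_transfer (Phi_bricks M_inj) (Phi_bricks M_inj') dM dM' hE.
have rlE i j : rl (edges_tri M_inj cM) i j =
    rl (edges_tri (inj_comp M_inj' q_inj) (fun i j => cM' (q i) (q j))) i j.
  rewrite /rl; congr andb; apply/idP/idP => h.
    by apply/(ehitsP (cM' _ _))/hq/ehitsP.
  by apply/(ehitsP (cM _ _))/hq/ehitsP.
have [e [b [en /choice[y yP]]]] := tri_rigid rlE.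
(* Turning back by [tau^e] restores starts and levels. Each [tau] flips tags, so the tags at level
   [n] differ from those of [M] by the constant bit [odd e (+) b]; [sigma] corrects it when the bit
   is 1. *)
pose N i := iter e (@etau n) (M' (q (y i))).
have NP i : [/\ el (N i) = el (M i), ep (N i) = ep (M i)
    & el (M i) = n -> et (N i) = (odd e (+) b) (+) et (M i)].
  have [/= y1 y2 y3] := yP i; have [i1 i2 i3] := iter_etau e (M' (q (y i))).
  split; first by rewrite i1.
    apply: (@shiftn_inj n e); rewrite ?ep_lt // i2 //; exact: y2.
  by move=> l; rewrite i3 ?y1 // y3 ?addbA // /rd /= l.
have y_inj : injective y.
  move=> i j yij; have [a1 a2 a3] := yP i; have [b1 b2 b3] := yP j.
  have [c1 c2 c3] := NP i; have [d1 d2 d3] := NP j.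
  have Nij : N i = N j by rewrite /N yij.
  apply: (M_inj i j); apply: edge_inj; rewrite -?c1 -?c2 ?Nij //.
  by move=> l; apply: (@addbI (odd e (+) b)); rewrite -c3 -?d3 -?c1 -?d1 ?Nij.
have qy_inj := inj_comp q_inj y_inj.
have [h|h] := boolP (odd e (+) b); [right|left]; exists e%:Z.
  apply: (sum_of_isom qy_inj _ dM (sum_of_sigma (sum_of_tau_pow e dM'))) => i /=.
  have [c1 c2 c3] := NP i; apply: edge_inj; rewrite ?ep_sigma ?el_sigma //.
  by move=> l; rewrite et_sigma ?c1 // c3 // h addTb negbK.
apply: (sum_of_isom qy_inj _ dM (sum_of_tau_pow e dM')) => i /=.
have [c1 c2 c3] := NP i; apply: edge_inj => // l; rewrite c3 // (negPf h) addFb.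
by [].
Qed.

End Cluster.

Theorem theorem4p1 (k : fieldType) (n : nat) (hn : (5 <= n)%N)
    (H : algType k) (hH : hereditary_of_type_D n H)
    (CH : cluster_category H) (phi : tagged_equiv n CH)
    (T T' : CH) (hT : basic_tilting n T) (hT' : basic_tilting n T') :
  endop_isomorphic T T' <->
  (exists i : int, isom T (tau_pow i T')) \/
  (exists j : int, isom T (sigma phi (tau_pow j T'))).
Proof. exact: tilting_endop. Qed.
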